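(* Let $H$ be a finite group, $\ell$ a prime such that $|H|$ is not divisible by any prime smaller than $\ell$, and $1\to C_\ell\to G\to H\to1$ a central extension. Let $m\ge1$ and assume that there are constants $c(k)>0$ for the number fields $k$ of degree $m$ and, for every $\delta>0$, a constant $c(m,H,\delta)$ such that $Z(k,H;x)\le c(m,H,\delta)\,c(k)\,x^{a(H)+\delta}$ for every number field $k$ with $[k:\mathbb Q]=m$. Then for every $\epsilon>0$ there exists a constant $c(m,G,\epsilon)$ such that for all number fields $k$ of degree $m$, $$Z(k,G;x)\le c(m,G,\epsilon)\,c(k)\,|\mathrm{Cl}(\tilde k)_\ell|\,x^{a(G)+\epsilon}\quad\text{for all }x>0.$$
   Context: Groups are taken in their regular permutation representations: $Z(k,G;x)$ is the number of Galois extensions of $k$ (inside a fixed algebraic closure) with group isomorphic to $G$ and norm of the discriminant at most $x$. For a permutation $g$ of a finite set $M$, $\mathrm{ind}(g)=|M|-(\text{number of orbits of } g)$; for $G\ne1$, $a(G)=(\min\{\mathrm{ind}(g):1\ne g\in G\})^{-1}$, $a(1)=0$. $\tilde k=k(\zeta)$ with $\zeta$ a primitive $\ell$-th root of unity, and $\mathrm{Cl}(\tilde k)_\ell$ is the largest elementary abelian $\ell$-quotient of the class group of $\tilde k$. *)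

(* Defs.v *)
From HB Require Import structures.
From mathcomp Require Import all_boot all_order all_algebra all_fingroup.
From mathcomp Require Import all_solvable all_field.
From mathcomp Require Import all_classical all_reals all_analysis.

Set Implicit Arguments.
Unset Strict Implicit.
Unset Printing Implicit Defensive.

Import Order.TTheory GRing.Theory Num.Theory.
Local Open Scope ring_scope.

Definition perm_ind (M : finType) (g : {perm M}) : nat :=
  #|M| - #|porbits g|.

(* Every perm_ind is at most #|M|, so the neutral element #|M| of the big
   minimum is harmless as soon as A contains a nontrivial permutation. *)
Definition perm_a (R : realType) (M : finType) (A : {group {perm M}}) : R :=
  if A :==: 1%g then 0
  else (\big[minn/#|M|]_(g in A^#%g) perm_ind g)%:R^-1.

Definition regular_a (R : realType) (G : finGroupType) : R :=
  perm_a R (actperm 'R @* [set: G])%G.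

Definition central_extension (A G H : finGroupType) : Prop :=
  exists (i : {morphism [set: A] >-> G}) (p : {morphism [set: G] >-> H}),
    [/\ 'injm i, i @* [set: A] = 'ker p, p @* [set: G] = [set: H]
      & i @* [set: A] \subset 'Z([set: G])]%g.

Local Open Scope classical_set_scope.

(* Number fields are realised as subfields of algC, which is the fixed
   algebraic closure of all of them; fields, rings and ideals are subsets of
   algC. *)
Definition number_field (m : nat) (k : set algC) : Prop :=
  exists (L : fieldExtType rat) (iota : {rmorphism L -> algC}),
    range iota = k /\ \dim {:L} = m.

(* L is an auxiliary ambient normal number field containing K and k. *)
Definition galois_extension (k K : set algC) (G : finGroupType) : Prop :=
  exists (L : splittingFieldType rat) (iota : {rmorphism L -> algC})
         (F E : {subfield L}),
    [/\ iota @` [set` F] = k, iota @` [set` E] = K, galois F E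
      & ('Gal(E / F) \isog [set: G]%SET)%g].

Definition adjoin (k : set algC) (z : algC) : set algC :=
  smallest [set F : set algC | divring_closed (mem F)] (k `|` [set z]).

Definition ring_of_integers (k : set algC) : set algC :=
  k `&` [set x | x \in Aint].

(* The finite sums of products: the ideal product if A and B are fractional
   ideals, the A-submodule generated by B if A is a ring. *)
Definition span_mul (A B : set algC) : set algC :=
  [set x | exists n (a b : 'I_n -> algC),
     [/\ forall i, A (a i), forall i, B (b i) & x = \sum_i a i * b i]].

Definition basis_over (k K : set algC) n (b : 'I_n -> algC) : Prop :=
  (forall i, K (b i)) /\
  (forall x, K x -> exists! c : 'rV[algC]_n,
     (forall i, k (c 0 i)) /\ x = \sum_i c 0 i * b i).

(* t is the trace of the k-linear endomorphism y |-> x * y of K. *)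
Definition is_trace (k K : set algC) (x t : algC) : Prop :=
  exists n (b : 'I_n -> algC) (M : 'M[algC]_n),
    [/\ basis_over k K b, forall i j, k (M i j),
        forall i, x * b i = \sum_j M i j * b j & t = \tr M].

Definition basis_discriminants (k K : set algC) : set algC :=
  [set d | exists n (b : 'I_n -> algC) (T : 'M[algC]_n),
     [/\ basis_over k K b, forall i, b i \in Aint,
         forall i j, is_trace k K (b i * b j) (T i j) & d = \det T]].

Definition discriminant (k K : set algC) : set algC :=
  span_mul (ring_of_integers k) (basis_discriminants k K).

(* Absolute norm of an ideal: the number of cosets of I in the ring of
   integers of k. *)
Definition ideal_norm (R : realType) (k I : set algC) : \bar R :=
  counting [set [set x + y | y in I] | x in ring_of_integers k].

(* A cardinality, hence +oo if there were infinitely many such extensions. *)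
Definition Zcount (R : realType) (k : set algC) (G : finGroupType) (x : R) :
    \bar R :=
  counting [set K | galois_extension k K G /\
                    (ideal_norm R k (discriminant k K) <= x%:E)%E].

Definition fractional_ideal (K I : set algC) : Prop :=
  exists s : seq algC,
    [/\ [set` s] `<=` K, I = span_mul (ring_of_integers K) [set` s]
      & exists2 x, I x & x != 0].

Definition ideal_class (K I : set algC) : set (set algC) :=
  [set [set a * x | x in I] | a in [set a | K a /\ a != 0]].

Definition class_group (K : set algC) : set (set (set algC)) :=
  [set ideal_class K I | I in fractional_ideal K].

(* The products of members of two classes form exactly one class. *)
Definition class_mul (c d : set (set algC)) : set (set algC) :=
  [set span_mul I J | I in c & J in d].

Definition class_group_abelem_quotient (l : nat) (K : set algC)
    (Q : finGroupType) : Prop :=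
  (l.-abelem [set: Q]%SET)%g /\
  exists f : set (set algC) -> Q,
    (forall c d, class_group K c -> class_group K d ->
       f (class_mul c d) = (f c * f d)%g) /\
    (forall q, exists2 c, class_group K c & f c = q).

(* The order of the largest elementary abelian l-quotient of the class
   group. *)
Definition card_class_group_ell (R : realType) (l : nat) (K : set algC) :
    \bar R :=
  ereal_sup [set e | exists2 Q : finGroupType,
    class_group_abelem_quotient l K Q & e = (#|Q|%:R)%:E].

(* Main.v *)
(** The group [G] of [K/k] is a central extension of [H] by a group [A] of
    prime order [l]; let [N] be the fixed field of [A], so that [N/k] has
    group [H].  The fields [K] are counted fibrewise over the fields [N].

    Two fields [K], [K0] over the same [N], with the same identification of
    the quotient [H], differ by a homomorphism into [A] from the absolute
    Galois group of [k], which Kummer theory over [k(zeta)] encodes by a class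
    modulo [l]-th powers.  This class lies in the Selmer group of the primes
    at which [K] or [K0] ramifies, whose order is [|Cl_l|] times a factor
    exponential in the number of these primes, that is, up to a constant,
    at most an arbitrarily small power of [x].

    If [r] is the product of the primes that ramify in [K] but divide neither
    [l] nor the discriminant of [N], then [D_N^l * r^(|H|(l-1)) <= D_K]: the
    discriminant of a tower gives [D_N^l], and over each prime divisor of [r]
    some prime of [k] is tamely ramified in [K/N], which gives the exponent
    [|H|(l-1)].  Since [1/(|H|(l-1)) <= a(G)] and [a(H) <= l/(|H|(l-1))],
    summing the bound for [H] at [(x / r^(|H|(l-1)))^(1/l)] over [r] gives a
    harmonic sum.

    Everything takes place inside [algC]: the Galois group of [K/k] is a
    quotient of the automorphisms of [algC] fixing [k], primes of [k] are
    contractions of prime ideals of the ring of all algebraic integers, and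
    ramification is tested by Noether's different instead of decomposition
    groups. *)
Require Import Defs.
From HB Require Import structures.
From mathcomp Require Import all_boot all_order all_algebra all_fingroup.
From mathcomp Require Import all_solvable all_field.
From mathcomp Require Import all_classical all_reals all_analysis.
From mathcomp Require Import ring lra zify.

Set Implicit Arguments.
Unset Strict Implicit.
Unset Printing Implicit Defensive.

Import Order.TTheory GRing.Theory Num.Theory.
Local Open Scope classical_set_scope.
Local Open Scope ring_scope.

(** * Number fields inside algC *)

(** The shape of the proof is dictated by uniformity: apart from the allowed factors, the constant
    may not depend on [k]. No regulator or field discriminant may survive. For [k(zeta)] only the
    degree, at most [m * l], and a class group quotient are kept: at most [n] primes lie over a
    rational prime, and units modulo [l]-th powers number at most [l ^ n.+1]. Wild ramification is
    never analysed. Primes dividing [l] or the discriminant of [N] are simply thrown into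
    [S = l * DN * r], which is at most [l * x] and therefore still harmless. The gain at a tame
    prime comes from a Fourier transform over the central kernel: the conjugates of a basis of [K]
    become eigenvectors, and products of opposite nontrivial eigenvectors fall into every ramified
    prime. Each of the [|H|] cosets has [l - 1] nontrivial characters, which is the exponent. Two
    fields over the same [N] are compared over [k(zeta)] only; this loses nothing because
    [[k(zeta) : k]] is prime to [l]. One third of [epsilon] is spent on the hypothesis for [H], one
    on the logarithm of the harmonic sum and one on the Selmer factor. *)

Notation algCaut := {rmorphism algC -> algC}.

Definition fixes (k : set algC) (s : algCaut) : Prop := forall x, k x -> s x = x.

(** The ambient field is generated by all roots of the product of the minimal polynomials, hence is
    a splitting field. *)
Lemma normal_number_field (s : seq algC) :
  exists (L : splittingFieldType rat) (iota : {rmorphism L -> algC}),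
    forall x, x \in s -> exists y, iota y = x.
Proof.
pose q (x : algC) := sval (minCpolyP x).
have qP x : minCpoly x = map_poly ratr (q x) by rewrite /q; case: minCpolyP => ? [].
pose Q := \prod_(x <- s) q x.
have [r Dr] := closed_field_poly_normal (map_poly ratr Q : {poly algC}).
have Qmon : Q \is monic.
  by apply: monic_prod => x _; rewrite /q; case: minCpolyP => ? [].
have lQ : lead_coef (map_poly ratr Q : {poly algC}) = 1.
  by rewrite lead_coef_map (monicP Qmon) rmorph1.
rewrite lQ scale1r in Dr.
have [Qs [QsC [s1 Ds genQ]]] := num_field_exists r.
have Dp : map_poly (in_alg Qs) Q = \prod_(y <- s1) ('X - y%:P).
  apply: (map_poly_inj QsC); rewrite -map_poly_comp.
  rewrite (eq_map_poly (g := ratr)); last first.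
    by move=> x /=; rewrite alg_num_field fmorph_rat.
  rewrite Dr rmorph_prod -Ds big_map; apply: eq_bigr => y _.
  by rewrite /= map_polyXsubC.
have split : SplittingField.axiom Qs.
  exists (map_poly (in_alg Qs) Q).
    by apply/polyOver1P; exists Q.
  exists s1; rewrite ?Dp ?eqpxx //.
have Qn_ax : FieldExt_isSplittingField _ Qs by constructor.
exists (HB.pack_for (splittingFieldType rat) Qs Qn_ax), QsC => x xs.
have : root (map_poly ratr Q : {poly algC}) x.
  rewrite /Q rmorph_prod /= /root horner_prod prodf_seq_eq0; apply/hasP.
  by exists x => //=; rewrite -qP; apply: root_minCpoly.
rewrite Dr root_prod_XsubC -Ds => /mapP[y _ ->]; by exists y.
Qed.

(** Makes the Galois theory of splitting fields available for subsets of [algC]: the abstract field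
    behind [k] is carried into a normal one by the partial inverse of [iota], and [s] names further
    elements to be reached. *)
Lemma number_field_in (n : nat) (k : set algC) (s : seq algC) :
  number_field n k ->
  exists (L : splittingFieldType rat) (iota : {rmorphism L -> algC})
         (F : {subfield L}),
    [/\ iota @` [set` F] = k, \dim F = n &
        forall x, x \in s -> exists y, iota y = x].
Proof.
move=> [L0 [i0 [<- <-]]].
have [L [iota Lr]] := normal_number_field ([seq i0 x | x <- vbasis {:L0}] ++ s).
have [C2L _ C2LK] := num_field_proj iota.
have ex x : exists y, i0 x = iota y.
  rewrite (coord_vbasis (memvf x)).
  elim/big_ind: _ => [|u v [y1 E1] [y2 E2]|i _].
  - by exists 0; rewrite !rmorph0.
  - by exists (y1 + y2); rewrite !rmorphD E1 E2.
  have [y yE] : exists y, iota y = i0 (vbasis {:L0})`_i.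
    apply: Lr; rewrite mem_cat; apply/orP; left; apply: map_f.
    by apply: mem_nth; rewrite size_tuple.
  exists (coord (vbasis {:L0}) i x *: y).
  by rewrite !rmorphZ_num yE.
pose j (x : L0) : L := C2L (i0 x).
have jE x : iota (j x) = i0 x.
  by rewrite /j; have [y ->] := ex x; rewrite C2LK.
have ja : zmod_morphism j.
  by move=> x y; apply: (fmorph_inj iota); rewrite !(jE, rmorphB).
have jm : monoid_morphism j.
  split=> [|x y]; apply: (fmorph_inj iota); rewrite ?jE ?rmorph1 //.
  by rewrite !rmorphM /= !jE.
pose jaM := GRing.isZmodMorphism.Build L0 L j ja.
pose jmM := GRing.isMonoidMorphism.Build L0 L j jm.
pose jRM : {rmorphism _ -> _} := HB.pack j jaM jmM.
pose jlM := GRing.isScalable.Build rat L0 L *:%R j (fmorph_numZ jRM).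
pose jLRM : {lrmorphism _ -> _} := HB.pack j jaM jmM jlM.
have jh : ahom_in {:L0} (linfun jLRM) := linfun_is_ahom jLRM.
pose J := AHom jh.
have JE z : J z = j z by exact: lfunE.
exists L, iota, (J @: {:L0})%AS; split=> [||x xs].
- rewrite eqEsubset; split=> x /=.
    by case=> y /memv_imgP[z _ ->] <-; exists z; rewrite //= -jE -JE.
  case=> z _ <-; exists (j z); last exact: jE.
  by apply/memv_imgP; exists z; rewrite ?memvf // -JE.
- rewrite limg_dim_eq //; apply/eqP; rewrite -subv0; apply/subvP => x.
  rewrite memv_cap memvf /= memv_ker => /eqP; rewrite -/(J x) JE => jx0.
  by rewrite memv0 -(fmorph_eq0 i0) -jE jx0 rmorph0.
by apply: Lr; rewrite mem_cat xs orbT.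
Qed.

Definition acomp (s t : algCaut) : algCaut := s \o t.

Lemma acompE (s t : algCaut) x : acomp s t x = s (t x).
Proof. by []. Qed.

Lemma fixes_comp k (s t : algCaut) : fixes k s -> fixes k t -> fixes k (acomp s t).
Proof. by move=> hs ht x kx; rewrite acompE ht // hs. Qed.

Lemma fixes_id k : fixes k (idfun : algCaut).
Proof. by []. Qed.

Lemma fixesW (k K : set algC) s : k `<=` K -> fixes K s -> fixes k s.
Proof. by move=> kK h x kx; apply/h/kK. Qed.

Lemma galois_rat (L : splittingFieldType rat) (F : {subfield L}) :
  galois F {:L}.
Proof.
rewrite /galois subvf normalFieldf andbT /=; apply/separableP => x _.
apply: pcharf0_separable => p.
by rewrite (pchar_lalg L); apply: pchar_num.
Qed.

Lemma extend_gal (L : splittingFieldType rat) (iota : {rmorphism L -> algC})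
  (E : {subfield L}) (g : gal_of E) :
  exists s : algCaut, forall x, s (iota x) = iota (g x).
Proof.
have [s sE] := extend_algC_subfield_aut iota g.
by exists s => x; rewrite sE.
Qed.

Lemma number_field_closed n k : number_field n k ->
  [/\ k 1, forall x y, k x -> k y -> k (x - y), forall x y, k x -> k y -> k (x * y)
    & forall x, k x -> k x^-1].
Proof.
move=> [L [i [<- _]]]; split.
- by exists 1; rewrite ?rmorph1.
- by move=> _ _ [x _ <-] [y _ <-]; exists (x - y); rewrite ?rmorphB.
- by move=> _ _ [x _ <-] [y _ <-]; exists (x * y); rewrite ?rmorphM.
by move=> _ [x _ <-]; exists x^-1; rewrite ?fmorphV.
Qed.

(** Galois descent, and the standard test for membership in a field from here on; elements of the
    Galois group of a normal closure extend to automorphisms of [algC]. *)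
Lemma number_field_fixed n k x : number_field n k ->
  (forall s, fixes k s -> s x = x) -> k x.
Proof.
move=> nk; have [L [iota [F [<- _ Lr]]]] := number_field_in [:: x] nk.
have [y yx] : exists y, iota y = x by apply: Lr; rewrite inE.
move=> fx; exists y => //=.
have /galois_fixedField <- := galois_rat F.
apply/fixedFieldP=> [|g gG]; first exact: memvf.
have [s sE] := extend_gal iota g.
apply: (fmorph_inj iota); rewrite -sE yx; apply: fx => _ [z Fz <-].
by rewrite sE (fixed_gal _ gG) ?subvf.
Qed.

(** The embeddings of [k] are represented by automorphisms of [algC], one for each root of the
    minimal polynomial of the primitive element [th]. *)
Lemma number_field_emb n k : number_field n k ->
  exists (th : algC) (e : 'I_n -> algCaut),
    [/\ k th, injective (fun i => e i th) &
        forall s : algCaut, exists i, forall x, k x -> s x = e i x].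
Proof.
move=> nk; have [L [iota [F [kE dF _]]]] := number_field_in [::] nk.
pose th := separable_generator 1%AS F.
have Fth : th \in F by apply: separable_generator_mem.
have [_ sepL nL] := and3P (galois_rat (1%AS : {subfield L})).
have FE : F = <<1; th>>%VS :> {vspace L}.
  apply: eq_adjoin_separable_generator; rewrite ?sub1v //.
  by apply: separableSr sepL; apply: subvf.
have /(normalField_factors (sub1v _))/(_ th (memvf th)) := nL.
case=> rs _ mE.
have sz : size rs = n.
  have := size_minPoly 1 th; rewrite mE size_prod_XsubC => -[->].
  by rewrite -dF FE dim_Fadjoin dimv1 muln1.
have urs : uniq [seq (g : gal_of {:L}) th | g <- rs].
  rewrite -separable_prod_XsubC big_map -mE.
  have /separableP := sepL; apply; exact: memvf.
have ex (i : 'I_n) : exists s : algCaut, forall x, s (iota x) = iota (nth 1%g rs i x).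
  exact: extend_gal.
have [e eE] := choice ex.
exists (iota th), e; split.
- by rewrite -kE; exists th.
- move=> i j; rewrite !eE => /fmorph_inj E; apply/val_inj/eqP.
  have lt (i0 : 'I_n) : (i0 < size rs)%N by rewrite sz.
  rewrite -(nth_uniq 0 _ _ urs) ?size_map ?lt //.
  by rewrite !(nth_map 1%g) ?lt // E.
move=> s; have [nu nuE] := restrict_aut_to_normal_num_field iota s.
have : root (minPoly 1 th) (nu th).
  have mp : map_poly nu (minPoly 1 th) = minPoly 1 th.
    apply/polyP => i; rewrite coef_map /=.
    have /vlineP[a ->] : (minPoly 1 th)`_i \in 1%VS.
      exact/polyOverP/minPolyOver.
    by rewrite linearZ /= rmorph1.
  by rewrite -[minPoly 1 th]mp fmorph_root root_minPoly.
rewrite mE -(big_map (fun g : gal_of {:L} => g th) xpredT (fun y => 'X - y%:P)).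
rewrite root_prod_XsubC => /(nthP 0)[i]; rewrite size_map sz => ltin.
rewrite (nth_map 1%g) ?sz // => iE.
exists (Ordinal ltin) => x; rewrite -kE => -[y /= Fy <-].
rewrite -nuE eE /=; congr (iota _).
move: Fy; rewrite FE => /Fadjoin_polyP[p /polyOver1P[q ->] ->].
rewrite -!horner_map /= iE; congr (_.[_]); rewrite -!map_poly_comp.
by apply: eq_map_poly => a /=; rewrite !linearZ /= !rmorph1.
Qed.

Lemma number_field_sub (L : fieldExtType rat) (iota : {rmorphism L -> algC})
  (E : {subfield L}) : number_field (\dim E) (iota @` [set` E]).
Proof.
exists (subvs_of E), (iota \o vsval); split; last by rewrite dimvf.
rewrite eqEsubset; split=> y [x].
  by move=> _ <-; exists (vsval x) => //=; apply: subvsP.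
by move=> /= Ex <-; exists (vsproj E x) => //=; rewrite vsprojK.
Qed.

(** An upper bound for the degree suffices: it lets every constant attached to [k(zeta)] depend on
    [m] and [l] alone. *)
Lemma number_field_adjoin n k l z : number_field n k -> l.-primitive_root z ->
  exists2 n', (n' <= n * l)%N & number_field n' (adjoin k z).
Proof.
move=> nk zP; have [L [iota [F [kE dF Lr]]]] := number_field_in [:: z] nk.
have [w wz] : exists y, iota y = z by apply: Lr; rewrite inE.
have l_gt0 := prim_order_gt0 zP.
exists (\dim <<F; w>>%AS).
  rewrite dim_Fadjoin dF mulnC leq_mul2l; apply/orP; right.
  have h : minPoly F w %| 'X^l - 1.
    apply: minPoly_dvdp; first by rewrite rpredB ?rpred1 ?rpredX //= polyOverX.
    rewrite -(fmorph_root iota) rmorphB rmorph1 /= map_polyXn wz.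
    by apply/unity_rootP; apply: prim_expr_order.
  have := dvdp_leq _ h; rewrite size_minPoly size_XnsubC // ltnS; apply.
  by rewrite -size_poly_eq0 size_XnsubC.
suff -> : adjoin k z = iota @` [set` <<F; w>>%AS] by apply: number_field_sub.
rewrite eqEsubset; split=> [x|_ [x /= xF <-]].
  apply; split.
    split=> [|_ _ /set_mem[u Fu <-] /set_mem[v Fv <-]|
              _ _ /set_mem[u Fu <-] /set_mem[v Fv <-]].
    - by apply/mem_set; exists 1; rewrite /= ?rmorph1 ?mem1v.
    - by apply/mem_set; exists (u - v); rewrite /= ?rmorphB ?memvB.
    - by apply/mem_set; exists (u / v); rewrite /= ?rmorphM ?fmorphV ?memvM ?memvV.
  rewrite -kE => _ [[y /= Fy <-]|->]; first by exists y; rewrite //= (subvP (subv_adjoin _ _)).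
  by exists w; rewrite //= memv_adjoin.
move=> X [[X1 XB XV] kX].
have {}kX1 u : k u -> u \in mem X by move=> ku; apply/mem_set/kX; left.
have zX : z \in mem X by apply/mem_set/kX; right.
have XM u v : u \in mem X -> v \in mem X -> u * v \in mem X.
  move=> uX vX; rewrite -[v]invrK; apply: (XV) => //.
  by rewrite -[v^-1]mul1r; apply: XV.
have X0 : 0 \in mem X by rewrite -(subrr 1); apply: (XB).
have XD u v : u \in mem X -> v \in mem X -> u + v \in mem X.
  by move=> uX vX; rewrite -[v]opprK; apply: (XB) => //; rewrite -sub0r; apply: XB.
apply/set_mem.
have /Fadjoin_polyP[p Fp ->] := xF.
rewrite -horner_map wz horner_coef.
elim/big_rec: _ => // i u _ uX; apply: (XD) => //; apply: (XM).
  rewrite coef_map /=; apply: kX1; rewrite -kE; exists p`_i => //=.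
  exact: polyOverP.
elim: (val i) => [|j IH]; first by rewrite expr0.
by rewrite exprS; apply: (XM).
Qed.

(* [phi] induces an isomorphism from the automorphisms of [algC] fixing [k],
   modulo those fixing [K], to [G]. *)
Definition galrep (k K : set algC) (G : finGroupType) (phi : algCaut -> G) : Prop :=
  [/\ k `<=` K,
      forall s t, fixes k s -> fixes k t -> phi (acomp s t) = (phi s * phi t)%g,
      forall g, exists2 s, fixes k s & phi s = g,
      forall s, fixes k s -> phi s = 1%g <-> fixes K s
    & forall s x, fixes k s -> K x -> K (s x)].

Lemma galrep_exists (k : set algC) (L : splittingFieldType rat)
   (iota : {rmorphism L -> algC}) (F E : {subfield L}) (G : finGroupType)
   (f : {morphism 'Gal(E / F)%g >-> G}) :
  iota @` [set` F] = k -> galois F E -> ('injm f)%g -> (f @* 'Gal(E / F) = [set: G]%SET)%g ->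
  exists phi : algCaut -> G, galrep k (iota @` [set` E]) phi /\
     forall s, fixes k s -> exists2 g, g \in 'Gal(E / F)%g & phi s = f g^-1%g /\
        forall y, y \in E -> s (iota y) = iota (g y).
Proof.
move=> kE galFE injf imf; have [sFE _ nFE] := and3P galFE.
have ex s : exists g, fixes k s ->
    g \in 'Gal(E / F)%g /\ forall y, y \in E -> s (iota y) = iota (g y).
  have [fs|nfs] := pselect (fixes k s); last by exists 1%g => /nfs.
  have [nu nuE] := restrict_aut_to_normal_num_field iota s.
  have [g gG gE] : {x | x \in 'Gal(E / F)%g & {in E, linfun nu =1 x}}.
    apply: kHom_to_gal; rewrite ?subvv ?sFE //.
    apply/kHomP_tmp; split=> [x Fx|x y _ _]; last by rewrite !lfunE /= rmorphM.
    rewrite lfunE /=; apply: (fmorph_inj iota); rewrite nuE; apply: fs.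
    by rewrite -kE; exists x.
  by exists g => _; split=> // y Ey; rewrite -nuE -gE // lfunE.
have [gs gsP] := choice ex.
(* The product of [gal_of] composes in the opposite order to [acomp]; the inverse turns restriction
   into a homomorphism. *)
pose phi s := f (gs s)^-1%g.
exists phi; split; last first.
  by move=> s fs; have [sG sE] := gsP s fs; exists (gs s).
split.
- by rewrite -kE => _ [x /= Fx <-]; exists x => //=; apply: (subvP sFE).
- move=> s t fs ft; rewrite /phi.
  have [sG sE] := gsP s fs; have [tG tE] := gsP t ft.
  have [cG cE] := gsP _ (fixes_comp fs ft).
  rewrite -morphM ?groupV // -invMg; congr (f _^-1%g).
  apply/eqP/gal_eqP => y Ey; apply: (fmorph_inj iota).
  by rewrite -cE // acompE tE // sE ?memv_gal // galM.
- move=> g; have : g \in (f @* 'Gal(E / F))%g by rewrite imf inE.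
  case/morphimP => h hG _ ->.
  have [s sE] := extend_gal iota h^-1%g.
  have fs : fixes k s.
    by rewrite -kE => _ [x /= Fx <-]; rewrite sE (fixed_gal sFE) ?groupV.
  exists s => //; rewrite /phi; have [sG {}sE'] := gsP s fs.
  congr (f _); apply/(canLR invgK)/eqP/gal_eqP => y Ey; apply: (fmorph_inj iota).
  by rewrite -sE' // sE.
- move=> s fs; have [sG sE] := gsP s fs; split.
    rewrite /phi => /eqP; rewrite morph_injm_eq1 ?groupV // invg_eq1 => /eqP g1.
    by move=> _ [y /= Ey <-]; rewrite sE // g1 gal_id.
  move=> fK; rewrite /phi; suff -> : gs s = 1%g by rewrite invg1 morph1.
  apply/eqP/gal_eqP => y Ey; apply: (fmorph_inj iota); rewrite gal_id -sE //.
  by apply: fK; exists y.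
move=> s _ fs [y /= Ey <-]; have [sG sE] := gsP s fs.
by rewrite sE //; exists (gs s y) => //=; apply: memv_gal.
Qed.

(** [N] is the fixed field of the kernel of [p]. That one map [phi] describes both fields keeps
    their Galois groups compatible, which the comparison of fields over a common [N] relies on. *)
Lemma galois_extension_quotient (k K : set algC) (G H : finGroupType)
   (p : {morphism [set: G]%SET >-> H}) :
  galois_extension k K G -> (p @* [set: G]%SET = [set: H]%SET)%g ->
  exists (phi : algCaut -> G) (N : set algC),
    [/\ galrep k K phi, galois_extension k N H, galrep k N (p \o phi) &
        (exists n, number_field n K) /\ (exists n, number_field n N)].
Proof.
move=> [L [iota [F [E [kE KE galFE isoG]]]]] psurj.
have [f injf imf] := isogP isoG.
have [phi [phiP phiE]] := galrep_exists kE galFE injf imf.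
pose A := ('Gal(E / F))%G.
pose q g := p (f g).
have qM : {in A &, {morph q : x y / (x * y)%g}}.
  by move=> x y xA yA; rewrite /q morphM // morphM ?inE.
pose Q := Morphism qM; pose B := ('ker Q)%G.
have BE g : g \in A -> (g \in B) = (p (f g) == 1%g).
  by move=> gA; rewrite /B /= !inE gA.
have nB : normal B A by apply: ker_normal.
have galFM := normal_fixedField_galois galFE nB.
pose M : {subfield L} := fixedField_aspace B.
have [sFM _ nM] := and3P (galFM : galois F M).
have sME : (M <= E)%VS by apply: fixedField_bound.
have sFE : (F <= E)%VS by case/and3P: galFE.
have GM : 'Gal(E / M)%g = B by apply: gal_fixedField.
have kN : k `<=` iota @` [set` M].
  by rewrite -kE => _ [x /= Fx <-]; exists x => //=; apply: (subvP sFM).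
exists phi, (iota @` [set` M]); split.
- by rewrite -KE.
- exists L, iota, F, M; split=> //.
  have := normalField_isog galFE (introT andP (conj sFM sME)) nM.
  rewrite GM isog_sym => i1; apply: isog_trans i1 _.
  have := first_isog Q; suff -> : (Q @* A)%g = [set: H]%SET by [].
  apply/setP => h; rewrite inE.
  have : h \in (p @* [set: G]%SET)%g by rewrite psurj inE.
  case/morphimP => x _ _ ->.
  have : x \in (f @* 'Gal(E / F))%g by rewrite imf inE.
  case/morphimP => g gA _ ->.
  by apply/morphimP; exists g.
- case: phiP => _ phiM phis phi1 _; split=> //.
  + by move=> s t fs ft; rewrite /= phiM // morphM ?inE.
  + move=> h; have : h \in (p @* [set: G]%SET)%g by rewrite psurj inE.
    case/morphimP => x _ _ ->; have [s fs <-] := phis x.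
    by exists s.
  + move=> s fs; have [g gA [phisE sE]] := phiE s fs.
    rewrite /= phisE; split.
      move=> /eqP; rewrite -BE ?groupV // => gB _ [y /= My <-].
      rewrite sE ?(subvP sME) //; congr (iota _).
      by have [_] := mem_fixedFieldP My; apply.
    move=> fN; apply/eqP; rewrite -BE ?groupV // -GM gal_kHom //.
    apply/kAHomP => y My; apply: (fmorph_inj iota).
    by rewrite -sE ?(subvP sME) //; apply: fN; exists y.
  move=> s _ fs [y /= My <-]; have [g gA [phisE sE]] := phiE s fs.
  have Ey := subvP sME _ My.
  rewrite sE //; exists (g y) => //=.
  apply/fixedFieldP=> [|b Bb]; first exact: memv_gal.
  have [_ cB] := mem_fixedFieldP My.
  rewrite -galM // conjgCV galM //= cB // memJ_norm ?groupV //.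
  exact: (fintype.subsetP (normal_norm nB)).
by split; [rewrite -KE; exists (\dim E)|exists (\dim M)]; apply: number_field_sub.
Qed.

(** * Algebraic integers and Dedekind's Prague theorem *)

Section NumberFieldOps.
Variables (n : nat) (k : set algC).
Hypothesis nk : number_field n k.

Lemma nf1 : k 1. Proof. by have [] := number_field_closed nk. Qed.
Lemma nfB x y : k x -> k y -> k (x - y).
Proof. by have [_ h _ _] := number_field_closed nk; apply: h. Qed.
Lemma nfM x y : k x -> k y -> k (x * y).
Proof. by have [_ _ h _] := number_field_closed nk; apply: h. Qed.
Lemma nfV x : k x -> k x^-1.
Proof. by have [_ _ _ h] := number_field_closed nk; apply: h. Qed.
Lemma nf0 : k 0. Proof. by rewrite -(subrr 1); apply/nfB; apply/nf1. Qed.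
Lemma nfN x : k x -> k (- x).
Proof. by move=> kx; rewrite -sub0r; apply/nfB => //; apply/nf0. Qed.
Lemma nfD x y : k x -> k y -> k (x + y).
Proof. by move=> kx ky; rewrite -[y]opprK; apply/nfB => //; apply/nfN. Qed.
Lemma nf_int (m : int) : k m%:~R.
Proof. by have [L [i [<- _]]] := nk; exists m%:~R; rewrite ?rmorph_int. Qed.
Lemma nf_nat (m : nat) : k m%:R.
Proof. by have := nf_int m; rewrite -pmulrn. Qed.
Lemma nf_sum I (r : seq I) (P : pred I) (F : I -> algC) :
  (forall i, P i -> k (F i)) -> k (\sum_(i <- r | P i) F i).
Proof. by move=> h; elim/big_ind: _ => //; [apply/nf0|apply/nfD]. Qed.
Lemma nf_prod I (r : seq I) (P : pred I) (F : I -> algC) :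
  (forall i, P i -> k (F i)) -> k (\prod_(i <- r | P i) F i).
Proof. by move=> h; elim/big_ind: _ => //; [apply/nf1|apply/nfM]. Qed.
Lemma nfX x m : k x -> k (x ^+ m).
Proof. by move=> kx; elim: m => [|m IH]; [apply/nf1|rewrite exprS; apply/nfM]. Qed.
End NumberFieldOps.

Lemma Aint_integralOver (x : algC) : (x \in Aint) <-> integralOver (intr : int -> algC) x.
Proof.
split.
  move=> xA; have /floorpP[q qE] : minCpoly x \is a polyOver Num.int by [].
  exists q; last by rewrite -qE; apply: root_minCpoly.
  rewrite monicE -(inj_eq (@intr_inj algC)) -lead_coef_map_inj ?rmorph1 //; last exact: intr_inj.
  by rewrite -qE (monicP (minCpoly_monic x)).
case=> p pm px0; apply: (root_monic_Aint px0).
  by rewrite monicE lead_coef_map_inj ?rmorph0 ?(monicP pm) ?rmorph1 //; apply: intr_inj.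
by apply/polyOverP => i; rewrite coef_map /= intr_int.
Qed.

Lemma Aint_root_monic (p : {poly algC}) x :
  p \is monic -> p \is a polyOver Aint -> root p x -> x \in Aint.
Proof.
move=> pm /polyOverP pA px0; apply/Aint_integralOver.
apply: (integral_root_monic pm px0) => c /(nthP 0)[i _ <-].
exact/Aint_integralOver.
Qed.

Lemma Aint_expr_inj (x : algC) n : (0 < n)%N -> x ^+ n \in Aint -> x \in Aint.
Proof.
move=> n0 xn; apply: (@Aint_root_monic ('X^n - (x ^+ n)%:P)).
- by rewrite monicXnsubC.
- by rewrite rpredB ?polyOverC //= rpredX // polyOverX.
by rewrite /root !hornerE subrr.
Qed.

(** Induction on the size of [q]: if [a] is its leading coefficient, then [a] and [a * r] are
    integral, so [a *: 'X^d] can be split off from [q]. *)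
Lemma Aint_div_root (q : {poly algC}) r :
  ('X - r%:P) * q \is a polyOver Aint -> q \is a polyOver Aint.
Proof.
have [n] := ubnP (size q); elim: n q => // n IH q ltqn hA.
have [->|q0] := eqVneq q 0; first exact: rpred0.
set h := ('X - r%:P) * q in hA.
pose a := lead_coef q; pose d := (size q).-1.
have sq : size q = d.+1 by rewrite /d prednK // size_poly_gt0.
have hm : size h = d.+2.
  by rewrite /h mulrC size_Mmonic ?monicXsubC // size_XsubC sq addn2.
have lh : h`_d.+1 = a.
  by rewrite -[d.+1]/(d.+2.-1) -hm -/(lead_coef h) lead_coefM lead_coefXsubC mul1r.
have aA : a \in Aint by rewrite -lh (polyOverP hA).
have arA : a * r \in Aint.
  (* This is [a ^+ d] times [h] evaluated at ['X / a], which is monic and has the root [a * r]. *)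
  pose p := 'X^(d.+1) + \poly_(i < d.+1) (h`_i * a ^+ (d - i)).
  apply: (@Aint_root_monic p).
  - by rewrite monicE lead_coefDl ?lead_coefXn // size_polyXn ltnS size_poly.
  - rewrite rpredD //= ?rpredX ?polyOverX //; apply/polyOverP => i.
    by rewrite coef_poly; case: ifP => // _; rewrite rpredM ?rpredX ?(polyOverP hA) // rpred0.
  have h0 : h.[r] = 0 by rewrite /h !hornerE subrr mul0r.
  have E : p.[a * r] = a ^+ d * h.[r].
    rewrite (horner_coef h) hm [in RHS]big_ord_recr /= lh /p hornerD hornerXn horner_poly.
    rewrite mulrDr mulr_sumr addrC; congr (_ + _); last by rewrite exprMn exprS; ring.
    apply: eq_bigr => i _; rewrite exprMn.
    have -> : a ^+ d = a ^+ (d - i) * a ^+ i by rewrite -exprD subnK // -ltnS.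
    by ring.
  by rewrite /root E h0 mulr0.
pose q' := q - a *: 'X^d.
have q'A : q' \is a polyOver Aint.
  apply: IH.
    rewrite sq ltnS in ltqn; apply: leq_ltn_trans ltqn; apply/leq_sizeP => j le_dj.
    rewrite coefB coefZ coefXn; move: le_dj; rewrite leq_eqVlt => /orP[/eqP<-|ltdj].
      by rewrite eqxx mulr1 /a lead_coefE -/d subrr.
    by rewrite gtn_eqF // mulr0 subr0 nth_default // sq.
  have -> : ('X - r%:P) * q' = h - (a *: 'X^(d.+1) - (a * r) *: 'X^d).
    by rewrite /q' mulrBr -/h -!mul_polyC exprS polyCM; ring.
  by rewrite rpredB // rpredB // -mul_polyC rpredM ?polyOverC //= ?rpredX ?polyOverX.
have -> : q = q' + a *: 'X^d by rewrite /q' subrK.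
by rewrite rpredD // -mul_polyC rpredM ?polyOverC //= ?rpredX ?polyOverX.
Qed.

(** Removing one linear factor leaves both [f * q] and [r *: (f * q)] integral, and the coefficients
    of [('X - r) * q] are differences of coefficients of these two shapes. *)
Lemma Prague_split (s : seq algC) (f : {poly algC}) c :
  f * (c *: \prod_(r <- s) ('X - r%:P)) \is a polyOver Aint ->
  forall j, (c *: \prod_(r <- s) ('X - r%:P))`_j *: f \is a polyOver Aint.
Proof.
elim: s c => [|r s IH] c.
  rewrite big_nil => h j; rewrite coefZ coef1.
  case: (j == 0%N); last by rewrite mulr0 scale0r rpred0.
  by rewrite mulr1; move: h; rewrite -scalerAr mulr1.
rewrite big_cons; set g := \prod_(_ <- _) _ => h j.
have qA : f * (c *: g) \is a polyOver Aint.
  by apply: (@Aint_div_root _ r); rewrite -!scalerAr in h *; rewrite mulrCA.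
have rqA : f * ((r * c) *: g) \is a polyOver Aint.
  have -> : f * ((r * c) *: g) = 'X * (f * (c *: g)) - f * (c *: (('X - r%:P) * g)).
    rewrite -!mul_polyC polyCM; ring.
  by rewrite rpredB // rpredM // polyOverX.
have -> : (c *: (('X - r%:P) * g))`_j = (if j == 0%N then 0 else (c *: g)`_j.-1) - ((r * c) *: g)`_j.
  rewrite !coefZ mulrBl coefB coefXM coefCM mulrBr; case: (j == 0%N); ring.
rewrite scalerBl rpredB ?IH //.
by case: (j == 0%N); [rewrite scale0r rpred0|apply: IH].
Qed.

(** Since [algC] is algebraically closed, [g] splits and its linear factors can be peeled off.
    Applied to polynomials, this does the work of localisation at primes. *)
Theorem Prague (f g : {poly algC}) : f * g \is a polyOver Aint ->
  forall i j, f`_i * g`_j \in Aint.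
Proof.
have [s ->] := closed_field_poly_normal g => /Prague_split h i j.
by have /polyOverP/(_ i) := h j; rewrite coefZ mulrC.
Qed.

Lemma fixed_rat (x : algC) : (forall s : algCaut, s x = x) -> x \in Crat.
Proof.
move=> fx; have [L [iota _]] := normal_number_field [::].
have h := @number_field_sub L iota 1%AS.
have /= [y Fy <-] : (iota @` [set` (1%AS : {subfield L})]) x.
  by apply: (number_field_fixed h) => s _; apply: fx.
have /vlineP[a ->] := Fy.
by rewrite rmorphZ_num rmorph1 mulr1; apply: Crat_rat.
Qed.

Lemma int_bezout (q : {poly int}) : exists n : nat -> int,
  \sum_(i < size q) n i * q`_i = zcontents q.
Proof.
rewrite /zcontents.
have : exists n : nat -> int, \sum_(i < size q) n i * q`_i = (\big[gcdn/0%N]_(i < size q) `|(q`_i)%R|%N)%:Z.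
  apply: (big_ind (fun d : nat => exists n : nat -> int, \sum_(i < size q) n i * q`_i = d%:Z)).
  - by exists (fun=> 0); rewrite big1 // => i _; rewrite mul0r.
  - move=> x y [n nE] [m mE]; have [u [v uvE]] := Bezoutz x y.
    exists (fun i => u * n i + v * m i).
    rewrite -[RHS]/(gcdz x y) -uvE -nE -mE !mulr_sumr -big_split /=.
    by apply: eq_bigr => i _; ring.
  move=> i _; exists (fun j => if j == i :> nat then sgz q`_i else 0).
  rewrite (bigD1 i) //= eqxx big1 ?addr0 => [|j nij]; first by rewrite abszEsg.
  by rewrite (_ : (j == i :> nat) = false) ?mul0r //; apply: negbTE.
move=> [n nE]; exists (fun i => sgz (lead_coef q) * n i).
by rewrite -nE mulr_sumr; apply: eq_bigr => i _; rewrite mulrA.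
Qed.

(* Gauss's lemma for the content ideal: over a number field every nonzero
   content ideal is invertible, with an explicit inverse obtained from the
   norm of the polynomial. *)
Lemma content_inverse n k (s : seq algC) : number_field n k ->
  (forall x, x \in s -> k x) -> has (fun x => x != 0) s ->
  exists t : nat -> algC, [/\ forall i, k (t i),
    \sum_(i < size s) s`_i * t i = 1 & forall i j, s`_i * t j \in Aint].
Proof.
move=> nk sk s0; have [k1 kB kM kV] := number_field_closed nk.
have k0 : k 0 by rewrite -(subrr 1); apply: (kB).
have kD x y : k x -> k y -> k (x + y).
  by move=> kx ky; rewrite -[y]opprK -[- y]sub0r; apply: (kB) => //; apply: (kB).
have [th [e [kth einj esurj]]] := number_field_emb nk.
pose f : {poly algC} := Poly s.
have fi i : f`_i = s`_i by rewrite coef_Poly.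
have kf i : k f`_i.
  rewrite fi; have [lt|le] := ltnP i (size s); first by apply/sk/mem_nth.
  by rewrite nth_default.
have f0 : f != 0.
  have /hasP[x xs x0] := s0; have /(nthP 0)[i _ ix] := xs.
  by apply: contraNneq x0 => f0; rewrite -ix -fi f0 coef0.
have [i0 i0E] := esurj (idfun : algCaut).
have [pi piE] : exists pi : algCaut -> 'I_n -> 'I_n, forall (s : algCaut) i x, k x -> s (e i x) = e (pi s i) x.
  have h (s1 : algCaut) : exists p1 : 'I_n -> 'I_n, forall i x, k x -> s1 (e i x) = e (p1 i) x.
    have [p1 p1E] := choice (fun i => esurj (acomp s1 (e i))).
    by exists p1 => i x kx; rewrite -p1E.
  by have [pi piE] := choice h; exists pi.
have piI (s1 : algCaut) : injective (pi s1).
  by move=> i j E; apply: einj; apply: (fmorph_inj s1); rewrite !piE // E.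
have emap (s1 : algCaut) i : map_poly s1 (map_poly (e i) f) = map_poly (e (pi s1 i)) f.
  by apply/polyP => j; rewrite !coef_map /= piE.
have fE : map_poly (e i0) f = f.
  by apply/polyP => j; rewrite coef_map /= -i0E.
(* The cofactor of [f] in its norm. An automorphism fixing [k] fixes [i0] and permutes the other
   embeddings, so the coefficients lie in [k]. *)
pose g := \prod_(i | i != i0) map_poly (e i) f.
have kg i : k g`_i.
  apply: (number_field_fixed nk) => s1 fs1.
  have pi0 : pi s1 i0 = i0.
    by apply: einj; rewrite -piE // -!i0E //= fs1.
  rewrite -coef_map /= rmorph_prod /=; congr (_`_i).
  under eq_bigr do rewrite emap.
  rewrite /g [in RHS](reindex_inj (piI s1)) /=.
  congr polyseq; apply: eq_bigl => j.
  by rewrite -[in RHS]pi0 (inj_eq (piI s1)).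
have Nf : f * g = \prod_i map_poly (e i) f by rewrite (bigD1 i0) //= fE.
have [P PE] : exists P : {poly rat}, f * g = map_poly ratr P.
  have ratc i : (f * g)`_i \in Crat.
    apply: fixed_rat => s1; rewrite Nf -coef_map rmorph_prod; congr (_`_i).
    under eq_bigr do rewrite /= emap.
    by rewrite [in RHS](reindex_inj (piI s1)).
  have /choice[P PE] i : exists a : rat, (f * g)`_i = ratr a.
    by have /CratP[a ->] := ratc i; exists a.
  exists (\poly_(i < size (f * g)) P i); apply/polyP => i.
  rewrite coef_map coef_poly; case: ltnP => [_|le]; first exact: PE.
  by rewrite nth_default //; apply/esym/rmorph0.
have g0 : g != 0.
  by apply/prodf_neq0 => i _; rewrite map_poly_eq0.
have P0 : P != 0.
  by rewrite -(map_poly_eq0 (ratr : rat -> algC)) -PE mulf_neq0.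
have [q [a a0 qE]] := rat_poly_scale P.
have q0 : q != 0.
  by apply: contraNneq P0 => q0; rewrite qE q0 map_poly0 scaler0.
have [u uE] := int_bezout (zprimitive q).
rewrite zcontents_primitive q0 in uE.
pose Z := zprimitive q.
pose c : algC := (zcontents q)%:~R / a%:~R.
have c0 : c != 0.
  by rewrite /c mulf_neq0 ?invr_eq0 ?intr_eq0 // zcontents_eq0.
(* Normalised so that [f * h] is the primitive integer polynomial [Z]: the Prague theorem then makes
   every [f_i * h_j] integral, and a Bezout relation for [Z] produces [1]. *)
pose h := c^-1 *: g.
have hE : f * h = map_poly intr Z.
  rewrite /h -scalerAr PE qE [in LHS](zpolyEprim q) -/Z.
  apply/polyP => i; rewrite coefZ !coef_map /= coefZ coef_map /= coefZ.
  rewrite rmorphM fmorphV /= !ratr_int rmorphM /=.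
  rewrite /c invf_div; field.
  by rewrite !intr_eq0 zcontents_eq0 q0 a0.
have kc : k c^-1.
  by rewrite /c; apply: (kV); apply: (kM); [|apply: (kV)]; apply: nf_int nk _.
have fhA : forall i j, f`_i * h`_j \in Aint.
  apply: Prague; rewrite hE; apply/polyOverP => i.
  by rewrite coef_map /= Aint_int.
(* The Bezout relation for the coefficients of [Z], each expanded as a convolution of [f] and [h]
   and regrouped by the coefficients of [f]. *)
exists (fun i => \sum_(m < size Z | (i <= m)%N) (u m)%:~R * h`_(m - i)); split.
- move=> i; elim/big_ind: _ => // m _; apply: (kM).
    exact: nf_int nk _.
  by rewrite coefZ; apply: (kM).
- transitivity ((\sum_(i < size Z) u i * Z`_i)%:~R : algC); last by rewrite uE.
  rewrite rmorph_sum /=.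
  under eq_bigr do rewrite mulr_sumr.
  under eq_bigr do rewrite big_mkcond.
  rewrite exchange_big /=; apply: eq_bigr => m _.
  rewrite rmorphM /= -coef_map -hE coefM mulr_sumr.
  pose F i := if (i <= m)%N then (u m)%:~R * (f`_i * h`_(m - i)) else 0.
  transitivity (\sum_(i < size s) F i).
    by apply: eq_bigr => i _; rewrite /F fi; case: ifP => _; ring.
  transitivity (\sum_(i < m.+1) F i); last first.
    by apply: eq_bigr => i _; rewrite /F -ltnS ltn_ord.
  rewrite -!(big_mkord xpredT F) (big_nat_widen _ _ (size s + m.+1)) ?leq_addr //.
  rewrite [RHS](big_nat_widen _ _ (size s + m.+1)) ?leq_addl //.
  rewrite big_mkcond [RHS]big_mkcond /=; apply: eq_bigr => i _.
  rewrite /F ltnS; case: ltnP => [_|le]; first by case: ifP.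
  by rewrite fi nth_default // mul0r mulr0 !if_same.
move=> i j; rewrite mulr_sumr rpred_sum // => m _.
by rewrite mulrCA rpredM ?Aint_int // -fi.
Qed.

Notation OO := ring_of_integers.
Notation ZZ := [set x : algC | x \in Aint].

(** * Fractional ideals *)

Section SpanMul.
Implicit Types A B C P : set algC.

Lemma span_mul0 A B : span_mul A B 0.
Proof. by exists 0, (fun=> 0), (fun=> 0); split=> [[]|[]|] //; rewrite big_ord0. Qed.

Lemma span_mulD A B x y : span_mul A B x -> span_mul A B y -> span_mul A B (x + y).
Proof.
move=> [n [a [b [aA bB ->]]]] [m [c [d [cA dB ->]]]].
pose u (i : 'I_(n + m)) := match fintype.split i with inl i => a i | inr i => c i end.
pose v (i : 'I_(n + m)) := match fintype.split i with inl i => b i | inr i => d i end.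
exists (n + m)%N, u, v; split.
- by move=> i; rewrite /u; case: fintype.split.
- by move=> i; rewrite /v; case: fintype.split.
rewrite big_split_ord /=; congr (_ + _); apply: eq_bigr => i _; rewrite /u /v.
  by rewrite (unsplitK (inl i)).
by rewrite (unsplitK (inr i)).
Qed.

Lemma mem_span_mul A B x y : A x -> B y -> span_mul A B (x * y).
Proof.
by move=> Ax By; exists 1%N, (fun=> x), (fun=> y); split=> //; rewrite big_ord1.
Qed.

Lemma span_mul_sum A B I (r : seq I) (Q : pred I) (F : I -> algC) :
  (forall i, Q i -> span_mul A B (F i)) -> span_mul A B (\sum_(i <- r | Q i) F i).
Proof.
move=> h; elim/big_ind: _ => //; [exact: span_mul0|exact: span_mulD].
Qed.

Lemma span_mul_ind A B P : P 0 -> (forall x y, P x -> P y -> P (x + y)) ->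
  (forall x y, A x -> B y -> P (x * y)) -> span_mul A B `<=` P.
Proof.
move=> P0 PD PM _ [n [a [b [aA bB ->]]]]; elim/big_ind: _ => // i _.
exact: PM.
Qed.

Lemma span_mulS A A' B B' : A `<=` A' -> B `<=` B' ->
  span_mul A B `<=` span_mul A' B'.
Proof.
move=> sA sB; apply: span_mul_ind; [exact: span_mul0|exact: span_mulD|].
by move=> x y /sA Ax /sB By; apply: mem_span_mul.
Qed.

Lemma span_mulC A B : span_mul A B = span_mul B A.
Proof.
by rewrite eqEsubset; split; (apply: span_mul_ind; [exact: span_mul0|exact: span_mulD|]);
  move=> x y Ax By; rewrite mulrC; apply: mem_span_mul.
Qed.

Lemma span_mulA A B C : span_mul A (span_mul B C) = span_mul (span_mul A B) C.
Proof.
have D x y U V : span_mul U V x -> span_mul U V y -> span_mul U V (x + y) by apply: span_mulD.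
rewrite eqEsubset; split; (apply: span_mul_ind; [exact: span_mul0|exact: span_mulD|]).
  move=> x y Ax; move: y; apply: span_mul_ind.
  - by rewrite mulr0; apply: span_mul0.
  - by move=> u v; rewrite mulrDr; apply: span_mulD.
  by move=> u v Bu Cv; rewrite mulrA; apply: mem_span_mul => //; apply: mem_span_mul.
move=> x y xAB Cy; move: x xAB; apply: (@span_mul_ind _ _ [set x | span_mul A (span_mul B C) (x * y)]) => /=.
- by rewrite mul0r; apply: span_mul0.
- by move=> u v; rewrite mulrDl; apply: span_mulD.
by move=> u v Au Bv; rewrite -mulrA; apply: mem_span_mul => //; apply: mem_span_mul.
Qed.

End SpanMul.

Definition dual (k I : set algC) : set algC :=
  [set t | k t /\ forall x, I x -> x * t \in Aint].

Definition omod (k I : set algC) : Prop :=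
  [/\ I `<=` k, I 0, forall x y, I x -> I y -> I (x + y)
    & forall a x, OO k a -> I x -> I (a * x)].

(* Equivalent to being a nonzero finitely generated submodule, but with a
   certificate of invertibility. *)
Definition frid (k I : set algC) : Prop :=
  omod k I /\ exists w : seq (algC * algC),
    [/\ forall p, p \in w -> I p.1, forall p, p \in w -> dual k I p.2
      & \sum_(p <- w) p.1 * p.2 = 1].

Definition prin (k : set algC) (a : algC) : set algC := [set a * x | x in OO k].

Section Ideals.
Variables (n : nat) (k : set algC).
Hypothesis nk : number_field n k.

Lemma OO_nat m : OO k m%:R.
Proof. by split; [apply: nf_nat nk _|rewrite /= rpred_nat]. Qed.
Lemma OO0 : OO k 0. Proof. exact: (OO_nat 0). Qed.
Lemma OO1 : OO k 1. Proof. exact: (OO_nat 1). Qed.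
Lemma OOD x y : OO k x -> OO k y -> OO k (x + y).
Proof. by move=> [kx Ax] [ky Ay]; split; [apply: (nfD nk)|rewrite /= rpredD]. Qed.
Lemma OOB x y : OO k x -> OO k y -> OO k (x - y).
Proof. by move=> [kx Ax] [ky Ay]; split; [apply: (nfB nk)|rewrite /= rpredB]. Qed.
Lemma OON x : OO k x -> OO k (- x).
Proof. by move=> [kx Ax]; split; [apply: (nfN nk)|rewrite /= rpredN]. Qed.
Lemma OOM x y : OO k x -> OO k y -> OO k (x * y).
Proof. by move=> [kx Ax] [ky Ay]; split; [apply: (nfM nk)|rewrite /= rpredM]. Qed.
Lemma OOX x m : OO k x -> OO k (x ^+ m).
Proof. by move=> [kx Ax]; split; [apply: (nfX nk)|rewrite /= rpredX]. Qed.

Lemma omodB I x y : omod k I -> I x -> I y -> I (x - y).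
Proof.
move=> [_ _ ID IM] Ix Iy; apply: ID => //; rewrite -mulN1r; apply: IM => //.
exact/OON/OO1.
Qed.

Lemma omod_sum I J (r : seq J) (P : pred J) (F : J -> algC) : omod k I ->
  (forall i, P i -> I (F i)) -> I (\sum_(i <- r | P i) F i).
Proof. by move=> [_ I0 ID _] h; elim/big_ind: _ => // x y; apply: ID. Qed.

Lemma omod_OO : omod k (OO k).
Proof.
split; [by move=> x []|exact: OO0|exact: OOD|exact: OOM].
Qed.

Lemma omod_span A B : A `<=` k -> omod k B -> omod k (span_mul A B).
Proof.
move=> kA [kB B0 BD BM]; split.
- apply: span_mul_ind; [exact: nf0 nk|exact: nfD nk|].
  by move=> x y /kA kx /kB ky; apply: (nfM nk).
- exact: span_mul0.
- exact: span_mulD.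
move=> a x Oa; move: x; apply: span_mul_ind.
- by rewrite mulr0; apply: span_mul0.
- by move=> u v; rewrite mulrDr; apply: span_mulD.
by move=> u v Au Bv; rewrite mulrCA; apply: mem_span_mul => //; apply: BM.
Qed.

Lemma span_OO I : omod k I -> span_mul (OO k) I = I.
Proof.
move=> [kI I0 ID IM]; rewrite eqEsubset; split; first exact: span_mul_ind.
by move=> x Ix; rewrite -[x]mul1r; apply: mem_span_mul => //; apply: OO1.
Qed.

Lemma frid_omod I : frid k I -> omod k I. Proof. by case. Qed.

Lemma dual_omod I : I `<=` k -> omod k (dual k I).
Proof.
move=> kI; split.
- by move=> x [].
- by split=> [|x _]; [apply: nf0 nk|rewrite mulr0 rpred0].
- move=> x y [kx xI] [ky yI]; split=> [|z Iz]; first exact: (nfD nk).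
  by rewrite mulrDr rpredD ?xI ?yI.
move=> a x [ka Aa] [kx xI]; split=> [|z Iz]; first exact: (nfM nk).
by rewrite mulrCA rpredM ?xI.
Qed.

(** An invertible module is its own bidual: multiply [x] by the certificate for [1]. This turns
    membership into integrality, which the Prague theorem can supply. *)
Lemma frid_mem I x : frid k I -> k x -> (forall t, dual k I t -> x * t \in Aint) -> I x.
Proof.
move=> [oI [w [w1 w2 w12]]] kx xt; rewrite -[x]mulr1 -w12 mulr_sumr big_seq.
apply: omod_sum => // p pw; have [_ _ _ IM] := oI.
rewrite mulrCA mulrC; apply: IM; last exact: w1.
have [k2 _] := w2 p pw; split; first exact: (nfM nk).
by apply: xt; apply: w2.
Qed.

(** Extending an ideal to all algebraic integers and contracting it again loses nothing, because
    elements of the dual multiply the whole extension into the integers. *)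
Lemma frid_contract I x : frid k I -> k x -> span_mul ZZ I x -> I x.
Proof.
move=> fI kx xI; apply: frid_mem => // t [kt tI].
move: x xI {kx}; apply: (@span_mul_ind _ _ [set x | x * t \in Aint]) => /=.
- by rewrite mul0r rpred0.
- by move=> x y xt yt; rewrite mulrDl rpredD.
by move=> x y xA Iy; rewrite -mulrA rpredM // tI.
Qed.

Lemma frid_dual I : frid k I -> frid k (dual k I).
Proof.
move=> fI; have [oI [w [w1 w2 w12]]] := fI.
have kI : I `<=` k by case: oI.
split; first exact: dual_omod.
exists [seq (p.2, p.1) | p <- w]; split.
- by move=> _ /mapP[p pw ->] /=; apply: w2.
- move=> _ /mapP[p pw ->] /=; split; first exact/kI/w1.
  by move=> x [_ xI]; rewrite mulrC; apply/xI/w1.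
by rewrite big_map -[RHS]w12; apply: eq_bigr => p _; rewrite mulrC.
Qed.

Lemma frid_mul_dual I : frid k I -> span_mul I (dual k I) = OO k.
Proof.
move=> [oI [w [w1 w2 w12]]]; have [kI _ _ IM] := oI.
rewrite eqEsubset; split.
  apply: span_mul_ind; [exact: OO0|exact: OOD|].
  by move=> x y Ix [ky yI]; split; [apply: (nfM nk) => //; apply: kI|apply: yI].
move=> x Ox; rewrite -[x]mulr1 -w12 mulr_sumr big_seq.
apply: span_mul_sum => p pw; rewrite mulrA; apply: mem_span_mul; last exact: w2.
by apply: IM => //; apply: w1.
Qed.

Lemma frid_mul I J : frid k I -> frid k J -> frid k (span_mul I J).
Proof.
move=> [oI [w [w1 w2 w12]]] [oJ [v [v1 v2 v12]]].
have kI : I `<=` k by case: oI.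
split; first exact: omod_span.
exists [seq (p.1 * q.1, p.2 * q.2) | p <- w, q <- v]; split.
- by move=> _ /allpairsP[[p q] [/= pw qv ->]]; apply: mem_span_mul; [apply: w1|apply: v1].
- move=> _ /allpairsP[[p q] [/= pw qv ->]].
  have [kp pI] := w2 p pw; have [kq qJ] := v2 q qv.
  split; first exact: (nfM nk).
  apply: (@span_mul_ind _ _ [set x | x * (p.2 * q.2) \in Aint]) => /=.
  + by rewrite mul0r rpred0.
  + by move=> x y xt yt; rewrite mulrDl rpredD.
  by move=> x y Ix Jy; rewrite mulrACA rpredM ?pI ?qJ.
rewrite big_allpairs_dep /= -[RHS](mulr1 1) -{1}w12 -v12 mulr_suml.
apply: eq_bigr => p _; rewrite mulr_sumr; apply: eq_bigr => q _.
by rewrite mulrACA.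
Qed.

Lemma frid_OO : frid k (OO k).
Proof.
split; first exact: omod_OO.
exists [:: (1, 1)]; split.
- by move=> p /[!inE] /eqP->; apply: OO1.
- move=> p /[!inE] /eqP-> /=; split; first exact: nf1 nk.
  by move=> x [_ xA]; rewrite mulr1.
by rewrite big_seq1 mulr1.
Qed.

Lemma frid_prin a : k a -> a != 0 -> frid k (prin k a).
Proof.
move=> ka a0; split.
  split.
  - by move=> _ [x [kx _] <-]; apply: (nfM nk).
  - by exists 0; rewrite ?mulr0 //; apply: OO0.
  - by move=> _ _ [x Ox <-] [y Oy <-]; exists (x + y); rewrite ?mulrDr //; apply: OOD.
  by move=> b _ Ob [x Ox <-]; exists (b * x); [apply: OOM|rewrite mulrCA].
exists [:: (a, a^-1)]; split.
- by move=> p /[!inE] /eqP->; exists 1; rewrite ?mulr1 //; apply: OO1.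
- move=> p /[!inE] /eqP-> /=; split; first exact: (nfV nk).
  by move=> _ [x [_ xA] <-]; rewrite mulrC mulrA mulVf // mul1r.
by rewrite big_seq1 divff.
Qed.

Lemma prin_mem a : prin k a a.
Proof. by exists 1; rewrite ?mulr1 //; apply: OO1. Qed.

Lemma span_prin a I : omod k I -> span_mul (prin k a) I = [set a * x | x in I].
Proof.
move=> [kI I0 ID IM]; rewrite eqEsubset; split.
  apply: span_mul_ind.
  - by exists 0; rewrite ?mulr0.
  - by move=> _ _ [x Ix <-] [y Iy <-]; exists (x + y); rewrite ?mulrDr //; apply: ID.
  by move=> _ y [x Ox <-] Iy; exists (x * y); rewrite ?mulrA //; apply: IM.
by move=> _ [x Ix <-]; apply: mem_span_mul => //; apply: prin_mem.
Qed.

(** Gauss's lemma supplies the certificate of invertibility. *)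
Lemma frid_gen (s : seq algC) : (forall x, x \in s -> k x) ->
  has (fun x => x != 0) s -> frid k (span_mul (OO k) [set` s]).
Proof.
move=> sk s0; have [t [kt st1 stA]] := content_inverse nk sk s0.
split.
  split.
  - apply: span_mul_ind; [exact: nf0 nk|exact: nfD nk|].
    by move=> x y [kx _] /= ys; apply: (nfM nk) => //; apply: sk.
  - exact: span_mul0.
  - exact: span_mulD.
  move=> a x Oa; move: x; apply: span_mul_ind.
  - by rewrite mulr0; apply: span_mul0.
  - by move=> u v; rewrite mulrDr; apply: span_mulD.
  by move=> u v Au Bv; rewrite mulrA; apply: mem_span_mul => //; apply: OOM.
exists [seq (s`_i, t i) | i : 'I_(size s)]; split.
- move=> _ /mapP[i _ ->] /=; rewrite -[s`_i]mul1r.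
  by apply: mem_span_mul; [apply: OO1|rewrite /= mem_nth].
- move=> _ /mapP[i _ ->] /=; split; first exact: kt.
  apply: (@span_mul_ind _ _ [set x | x * t i \in Aint]) => /=.
  + by rewrite mul0r rpred0.
  + by move=> x y xt yt; rewrite mulrDl rpredD.
  by move=> x y [_ xA] /(nthP 0)[j _ <-]; rewrite -mulrA rpredM.
by rewrite big_image /= -[RHS]st1.
Qed.

Lemma frid_fractional I : frid k I <-> fractional_ideal k I.
Proof.
split.
  move=> [oI [w [w1 w2 w12]]]; have [kI I0 ID IM] := oI.
  exists [seq p.1 | p <- w]; split.
  - by move=> x /= /mapP[p pw ->]; apply/kI/w1.
  - rewrite eqEsubset; split.
      move=> x Ix; rewrite -[x]mulr1 -w12 mulr_sumr big_seq.
      apply: span_mul_sum => p pw; rewrite mulrCA mulrC; apply: mem_span_mul.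
        have [kp pI] := w2 p pw; split; last exact: pI.
        by apply: (nfM nk) => //; apply: kI.
      by rewrite /=; apply: map_f.
    apply: span_mul_ind => // x y Ox /= /mapP[p pw ->]; apply: IM => //.
    exact: w1.
  apply: contrapT => h.
  have : \sum_(p <- w) p.1 * p.2 = 0.
    rewrite big_seq; apply: big1 => p pw.
    have [->|p0] := eqVneq p.1 0; first by rewrite mul0r.
    by case: h; exists p.1 => //; apply: w1.
  by rewrite w12 => /eqP; rewrite oner_eq0.
move=> [s [sk -> [x xI x0]]]; apply: frid_gen; first by [].
apply/negbNE/negP => /hasPn h; case/eqP: x0.
apply: (@span_mul_ind _ _ [set x | x = 0]) xI => //= [u v -> ->|u v _ /= vs].
  by rewrite addr0.
by have := h v vs; rewrite negbK => /eqP->; rewrite mulr0.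
Qed.

Lemma frid_cancel I J J' : frid k I -> omod k J -> omod k J' ->
  span_mul I J = span_mul I J' -> J = J'.
Proof.
move=> fI oJ oJ' E; rewrite -[J](span_OO oJ) -[J'](span_OO oJ').
by rewrite -(frid_mul_dual fI) ![span_mul I _]span_mulC -!span_mulA E.
Qed.

(** To contain is to divide; the quotient is the product with the inverse ideal. *)
Lemma frid_div I J : frid k I -> omod k J -> J `<=` I ->
  exists2 J', omod k J' /\ J' `<=` OO k & J = span_mul I J'.
Proof.
move=> fI oJ JI; have kI : I `<=` k by case: fI => -[].
exists (span_mul (dual k I) J).
  split; first by apply: omod_span => // x [].
  by rewrite -(frid_mul_dual fI) span_mulC; apply: span_mulS.
by rewrite span_mulA frid_mul_dual // span_OO.
Qed.

Lemma frid_div_frid I J : frid k I -> frid k J -> J `<=` I ->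
  exists2 J', frid k J' /\ J' `<=` OO k & J = span_mul I J'.
Proof.
move=> fI fJ JI; have kI : I `<=` k by case: fI => -[].
exists (span_mul (dual k I) J).
  split; first by apply: frid_mul => //; apply: frid_dual.
  by rewrite -(frid_mul_dual fI) span_mulC; apply: span_mulS.
by rewrite span_mulA frid_mul_dual // span_OO //; case: fJ.
Qed.

End Ideals.

Fixpoint ipow (k I : set algC) (m : nat) : set algC :=
  if m is m'.+1 then span_mul I (ipow k I m') else OO k.

Lemma omod_ipow n k I m : number_field n k -> I `<=` k -> omod k (ipow k I m).
Proof.
move=> nk kI; elim: m => [|m IH] /=; first exact: (omod_OO nk).
exact: (omod_span nk).
Qed.

Lemma frid_ipow n k I m : number_field n k -> frid k I -> frid k (ipow k I m).
Proof.
move=> nk fI; elim: m => [|m IH] /=; first exact: (frid_OO nk).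
exact: (frid_mul nk).
Qed.

Lemma ipowD n k I a b : number_field n k -> omod k I ->
  ipow k I (a + b) = span_mul (ipow k I a) (ipow k I b).
Proof.
move=> nk [kI _ _ _]; have oP m := omod_ipow m nk kI.
elim: a => [|a IH] /=; first by rewrite add0n (span_OO nk).
by rewrite IH span_mulA.
Qed.

Lemma ipowM n k I J m : number_field n k ->
  ipow k (span_mul I J) m = span_mul (ipow k I m) (ipow k J m).
Proof.
move=> nk; elim: m => [|m IH] /=; first by rewrite (span_OO nk) //; apply: (omod_OO nk).
by rewrite IH -!span_mulA; congr span_mul; rewrite !span_mulA [span_mul J _]span_mulC.
Qed.

Lemma ipow_prin n k a m : number_field n k -> k a -> ipow k (prin k a) m = prin k (a ^+ m).
Proof.
move=> nk ka; elim: m => [|m IH] /=.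
  by rewrite eqEsubset; split=> [x Ox|_ [x Ox <-]]; [exists x|]; rewrite ?mul1r.
have oX : omod k (ipow k (prin k a) m).
  apply: (omod_ipow _ nk) => _ [x [kx _] <-]; exact: (nfM nk).
rewrite (span_prin nk) // IH eqEsubset; split=> [_ [_ [x Ox <-] <-]|_ [x Ox <-]].
  by exists x => //; rewrite exprS mulrA.
by exists (a ^+ m * x); rewrite ?exprS ?mulrA //; exists x.
Qed.

(** The leading coefficient of an integer polynomial with root [x] clears its denominator, since
    [x *: f = 'X * f - ('X - x) * f] has integral coefficients when [('X - x) * f] has. *)
Lemma Aint_multiple (x : algC) : exists2 m : nat, (0 < m)%N & m%:R * x \in Aint.
Proof.
have [p [pE pm _]] := minCpolyP x.
have [q [a a0 qE]] := rat_poly_scale p.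
have q0 : q != 0.
  by apply: contraTneq (monic_neq0 pm) => q0; rewrite qE q0 map_poly0 scaler0 eqxx.
pose Q : {poly algC} := map_poly intr q.
have rQ : root Q x.
  have := root_minCpoly x; rewrite pE qE /root linearZ /= hornerZ mulf_eq0.
  rewrite fmorph_eq0 invr_eq0 intr_eq0 (negbTE a0) /=.
  rewrite /Q -map_poly_comp; congr (_.[_] == 0); apply: eq_map_poly => c /=.
  by rewrite ratr_int.
have [f fE] := factor_theorem _ _ rQ.
have QA : ('X - x%:P) * f \is a polyOver Aint.
  rewrite mulrC -fE; apply/polyOverP => i; by rewrite coef_map /= Aint_int.
have fA := Aint_div_root QA.
have xfA : x *: f \is a polyOver Aint.
  have -> : x *: f = 'X * f - ('X - x%:P) * f by rewrite -mul_polyC; ring.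
  by rewrite rpredB // rpredM // polyOverX.
have : lead_coef q != 0 by rewrite lead_coef_eq0.
have lE : (lead_coef q)%:~R = lead_coef f.
  rewrite -(lead_coef_map_inj (f := intr)) ?rmorph0 //; last exact: intr_inj.
  by rewrite -/Q fE lead_coef_Mmonic // monicXsubC.
move=> l0; exists `|lead_coef q|%N; first by rewrite absz_gt0.
have : (lead_coef q)%:~R * x \in Aint.
  by rewrite lE mulrC lead_coefE -coefZ; apply: (polyOverP xfA).
rewrite {1}(intEsign (lead_coef q)) rmorphMsign /= -mulrA mulr_sign.
by case: ifP => _; rewrite ?rpredN -pmulrn.
Qed.

Lemma Aint_multiple_fin (T : finType) (f : T -> algC) :
  exists2 m : nat, (0 < m)%N & forall t, m%:R * f t \in Aint.
Proof.
have [m mP] := choice (fun t => let: ex_intro2 m m0 mA := Aint_multiple (f t) in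
   ex_intro (fun m : nat => (0 < m)%N /\ m%:R * f t \in Aint) m (conj m0 mA)).
exists (\prod_t m t)%N; first by apply: prodn_gt0 => t; case: (mP t).
move=> t; rewrite (bigD1 t) //= mulnC natrM -mulrA rpredM ?rpred_nat //.
by case: (mP t).
Qed.

(** Not an integral basis: [b] consists of powers of an integral primitive element, [A] is an
    inverse Vandermonde matrix, and [m] clears the denominators of [A], hence those of the
    coordinates of all integers of [k] at once. *)
Lemma int_basis n k : number_field n k ->
  exists (e : 'I_n -> algCaut) (b : 'I_n -> algC) (A : 'I_n -> 'I_n -> algC) (m : nat),
    let C x j := \sum_i A j i * e i x in
    [/\ (forall s : algCaut, exists i, forall x, k x -> s x = e i x) /\
          (forall i j, (forall x, k x -> e i x = e j x) -> i = j),
        (0 < m)%N /\ forall j, OO k (b j),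
        forall x, k x -> x = \sum_j C x j * b j,
        forall x j, k x -> C x j \in Crat
      & forall x j, OO k x -> m%:R * C x j \in Num.int].
Proof.
move=> nk; have [th0 [e [kth0 einj0 esurj]]] := number_field_emb nk.
have [c c0 thA] := Aint_multiple th0.
pose th := c%:R * th0.
have kth : k th by apply: (nfM nk) => //; apply: (nf_nat nk).
have einj : injective (fun i => e i th).
  move=> i j; rewrite /th !rmorphM !rmorph_nat => /mulfI E; apply: einj0; apply: E.
  by rewrite pnatr_eq0 -lt0n.
pose a : 'rV[algC]_n := \row_i e i th.
pose V : 'M[algC]_n := (Vandermonde n a)^T.
have VE i j : V i j = e i (th ^+ j) by rewrite !mxE rmorphXn.
have Vu : V \in unitmx.
  rewrite unitmx_tr unitmxE det_Vandermonde unitfE.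
  apply/prodf_neq0 => i _; apply/prodf_neq0 => j ltij.
  rewrite !mxE subr_eq0; apply/eqP => /einj E.
  by rewrite E ltnn in ltij.
pose A j i := invmx V j i.
pose C x j := \sum_i A j i * e i x.
have CE x j : C x j = (invmx V *m \col_i e i x) j 0.
  by rewrite mxE; apply: eq_bigr => i _; rewrite !mxE.
have VC x i : \sum_(j < n) e i (th ^+ j) * C x j = e i x.
  transitivity ((V *m (invmx V *m \col_i e i x)) i 0).
    by rewrite [RHS]mxE; apply: eq_bigr => j _; rewrite VE CE.
  by rewrite mulKVmx // mxE.
have Cuniq (D : 'I_n -> algC) x : (forall i, \sum_(j < n) e i (th ^+ j) * D j = e i x) ->
    forall j, D j = C x j.
  move=> DE j; rewrite CE; have -> : D j = (\col_j D j) j 0 by rewrite mxE.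
  congr ((_ : matrix _ _ _) _ _); rewrite -[LHS](mulKmx Vu); congr (_ *m _).
  apply/colP => i; rewrite [RHS]mxE -DE mxE; apply: eq_bigr => j' _.
  by rewrite VE mxE.
have [m m0 mA] := Aint_multiple_fin (fun ji : 'I_n * 'I_n => A ji.1 ji.2).
have Crt x j : k x -> C x j \in Crat.
  move=> kx; apply: fixed_rat => s; move: j.
  have [p pE] := choice (fun i => esurj (acomp s (e i))).
  have pI : injective p.
    move=> i j E; apply: einj; apply: (fmorph_inj s).
    by rewrite -!acompE !pE ?E.
  apply: (Cuniq (fun j => s (C x j))) => i.
  have /codomP[i' ->] : i \in codom p by apply: (inj_card_onto pI).
  rewrite -pE // acompE -(VC x i') rmorph_sum; apply: eq_bigr => j _.
  by rewrite rmorphM /= -pE // ; apply: (nfX nk).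
exists e, (fun j => th ^+ j), A, m; split=> //.
- by split=> // i j h; apply: einj; apply: h.
- by split=> // j; apply: (OOX nk).
- move=> x kx; have [i0 i0E] := esurj (idfun : algCaut).
  rewrite -[LHS]/(idfun x) (i0E x kx) -VC; apply: eq_bigr => j _.
  by rewrite mulrC -i0E //; apply: (nfX nk).
move=> x j [kx xA]; apply: Cint_rat_Aint.
  by rewrite rpredM ?rpred_nat ?Crt.
rewrite mulr_sumr rpred_sum // => i _; rewrite mulrA rpredM ?Aint_aut //.
exact: (mA (j, i)).
Qed.

(** * Indices and maximal ideals *)

(** Indices are carried by lists of representatives instead of quotient groups; [B] need not lie
    inside [A], which makes it possible to shrink [A] alone. *)
Definition transv (A B : set algC) (s : seq algC) : Prop :=
  [/\ uniq s, forall x, x \in s -> A x,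
      forall x y, x \in s -> y \in s -> B (x - y) -> x = y
    & forall x, A x -> exists2 y, y \in s & B (x - y)].

Definition idx (A B : set algC) (N : nat) : Prop :=
  exists2 s, transv A B s & size s = N.

Section Index.
Variables (n : nat) (k : set algC).
Hypothesis nk : number_field n k.
Implicit Types A B C : set algC.

Lemma idx_bound A B N s : omod k B -> idx A B N -> uniq s ->
  (forall x, x \in s -> A x) ->
  (forall x y, x \in s -> y \in s -> B (x - y) -> x = y) -> (size s <= N)%N.
Proof.
move=> oB [t [ut tA tB tr] <-] us sA sB.
have h x : exists y, A x -> y \in t /\ B (x - y).
  have [Ax|nAx] := pselect (A x); last by exists 0.
  by have [y yt By] := tr x Ax; exists y.
have [r rP] := choice h.
rewrite -(size_map r s); apply: uniq_leq_size.
  rewrite map_inj_in_uniq // => x y xs ys E; apply: sB => //.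
  have [_ Bx] := rP x (sA x xs); have [_ By] := rP y (sA y ys).
  have -> : x - y = (x - r x) - (y - r y) by rewrite E; ring.
  exact: (omodB nk).
by move=> _ /mapP[x xs ->]; have [] := rP x (sA x xs).
Qed.

Lemma idx_unique A B N M : omod k B -> idx A B N -> idx A B M -> N = M.
Proof.
move=> oB iN iM; apply/eqP; rewrite eqn_leq.
have [s [us sA sB _] sN] := iN; have [t [ut tA tB _] tM] := iM.
by rewrite -{1}sN (idx_bound oB iM) // -tM (idx_bound oB iN).
Qed.

(** A longest list of pairwise incongruent elements is a transversal. *)
Lemma idx_exists A B M : omod k B ->
  (forall s, uniq s -> (forall x, x \in s -> A x) ->
    (forall x y, x \in s -> y \in s -> B (x - y) -> x = y) -> (size s <= M)%N) ->
  exists2 N, (N <= M)%N & idx A B N.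
Proof.
move=> oB bnd.
pose Q N := `[< exists s, [/\ uniq s, forall x, x \in s -> A x,
   forall x y, x \in s -> y \in s -> B (x - y) -> x = y & size s = N] >].
have exQ : exists N, Q N by exists 0%N; apply/asboolP; exists [::].
have bQ N : Q N -> (N <= M)%N by move=> /asboolP[s [us sA sB <-]]; apply: bnd.
have [N /asboolP[s [us sA sB sN]] Nmax] := ex_maxnP exQ bQ.
exists N; first by apply: bQ; apply/asboolP; exists s.
exists s => //; split=> // x Ax; apply: contrapT => h.
have hx y : y \in s -> ~ B (x - y) by move=> ys Bxy; apply: h; exists y.
have := Nmax N.+1; rewrite ltnn => H; suff: false by []. apply: H.
apply/asboolP; exists (x :: s); split; rewrite /= ?sN //.
- rewrite us andbT; apply/negP => xs; apply: (hx x xs).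
  by rewrite subrr; case: oB.
- by move=> y; rewrite inE => /orP[/eqP->|/sA].
move=> y z; rewrite !inE => /orP[/eqP->|ys] /orP[/eqP->|zs] //.
- by move=> /hx - /(_ zs).
- move=> Byx; have := omodB nk oB (_ : B 0) Byx; rewrite sub0r opprB => h2.
  by case: (hx y ys); apply: h2; case: oB.
exact: sB.
Qed.

Lemma idx_super A B C N : omod k B -> omod k C -> B `<=` C -> idx A B N ->
  exists2 M, (M <= N)%N & idx A C M.
Proof.
move=> oB oC BC iN; apply: idx_exists => // s us sA sC.
by apply: (idx_bound oB iN) => // x y xs ys Bxy; apply: sC => //; apply: BC.
Qed.

Lemma idx_sub A A' B N : omod k B -> A' `<=` A -> idx A B N ->
  exists2 M, (M <= N)%N & idx A' B M.
Proof.
move=> oB AA iN; apply: idx_exists => // s us sA sB.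
by apply: (idx_bound oB iN) => // x /sA /AA.
Qed.

Lemma idx_tower A B C N M : omod k A -> omod k B -> omod k C -> B `<=` A -> C `<=` B ->
  idx A B N -> idx B C M -> idx A C (N * M).
Proof.
move=> oA oB oC BA CB [s [us sA sB sr] <-] [t [ut tB tC tr] <-].
have key x y x' y' : x \in s -> y \in t -> x' \in s -> y' \in t ->
    C ((x + y) - (x' + y')) -> x = x' /\ y = y'.
  move=> xs yt xs' yt' Cxy.
  have E : x = x'.
    apply: sB => //; have -> : x - x' = (x + y - (x' + y')) - (y - y') by ring.
    by apply: (omodB nk) => //; [apply: CB|apply: (omodB nk) => //; apply: tB].
  split=> //; apply: tC => //.
  by have -> : y - y' = x + y - (x' + y') by rewrite E; ring.
have C0 : C 0 by case: oC.
exists [seq x + y | x <- s, y <- t]; last by rewrite size_allpairs.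
split.
- rewrite allpairs_uniq // => -[x y] [x' y'] /allpairsP[[u v] [/= us' vt [-> ->]]].
  move=> /allpairsP[[u' v'] [/= us'' vt' [-> ->]]] /= E.
  by have [-> ->] : u = u' /\ v = v' by apply: key => //; rewrite E subrr.
- move=> _ /allpairsP[[x y] [/= xs yt ->]].
  by case: oA => _ _ AD _; apply: AD; [apply: sA|apply/BA/tB].
- move=> _ _ /allpairsP[[x y] [/= xs yt ->]] /allpairsP[[x' y'] [/= xs' yt' ->]].
  by move=> /key[] // -> ->.
move=> z Az; have [x xs Bx] := sr z Az; have [y yt Cy] := tr _ Bx.
exists (x + y); last by rewrite opprD addrA.
by apply/allpairsP; exists (x, y).
Qed.

Lemma idx_refl A : omod k A -> idx A A 1.
Proof.
move=> oA; exists [:: 0] => //; split=> //.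
- by move=> x; rewrite inE => /eqP->; case: oA.
- by move=> x y; rewrite !inE => /eqP-> /eqP->.
by move=> x Ax; exists 0; rewrite ?inE ?subr0.
Qed.

Lemma idx1 A B : omod k A -> omod k B -> B `<=` A -> idx A B 1 -> A = B.
Proof.
move=> oA oB BA [s [us sA sB sr] s1]; rewrite eqEsubset; split=> // x Ax.
have [y ys Bxy] := sr x Ax; have [z zs Bz] := sr 0 (let: And4 _ h _ _ := oA in h).
have E : y = z.
  by case: s s1 ys zs {us sA sB sr} => [|u [|]] //= _; rewrite !inE => /eqP-> /eqP->.
have E2 : x = (x - y) - (0 - z) by rewrite E; ring.
by rewrite E2; apply: (omodB nk).
Qed.

Lemma idx_gt0 A B N : omod k A -> idx A B N -> (0 < N)%N.
Proof.
by move=> [_ A0 _ _] [s [_ _ _ sr] <-]; have [y] := sr 0 A0; case: s {sr}.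
Qed.

(** Translation by [x] permutes the classes; comparing the sums of representatives before and after
    leaves [N * x]. *)
Lemma idx_mem A B N x : omod k A -> omod k B -> B `<=` A -> idx A B N -> A x ->
  B (N%:R * x).
Proof.
move=> oA oB BA [s [us sA sB sr] <-] Ax.
have [_ A0 AD _] := oA.
have h y : exists z, y \in s -> z \in s /\ B (y + x - z).
  case: (boolP (y \in s)) => ys; last by exists 0.
  by have [z zs Bz] := sr (y + x) (AD _ _ (sA y ys) Ax); exists z.
have [r rP] := choice h.
have p : perm_eq [seq r y | y <- s] s.
  have ur : uniq [seq r y | y <- s].
    rewrite map_inj_in_uniq // => y z ys zs E.
    have [_ By] := rP y ys; have [_ Bz] := rP z zs.
    apply: sB => //; have -> : y - z = (y + x - r y) - (z + x - r z) by rewrite E; ring.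
    exact: (omodB nk).
  apply: uniq_perm => //; apply: (uniq_min_size ur _ _).2; last by rewrite size_map.
  by move=> _ /mapP[y ys ->]; have [] := rP y ys.
have -> : (size s)%:R * x = \sum_(y <- s) (y + x - r y).
  rewrite sumrB big_split /= -(big_map r xpredT id) (perm_big s p) /=.
  rewrite big_const_seq count_predT iter_addr addr0 -mulr_natl; ring.
have [_ B0 BD _] := oB; rewrite big_seq; elim/big_ind: _ => // y ys.
by have [] := rP y ys.
Qed.


(** Integers are separated modulo [N] by their scaled coordinates modulo [N * d]. The surplus factor
    [d ^ n] does not depend on [N], so it disappears when [N] runs through powers of a prime. *)
Lemma OO_mod : exists2 d : nat, (0 < d)%N & forall N : nat, (0 < N)%N ->
  exists2 M, (M <= (N * d) ^ n)%N & idx (OO k) (prin k N%:R) M.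
Proof.
have [e [b [A [m [_ [m0 bO] xE _ Cint]]]]] := int_basis nk.
pose C x j := \sum_i A j i * e i x.
have CB x y j : C (x - y) j = C x j - C y j.
  by rewrite /C -sumrB; apply: eq_bigr => i _; rewrite rmorphB mulrBr.
exists m => // N N0.
have oP : omod k (prin k N%:R).
  apply: frid_omod; apply: (frid_prin nk); rewrite ?pnatr_eq0 -?lt0n //.
  exact: nf_nat nk _.
apply: (idx_exists oP) => s us sA sB.
pose z x j : int := Num.floor (m%:R * C x j).
have zE x j : OO k x -> m%:R * C x j = (z x j)%:~R.
  by move=> Ox; rewrite /z [RHS](floorK (Cint x j Ox)).
have Nm0 : (0 < N * m)%N by rewrite muln_gt0 N0.
have lt x j : (`|(z x j %% (N * m)%N)%Z| < N * m)%N.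
  rewrite -ltz_nat gez0_abs ?modz_ge0 ?ltz_pmod ?ltz_nat //.
  by rewrite -lt0n.
pose key x : {ffun 'I_n -> 'I_(N * m)} := [ffun j => Ordinal (lt x j)].
rewrite -[n in (_ ^ n)%N]card_ord -[X in (X ^ _)%N]card_ord -card_ffun.
rewrite -(size_map key) cardE; apply: uniq_leq_size; last by move=> f; rewrite mem_enum.
rewrite map_inj_in_uniq // => x y xs ys /ffunP E; apply: sB => //.
have [Ox Oy] := (sA x xs, sA y ys).
have h j : exists q : int, C (x - y) j = q%:~R * N%:R.
  have /eqP := congr1 val (E j); rewrite !ffunE /= -eqz_nat !gez0_abs ?modz_ge0 // -?lt0n //.
  rewrite eqz_mod_dvd => /dvdzP[q qE]; exists q.
  apply: (@mulfI _ (m%:R)); first by rewrite pnatr_eq0 -lt0n.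
  rewrite CB mulrBr !zE // -rmorphB /= qE rmorphM /= -pmulrn natrM; ring.
have [q qE] := choice h.
have kxy : k (x - y) by apply: (nfB nk); [case: Ox|case: Oy].
exists (\sum_j (q j)%:~R * b j).
  apply: omod_sum; first exact: (omod_OO nk).
  move=> j _; apply: (OOM nk) => //; split; first exact: nf_int nk _.
  by rewrite /= rpred_int.
rewrite [RHS](xE _ kxy) mulr_sumr; apply: eq_bigr => j _.
rewrite -/(C (x - y) j) qE; ring.
Qed.

Lemma omod_int I x : omod k I -> I `<=` OO k -> I x -> x != 0 ->
  exists2 m : nat, (0 < m)%N & I m%:R.
Proof.
move=> [kI I0 ID IM] IO Ix x0; have [m m0 mA] := Aint_multiple x^-1.
exists m => //; have -> : m%:R = (m%:R * x^-1) * x by rewrite mulfVK.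
apply: IM => //; split=> //; apply: (nfM nk); first exact: nf_nat nk _.
by apply: (nfV nk); apply: kI.
Qed.

Lemma omod_prin_nat m : (0 < m)%N -> omod k (prin k m%:R).
Proof.
move=> m0; apply: frid_omod; apply: (frid_prin nk); rewrite ?pnatr_eq0 -?lt0n //.
exact: nf_nat nk _.
Qed.

Lemma prin_sub I x : omod k I -> I x -> prin k x `<=` I.
Proof. by move=> [_ _ _ IM] Ix _ [y Oy <-]; rewrite mulrC; apply: IM. Qed.

Lemma idx_ex A B m : omod k B -> A `<=` OO k -> (0 < m)%N -> B m%:R ->
  exists N, idx A B N.
Proof.
move=> oB AO m0 Bm; have [d d0 /(_ m m0)[M _ iM]] := OO_mod.
have [N1 _ i1] := idx_super (omod_prin_nat m0) oB (prin_sub oB Bm) iM.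
by have [N _ iN] := idx_sub oB AO i1; exists N.
Qed.

(** A nonzero ideal contains a positive integer [m], so it is generated by [m] and finitely many
    representatives modulo [m]. *)
Lemma omod_frid I x : omod k I -> I `<=` OO k -> I x -> x != 0 -> frid k I.
Proof.
move=> oI IO Ix x0; have [m m0 Im] := omod_int oI IO Ix x0.
have [kI I0 ID IM] := oI.
have [N [s [us sA sB sr] _]] := idx_ex (omod_prin_nat m0) IO m0 (prin_mem nk _).
have -> : I = span_mul (OO k) [set` m%:R :: s].
  rewrite eqEsubset; split=> [y Iy|].
    have [z zs [u Ou uE]] := sr y Iy.
    have -> : y = u * m%:R + 1 * z by rewrite mul1r mulrC uE subrK.
    apply: span_mulD; apply: mem_span_mul => //; rewrite /= ?inE ?eqxx ?zs ?orbT //.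
    exact: OO1 nk.
  apply: span_mul_ind => // u v Ou /=; rewrite inE => /orP[/eqP->|vs]; apply: IM => //.
  exact: sA.
apply: (frid_gen nk).
  move=> y; rewrite inE => /orP[/eqP->|ys]; first exact: nf_nat nk _.
  by apply: kI; apply: sA.
by rewrite /= pnatr_eq0 -lt0n m0.
Qed.

End Index.

Definition idealZ (P : set algC) : Prop :=
  [/\ P `<=` ZZ, P 0, forall x y, P x -> P y -> P (x + y)
    & forall a x, a \in Aint -> P x -> P (a * x)].

Definition primeZ (P : set algC) : Prop :=
  [/\ idealZ P, ~ P 1
    & forall x y, x \in Aint -> y \in Aint -> P (x * y) -> P x \/ P y].

Lemma prime_exists J : idealZ J -> ~ J 1 -> exists2 P, primeZ P & J `<=` P.
Proof.
move=> iJ J1; have [JZ J0 JD JM] := iJ.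
(* Adjoining [J] makes the empty chain harmless for Zorn's lemma: its union is empty and stands for
   [J] itself. *)
pose Q A := idealZ (A `|` J) /\ ~ (A `|` J) 1.
have [A [[iA A1] Amax]] : exists A, Q A /\ forall B, A `<` B -> ~ Q B.
  apply: (@Zorn_bigcup _ Q) => F FQ Ftot.
  have [nF|nF] := pselect (exists A, F A); last first.
    have -> : \bigcup_(X in F) X = set0.
      by rewrite eqEsubset; split=> // x [X FX _]; case: nF; exists X.
    by rewrite /Q set0U.
  have key x y : (\bigcup_(X in F) X `|` J) x -> (\bigcup_(X in F) X `|` J) y ->
      exists2 X, F X & (X `|` J) x /\ (X `|` J) y.
    move=> [[X FX Xx]|Jx] [[Y FY Yy]|Jy].
    - have [XY|YX] := Ftot X Y FX FY.
        by exists Y => //; split; left => //; apply: XY.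
      by exists X => //; split; left => //; apply: YX.
    - by exists X => //; split; [left|right].
    - by exists Y => //; split; [right|left].
    by have [X FX] := nF; exists X => //; split; right.
  have up X x : F X -> (X `|` J) x -> (\bigcup_(X in F) X `|` J) x.
    by move=> FX [Xx|Jx]; [left; exists X|right].
  split; last first.
    by move=> h; have [X FX [X1 _]] := key _ _ h h; have [_] := FQ X FX.
  split.
  - by move=> x h; have [X FX [Xx _]] := key _ _ h h; have [[XZ _ _ _] _] := FQ X FX; apply: XZ.
  - by right.
  - move=> x y hx hy; have [X FX [Xx Xy]] := key _ _ hx hy.
    by apply: (up X) => //; have [[_ _ XD _] _] := FQ X FX; apply: XD.
  move=> a x aA hx; have [X FX [Xx _]] := key _ _ hx hx.
  by apply: (up X) => //; have [[_ _ _ XM] _] := FQ X FX; apply: XM.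
pose P := A `|` J; exists P; last by move=> x; right.
have [PZ P0 PD PM] := iA.
have key x : x \in Aint -> ~ P x -> exists2 a, a \in Aint & P (1 - a * x).
  move=> xA nPx; apply: contrapT => h.
  pose B := [set z | exists p a, [/\ P p, a \in Aint & z = p + a * x]].
  have PB : P `<=` B by move=> p Pp; exists p, 0; rewrite mul0r addr0 rpred0.
  have BJ : B `|` J = B by apply/setUidPl => z Jz; apply: PB; right.
  have AB : A `<` B.
    split=> [z Az|BA]; first by apply: PB; left.
    by apply: nPx; left; apply: BA; exists 0, 1; rewrite mul1r add0r rpred1.
  apply: (Amax B AB); split; rewrite BJ.
    split.
    - move=> _ [p [a [Pp aA ->]]]; rewrite /= rpredD ?rpredM //; exact: PZ.
    - exact: PB.
    - move=> _ _ [p [a [Pp aA ->]]] [q [b [Pq bA ->]]].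
      exists (p + q), (a + b); rewrite rpredD //; split=> //; last by ring.
      exact: PD.
    move=> c _ cA [p [a [Pp aA ->]]]; exists (c * p), (c * a).
    by rewrite rpredM //; split=> //; [apply: PM|ring].
  move=> [p [a [Pp aA E]]]; apply: h; exists a => //.
  by rewrite E addrK.
split=> // x y xA yA Pxy; apply: contrapT => /not_orP[nx ny].
have [a aA Pa] := key x xA nx; have [b bA Pb] := key y yA ny.
apply: A1; rewrite -/P.
have -> : 1 = (1 - a * x) + (a * x) * (1 - b * y) + (a * b) * (x * y) by ring.
by apply: (PD); [apply: (PD) => //; apply: (PM) => //; rewrite rpredM|apply: (PM); rewrite ?rpredM].
Qed.

Lemma primeX P x m : primeZ P -> x \in Aint -> P (x ^+ m) -> P x.
Proof.
move=> [[PZ P0 PD PM] P1 Pp] xA; elim: m => [|m IH]; first by rewrite expr0.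
by rewrite exprS => /Pp[] //; rewrite rpredX.
Qed.

(** Maximality is expressed by inverses in the residue ring; the positive integer excludes the zero
    ideal. *)
Definition maxid (k P : set algC) : Prop :=
  [/\ omod k P /\ P `<=` OO k, exists2 m : nat, (0 < m)%N & P m%:R, ~ P 1
    & forall x, OO k x -> ~ P x -> exists2 y, OO k y & P (1 - x * y)].

(** A finite domain is a field: two powers of [x] agree modulo [m], and as [P] is prime this makes a
    power of [x] an inverse of [x] modulo [P]. *)
Lemma prime_contract n k P m : number_field n k -> primeZ P -> (0 < m)%N ->
  P m%:R -> maxid k (k `&` P).
Proof.
move=> nk pP m0 Pm; have [[PZ P0 PD PM] P1 Pp] := pP.
split.
- split; last by move=> x [kx Px]; split=> //; apply: PZ.
  split=> [x []//||x y [kx Px] [ky Py]|a x [ka aA] [kx Px]].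
  + by split=> //; apply: nf0 nk.
  + by split; [apply: (nfD nk)|apply: PD].
  by split; [apply: (nfM nk)|apply: PM].
- by exists m => //; split=> //; apply: nf_nat nk _.
- by move=> [_ /P1].
move=> x Ox nPx.
have nP : ~ P x by move=> h; apply: nPx; split=> //; case: Ox.
have [d d0 /(_ m m0)[M _ iM]] := OO_mod nk.
have [i [j [ltij [y Oy yE]]]] : exists i j : nat, (i < j)%N /\ prin k m%:R (x ^+ j - x ^+ i).
  apply: contrapT => h.
  pose s := [seq x ^+ i | i <- iota 0 M.+1].
  have h' i j : prin k m%:R (x ^+ j - x ^+ i) -> i = j.
    move=> hp; case: (ltngtP i j) => // lt; case: h.
      by exists i, j.
    exists j, i; split=> //; case: hp => y Oy yE; exists (- y); first exact: (OON nk).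
    by rewrite mulrN yE opprB.
  have oP := omod_prin_nat nk m0.
  have P00 : prin k m%:R 0 by case: oP.
  have us : uniq s.
    rewrite map_inj_uniq ?iota_uniq // => i j E; apply: h'; by rewrite E subrr.
  have := idx_bound nk oP iM us; rewrite size_map size_iota ltnn => H.
  suff: false by []. apply: H.
    by move=> _ /mapP[i _ ->]; apply: (OOX nk).
  by move=> _ _ /mapP[i _ ->] /mapP[j _ ->] /h' ->.
have Pij : P (x ^+ i * (1 - x * x ^+ (j - i).-1)).
  have -> : x ^+ i * (1 - x * x ^+ (j - i).-1) = - y * m%:R.
    rewrite -exprS prednK ?subn_gt0 // mulrBr mulr1 -exprD subnKC ?(ltnW ltij) //.
    by rewrite mulNr [y * _]mulrC yE opprB.
  by apply: PM => //; rewrite rpredN; case: Oy.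
have xA : x \in Aint by case: Ox.
exists (x ^+ (j - i).-1); first exact: (OOX nk).
have yA : 1 - x * x ^+ (j - i).-1 \in Aint.
  by rewrite rpredB ?rpred1 // rpredM // rpredX.
have [/(primeX pP xA)//|h] := Pp _ _ (rpredX i xA) yA Pij.
split=> //; apply: (nfB nk); first exact: nf1 nk.
by apply: (nfM nk); [case: Ox|apply: (nfX nk); case: Ox].
Qed.

Lemma maxid_frid n k P : number_field n k -> maxid k P -> frid k P.
Proof.
move=> nk [[oP PO] [m m0 Pm] _ _]; apply: (omod_frid nk oP PO Pm).
by rewrite pnatr_eq0 -lt0n.
Qed.

Lemma idealZ_span A : A `<=` ZZ -> idealZ (span_mul ZZ A).
Proof.
move=> AZ; split.
- apply: span_mul_ind => [|x y xA yA|x y xA /AZ yA] /=; first exact: rpred0.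
    exact: rpredD.
  exact: rpredM.
- exact: span_mul0.
- exact: span_mulD.
move=> a x aA; move: x; apply: span_mul_ind.
- by rewrite mulr0; apply: span_mul0.
- by move=> u v; rewrite mulrDr; apply: span_mulD.
by move=> u v uA Av; rewrite mulrA; apply: mem_span_mul => //; apply: rpredM.
Qed.

Lemma maxid_exists n k J : number_field n k -> frid k J -> J `<=` OO k -> ~ J 1 ->
  exists2 P, maxid k P & J `<=` P.
Proof.
move=> nk fJ JO J1; have JZ : J `<=` ZZ by move=> x /JO[].
have [P pP JP] : exists2 P, primeZ P & span_mul ZZ J `<=` P.
  apply: prime_exists; first exact: idealZ_span.
  by move=> h; apply: J1; apply: (frid_contract nk fJ) => //; apply: nf1 nk.
have JP' x : J x -> P x.
  by move=> Jx; apply: JP; rewrite -[x]mul1r; apply: mem_span_mul; rewrite //= rpred1.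
have [x Jx x0] : exists2 x, J x & x != 0.
  by have /(frid_fractional nk)[s [_ _]] := fJ.
have [m m0 Jm] := omod_int nk (frid_omod fJ) JO Jx x0.
exists (k `&` P); first exact: (prime_contract nk pP m0 (JP' _ Jm)).
by move=> y Jy; split; [case: (JO y Jy)|apply: JP'].
Qed.

Section IndexMul.
Variables (n : nat) (k : set algC).
Hypothesis nk : number_field n k.

Lemma span_subr I J : omod k I -> J `<=` OO k -> span_mul I J `<=` I.
Proof.
move=> [kI I0 ID IM] JO; apply: span_mul_ind => // x y Ix /JO Oy.
by rewrite mulrC; apply: IM.
Qed.

Lemma span_subl I J : omod k J -> I `<=` OO k -> span_mul I J `<=` J.
Proof. by move=> oJ IO; rewrite span_mulC; apply: span_subr. Qed.

Lemma omod_1 I : omod k I -> I `<=` OO k -> I 1 -> I = OO k.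
Proof.
move=> [kI I0 ID IM] IO I1; rewrite eqEsubset; split=> // x Ox.
by rewrite -[x]mulr1; apply: IM.
Qed.

Lemma span_OOr I : omod k I -> span_mul I (OO k) = I.
Proof. by move=> oI; rewrite span_mulC (span_OO nk). Qed.

Lemma frid_le I A B : frid k I -> omod k A -> omod k B ->
  span_mul I A `<=` span_mul I B -> A `<=` B.
Proof.
move=> fI oA oB AB; rewrite -[A](span_OO nk oA) -[B](span_OO nk oB).
rewrite -(frid_mul_dual nk fI) ![span_mul I _]span_mulC -!span_mulA.
exact: span_mulS.
Qed.

(** For [a] in [I] outside [I * P], the module [X = a * OO k + I * P] equals [I * J] with [J]
    containing [P] strictly, so [X = I] by maximality. Multiplication by [a] thus carries residues
    modulo [P] to residues of [I] modulo [I * P]. *)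
Lemma idx_maxid P I N : maxid k P -> frid k I -> idx (OO k) P N ->
  idx I (span_mul I P) N.
Proof.
move=> mP fI [s [us sO sP sr] sN].
have [[oP PO] [m m0 Pm] P1 Pmax] := mP.
have oI := frid_omod fI; have [kI I0 ID IM] := oI; have [kP P0 PD PM] := oP.
have oIP : omod k (span_mul I P) by apply: (omod_span nk).
have [a Ia nIPa] : exists2 a, I a & ~ span_mul I P a.
  apply: contrapT => h; apply: P1.
  have E : span_mul I P = span_mul I (OO k).
    rewrite span_OOr // eqEsubset; split; first exact: span_subr.
    by move=> x Ix; apply: contrapT => nx; apply: h; exists x.
  rewrite (frid_cancel nk fI oP (omod_OO nk) E); exact: (OO1 nk).
have aP x : OO k x -> span_mul I P (a * x) -> P x.
  move=> Ox ax; apply: contrapT => nPx; have [y Oy Py] := Pmax x Ox nPx.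
  apply: nIPa; have -> : a = a * (1 - x * y) + y * (a * x) by ring.
  by have [_ _ XD XM] := oIP; apply: XD; [apply: mem_span_mul|apply: XM].
have a0 : a != 0 by apply: contra_notN nIPa => /eqP->; case: oIP.
pose X := [set z | exists x y, [/\ OO k x, span_mul I P y & z = a * x + y]].
have oX : omod k X.
  split.
  - move=> _ [x [y [[kx _] /(span_subr oI PO)/kI ky ->]]].
    by apply: (nfD nk) => //; apply: (nfM nk) => //; apply: kI.
  - by exists 0, 0; rewrite mulr0 addr0; split=> //; [apply: (OO0 nk)|case: oIP].
  - move=> _ _ [x [y [Ox Iy ->]]] [x' [y' [Ox' Iy' ->]]].
    exists (x + x'), (y + y'); split; [exact: (OOD nk)| |ring].
    by case: oIP => _ _ XD _; apply: XD.
  move=> b _ Ob [x [y [Ox Iy ->]]]; exists (b * x), (b * y); split; [exact: (OOM nk)| |ring].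
  by case: oIP => _ _ _ XM; apply: XM.
have XI : X `<=` I.
  move=> _ [x [y [Ox /(span_subr oI PO) Iy ->]]]; apply: ID => //.
  by rewrite mulrC; apply: IM.
have [J [oJ JO] XE] := frid_div nk fI oX XI.
have PJ : P `<=` J.
  apply: (frid_le fI oP oJ); rewrite -XE => y Iy; exists 0, y.
  by rewrite mulr0 add0r; split=> //; apply: (OO0 nk).
have IX : I `<=` X.
  rewrite XE; suff -> : J = OO k by rewrite span_OOr.
  apply: omod_1 => //; apply: contrapT => nJ1; apply: nIPa.
  have -> : P = J.
    rewrite eqEsubset; split=> // y Jy; apply: contrapT => nPy.
    have [z Oz Pz] := Pmax y (JO y Jy) nPy; apply: nJ1.
    have -> : 1 = (1 - y * z) + z * y by ring.
    by have [_ _ XD XM] := oJ; apply: XD; [apply: PJ|apply: XM].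
  rewrite -XE; exists 1, 0; rewrite mulr1 addr0; split=> //; first exact: (OO1 nk).
  by case: oIP.
exists [seq a * x | x <- s]; last by rewrite size_map.
have key x y : x \in s -> y \in s -> span_mul I P (a * x - a * y) -> x = y.
  move=> xs ys; rewrite -mulrBr => /aP h; apply: sP => //; apply: h.
  by apply: (OOB nk); apply: sO.
split.
- by rewrite map_inj_uniq // => x y; apply: mulfI.
- by move=> _ /mapP[x xs ->]; rewrite mulrC; apply: IM => //; apply: sO.
- by move=> _ _ /mapP[x xs ->] /mapP[y ys ->] /key ->.
move=> z /IX [x [y [Ox Iy ->]]]; have [x' xs' Px'] := sr x Ox.
exists (a * x'); first exact: map_f.
have -> : a * x + y - a * x' = a * (x - x') + y by ring.
by have [_ _ XD _] := oIP; apply: XD => //; apply: mem_span_mul.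
Qed.

Lemma frid_nat J : frid k J -> J `<=` OO k -> exists2 m : nat, (0 < m)%N & J m%:R.
Proof.
move=> fJ JO; have [s [_ _ [x Jx x0]]] := (frid_fractional nk J).1 fJ.
exact: (omod_int nk (frid_omod fJ) JO Jx x0).
Qed.

Lemma idx_frid A J : frid k J -> J `<=` OO k -> A `<=` OO k -> exists N, idx A J N.
Proof.
move=> fJ JO AO; have [m m0 Jm] := frid_nat fJ JO.
exact: (idx_ex nk (frid_omod fJ) AO m0 Jm).
Qed.

(** Splitting off a maximal ideal lowers the index strictly; induction on the index takes the place
    of unique factorisation. *)
Lemma frid_split J N : frid k J -> J `<=` OO k -> idx (OO k) J N -> ~ J 1 ->
  exists P J' M, [/\ maxid k P, J `<=` P, frid k J' /\ J' `<=` OO k, J = span_mul P J' &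
     (M < N)%N /\ idx (OO k) J' M].
Proof.
move=> fJ JO iN J1; have [P mP JP] := maxid_exists nk fJ JO J1.
have fP := maxid_frid nk mP; have [[oP PO] _ P1 _] := mP.
have [J' [fJ' JO'] JE] := frid_div_frid nk fP fJ JP.
have [oJ oJ'] := (frid_omod fJ, frid_omod fJ').
have JJ' : J `<=` J' by rewrite JE; apply: span_subl.
have [M _ iM] := idx_super nk oJ oJ' JJ' iN.
have [t it] := idx_frid fJ JO JO'.
have Nt := idx_unique nk oJ iN (idx_tower nk (omod_OO nk) oJ' oJ JO' JJ' iM it).
exists P, J', M; split=> //; split=> //; rewrite Nt ltn_Pmulr ?(idx_gt0 (omod_OO nk) iM) //.
have t0 := idx_gt0 oJ' it.
case: t t0 it {Nt} => [|[|t]] // _ it; case: P1.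
have E := idx1 nk oJ' oJ JJ' it.
suff -> : P = OO k by apply: (OO1 nk).
apply: (frid_cancel nk fJ' oP (omod_OO nk)).
by rewrite span_OOr // span_mulC -JE.
Qed.

(** Multiplicativity of the norm, by splitting maximal ideals off [J] and using [idx_maxid] for each
    of them. *)
Lemma idx_mul I J N : frid k I -> frid k J -> J `<=` OO k -> idx (OO k) J N ->
  idx I (span_mul I J) N.
Proof.
have [m] := ubnP N; elim: m I J N => // m IH I J N ltN fI fJ JO iN.
have [J1|J1] := pselect (J 1).
  have JE := omod_1 (frid_omod fJ) JO J1.
  rewrite JE span_OOr; last exact: frid_omod.
  rewrite JE in iN.
  rewrite (idx_unique nk (omod_OO nk) iN (idx_refl (omod_OO nk))).
  exact: idx_refl (frid_omod fI).
have [P [J' [M [mP JP [fJ' JO'] JE [ltMN iM]]]]] := frid_split fJ JO iN J1.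
have fP := maxid_frid nk mP; have [[oP PO] _ P1 _] := mP.
have [t it] := idx_frid fP PO (fun x h => h : OO k x).
have ltMm : (M < m)%N by apply: leq_trans ltMN _.
have iPM := IH P J' M ltMm fP fJ' JO' iM.
have fIP := frid_mul nk fI fP.
have iIPM := IH _ J' M ltMm fIP fJ' JO' iM.
have iIP := idx_maxid mP fI it.
rewrite -JE in iPM; rewrite -span_mulA -JE in iIPM.
have [oI oJ oIP] := And3 (frid_omod fI) (frid_omod fJ) (frid_omod fIP).
have oIJ := frid_omod (frid_mul nk fI fJ).
have -> : N = (t * M)%N.
  exact: (idx_unique nk oJ iN (idx_tower nk (omod_OO nk) oP oJ PO JP it iPM)).
apply: (idx_tower nk oI oIP oIJ) => //; first exact: span_subr.
by apply: span_mulS.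
Qed.

Lemma span_subOO I J : I `<=` OO k -> J `<=` OO k -> span_mul I J `<=` OO k.
Proof.
move=> IO JO; apply: span_mul_ind; [exact: (OO0 nk)|exact: (OOD nk)|].
by move=> x y /IO Ox /JO Oy; apply: (OOM nk).
Qed.

Lemma idx_mulOO I J N M : frid k I -> frid k J -> I `<=` OO k -> J `<=` OO k ->
  idx (OO k) I N -> idx (OO k) J M -> idx (OO k) (span_mul I J) (N * M).
Proof.
move=> fI fJ IO JO iN iM.
apply: (idx_tower nk (omod_OO nk) (frid_omod fI) _ IO _ iN (idx_mul fI fJ JO iM)).
  exact: frid_omod (frid_mul nk fI fJ).
exact: span_subr (frid_omod fI) JO.
Qed.

Lemma ipow_subOO I m : I `<=` OO k -> ipow k I m `<=` OO k.
Proof.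
by move=> IO; elim: m => [|m IH] //=; apply: span_subOO.
Qed.

Lemma idx_ipow I N m : frid k I -> I `<=` OO k -> idx (OO k) I N ->
  idx (OO k) (ipow k I m) (N ^ m).
Proof.
move=> fI IO iN; elim: m => [|m IH] /=; first exact: idx_refl (omod_OO nk).
rewrite expnS; apply: idx_mulOO => //; first exact: (frid_ipow _ nk).
exact: ipow_subOO.
Qed.

Definition comax (I J : set algC) := exists x y, [/\ I x, J y & x + y = 1].

Lemma comax_sym I J : comax I J -> comax J I.
Proof. by move=> [x [y [Ix Jy E]]]; exists y, x; rewrite addrC. Qed.

Lemma comax_sub I J X : omod k X -> I `<=` OO k -> J `<=` OO k -> comax I J -> X `<=` I -> X `<=` J ->
  X `<=` span_mul I J.
Proof.
move=> [kX X0 XD XM] IO JO [x [y [Ix Jy E]]] XI XJ z Xz.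
rewrite -[z]mulr1 -E mulrDr; apply: span_mulD.
  by rewrite mulrC; apply: mem_span_mul => //; apply: XJ.
by apply: mem_span_mul => //; apply: XI.
Qed.

Lemma comax_mul I I' J : omod k J -> I `<=` OO k -> I' `<=` OO k -> J `<=` OO k ->
  comax I J -> comax I' J -> comax (span_mul I I') J.
Proof.
move=> [kJ J0 JD JM] IO IO' JO [x [y [Ix Jy E]]] [x' [y' [Ix' Jy' E']]].
exists (x * x'), (x * y' + y * x' + y * y'); split.
- exact: mem_span_mul.
- apply: (JD); [apply: (JD)|]; try (by apply: (JM) => //; apply: IO).
    by rewrite mulrC; apply: (JM) => //; apply: IO'.
  by apply: (JM) => //; apply: JO.
by rewrite -[RHS](mulr1 1) -{1}E -E'; ring.
Qed.

Lemma comax_ipow I J m : omod k J -> I `<=` OO k -> J `<=` OO k ->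
  comax I J -> comax (ipow k I m) J.
Proof.
move=> oJ IO JO cIJ; elim: m => [|m IH] /=.
  by exists 1, 0; rewrite addr0; split=> //; [apply: (OO1 nk)|case: oJ].
by apply: comax_mul => //; apply: ipow_subOO.
Qed.

Lemma maxid_comax P Q : maxid k P -> maxid k Q -> P <> Q -> comax P Q.
Proof.
move=> mP mQ PQ; have [[oP PO] _ P1 Pm] := mP; have [[oQ QO] _ Q1 Qm] := mQ.
have [x Px nQx] : exists2 x, P x & ~ Q x.
  apply: contrapT => h; apply: PQ; rewrite eqEsubset.
  have PsQ : P `<=` Q by move=> x Px; apply: contrapT => nQ; apply: h; exists x.
  split=> // x Qx; apply: contrapT => nPx; apply: Q1.
  have [y Oy Py] := Pm x (QO x Qx) nPx.
  have -> : 1 = (1 - x * y) + y * x by ring.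
  by have [_ _ QD QM] := oQ; apply: QD; [apply: PsQ|apply: QM].
have [y Oy Qy] := Qm x (PO x Px) nQx.
exists (y * x), (1 - x * y); split=> //; last by ring.
by have [_ _ _ PM] := oP; apply: PM.
Qed.

(* If p is in P, the residues 0, ..., p - 1 are distinct modulo P. *)
Lemma maxid_idx_ge P p N : maxid k P -> prime p -> P p%:R -> idx (OO k) P N -> (p <= N)%N.
Proof.
move=> [[oP PO] _ P1 _] pp Pp iN.
pose s : seq algC := [seq i%:R | i <- iota 0 p].
have key i j : (i < j)%N -> (j < p)%N -> ~ P (j%:R - i%:R).
  move=> ltij ltjp Pij; apply: P1.
  have c : coprime (j - i) p.
    rewrite coprime_sym prime_coprime // gtnNdvd ?subn_gt0 //.
    exact: leq_ltn_trans (leq_subr _ _) _.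
  have ji0 : (0 < j - i)%N by rewrite subn_gt0.
  have [u v uv _] := egcdnP p ji0; rewrite (eqP c) in uv.
  have -> : (1 : algC) = u%:R * (j%:R - i%:R) - v%:R * p%:R.
    by rewrite -natrB ?(ltnW ltij) // -!natrM uv natrD addrC addKr.
  by apply: (omodB nk) => //; have [_ _ _ PM] := oP; apply: PM => //; apply: (OO_nat nk).
have key2 i j : (i < p)%N -> (j < p)%N -> P (j%:R - i%:R) -> i = j.
  move=> lti ltj h; case: (ltngtP i j) => // lt; first by case: (key _ _ lt ltj).
  case: (key _ _ lt lti); have [_ P0 _ _] := oP.
  by have := omodB nk oP P0 h; rewrite sub0r opprB.
have := idx_bound nk oP iN (s := s); rewrite size_map size_iota; apply.
- by rewrite map_inj_uniq ?iota_uniq // => i j /eqP; rewrite eqr_nat => /eqP.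
- by move=> _ /mapP[i _ ->]; apply: (OO_nat nk).
move=> _ _ /mapP[i + ->] /mapP[j + ->]; rewrite !mem_iota /= !add0n => lti ltj h.
by rewrite (key2 j i).
Qed.

Definition iprod (s : seq (set algC)) := foldr span_mul (OO k) s.

Lemma iprodP (Q : set (set algC)) s : (forall P, P \in s -> Q P) ->
  (forall P, Q P -> frid k P /\ P `<=` OO k) ->
  frid k (iprod s) /\ iprod s `<=` OO k.
Proof.
move=> sQ QP; elim: s sQ => [|P s IH] sQ /=; first by split=> //; apply: (frid_OO nk).
have [fs sO] : frid k (iprod s) /\ iprod s `<=` OO k.
  by apply: IH => R Rs; apply: sQ; rewrite inE Rs orbT.
have [fP PO] := QP P (sQ P (mem_head _ _)).
by split; [apply: (frid_mul nk)|apply: span_subOO].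
Qed.

(** For pairwise comaximal ideals the intersection is the product. *)
Lemma iprod_comax X (s : seq (set algC)) : omod k X -> X `<=` OO k -> uniq s ->
  (forall P, P \in s -> [/\ frid k P, P `<=` OO k & X `<=` P]) ->
  (forall P Q, P \in s -> Q \in s -> P <> Q -> comax P Q) ->
  X `<=` iprod s.
Proof.
move=> oX XO; elim: s => [|P s IH] //= /andP[nPs us] sP sc.
have [fP PO XP] := sP P (mem_head _ _).
have sP' Q : Q \in s -> [/\ frid k Q, Q `<=` OO k & X `<=` Q].
  by move=> Qs; apply: sP; rewrite inE Qs orbT.
have [fs sO] : frid k (iprod s) /\ iprod s `<=` OO k.
  apply: (@iprodP [set Q | frid k Q /\ Q `<=` OO k]) => // Q Qs /=.
  by have [] := sP' Q Qs.
apply: comax_sub => //; last first.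
  apply: IH => // Q R Qs Rs; apply: sc; by rewrite inE ?Qs ?Rs orbT.
have {}sc Q : Q \in s -> comax Q P.
  move=> Qs; apply: sc; rewrite ?inE ?eqxx ?Qs ?orbT //.
  by move=> E; rewrite -E Qs in nPs.
apply: comax_sym; have oP := frid_omod fP.
elim: s {IH nPs us sP fs sO} sP' sc => [|Q s IH] /= sP' sc.
  by exists 1, 0; rewrite addr0; split=> //; [apply: (OO1 nk)|case: oP].
have [fQ QO XQ] := sP' Q (mem_head _ _).
have sP'' R : R \in s -> [/\ frid k R, R `<=` OO k & X `<=` R].
  by move=> Rs; apply: sP'; rewrite inE Rs orbT.
apply: comax_mul => //.
- have [] // : frid k (iprod s) /\ iprod s `<=` OO k.
  apply: (@iprodP [set Q | frid k Q /\ Q `<=` OO k]) => // R Rs /=.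
  by have [] := sP'' R Rs.
- by apply: sc; rewrite mem_head.
by apply: IH => // R Rs; apply: sc; rewrite inE Rs orbT.
Qed.

Lemma idx_iprod (s : seq (set algC)) (p : nat) :
  (forall P, P \in s -> [/\ frid k P, P `<=` OO k &
      exists2 N, idx (OO k) P N & (p <= N)%N]) ->
  exists2 N, idx (OO k) (iprod s) N & (p ^ size s <= N)%N.
Proof.
elim: s => [|P s IH] sP /=.
  by exists 1%N => //; apply: idx_refl (omod_OO nk).
have sP' Q : Q \in s -> [/\ frid k Q, Q `<=` OO k & exists2 N, idx (OO k) Q N & (p <= N)%N].
  by move=> Qs; apply: sP; rewrite inE Qs orbT.
have [M iM leM] := IH sP'; have [fP PO [N iN leN]] := sP P (mem_head _ _).
exists (N * M)%N; last by rewrite expnS leq_mul.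
have [fs sO] : frid k (iprod s) /\ iprod s `<=` OO k.
  apply: (@iprodP [set Q | frid k Q /\ Q `<=` OO k]) => // Q Qs /=.
  by have [] := sP' Q Qs.
exact: idx_mulOO.
Qed.


(** The [a]-th power of the product of the primes in [s] contains [p ^ a] and has index at least
    [p ^ (size s * a)], whereas [p ^ a] itself has index at most [(p ^ a * d) ^ n]. Large [a] gives
    the bound without ramification theory. *)
Lemma maxid_over_prime p (s : seq (set algC)) : prime p -> uniq s ->
  (forall P, P \in s -> maxid k P /\ P p%:R) -> (size s <= n)%N.
Proof.
move=> pp us sP; have p0 := prime_gt0 pp.
have oX := omod_prin_nat nk p0.
have kp : k p%:R by apply: (nf_nat nk).
have pne0 : p%:R != 0 :> algC by rewrite pnatr_eq0 -lt0n.
have sO P : P \in s -> frid k P /\ P `<=` OO k.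
  by move=> /sP[mP _]; split; [apply: (maxid_frid nk)|case: mP => -[]].
have [fs sO'] : frid k (iprod s) /\ iprod s `<=` OO k.
  by apply: (@iprodP [set Q | frid k Q /\ Q `<=` OO k]).
have pI : prin k p%:R `<=` iprod s.
  apply: iprod_comax => //.
  - by move=> _ [x Ox <-]; apply: (OOM nk) => //; apply: (OO_nat nk).
  - move=> P Ps; have [fP PO] := sO P Ps; split=> //.
    by have [_ Pp] := sP P Ps; apply: (prin_sub (frid_omod fP)).
  by move=> P Q /sP[mP _] /sP[mQ _]; apply: maxid_comax.
have [N iN leN] : exists2 N, idx (OO k) (iprod s) N & (p ^ size s <= N)%N.
  apply: idx_iprod => P Ps; have [fP PO] := sO P Ps; split=> //.
  have [mP Pp] := sP P Ps; have [N iN] := idx_frid fP PO (fun x h => h : OO k x).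
  by exists N => //; apply: (maxid_idx_ge mP).
have [d d0 dP] := OO_mod nk.
have bnd a : (p ^ (size s * a) <= (p ^ a * d) ^ n)%N.
  have pa0 : (0 < p ^ a)%N by rewrite expn_gt0 p0.
  have [M leM iM] := dP _ pa0; apply: leq_trans leM.
  have fsa := frid_ipow a nk fs.
  have [M' leM' iM'] : exists2 M', (M' <= M)%N & idx (OO k) (ipow k (iprod s) a) M'.
    apply: (idx_super nk (omod_prin_nat nk pa0) (frid_omod fsa) _ iM).
    rewrite natrX -(ipow_prin _ nk kp).
    elim: a {pa0 M iM fsa} => //= a IH; exact: span_mulS.
  apply: leq_trans leM'; rewrite (idx_unique nk (frid_omod fsa) iM' (idx_ipow a fs sO' iN)).
  by rewrite expnM; case: (a) => // a'; rewrite leq_exp2r.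
rewrite leqNgt; apply/negP => ltn.
(* Large enough for [p ^ a] to exceed [d ^ n]. *)
pose a := (d ^ n).+1.
have := bnd a; rewrite expnMn -expnM leqNgt => /negP; apply.
apply: (@leq_trans (p ^ (n.+1 * a))); last by rewrite leq_exp2l ?prime_gt1 // leq_mul2r ltn orbT.
rewrite mulSn expnD mulnC [(n * a)%N]mulnC ltn_pmul2r ?expn_gt0 ?p0 //.
apply: leq_trans (ltn_expl _ (prime_gt1 pp)) => //.
Qed.

End IndexMul.

(** * Units, class group and Selmer group *)

Lemma size_fibers (T K : eqType) (key : T -> K) (s : seq T) (ks : seq K) m :
  (forall x, x \in s -> key x \in ks) ->
  (forall c, c \in ks -> (size [seq x <- s | key x == c] <= m)%N) ->
  (size s <= size ks * m)%N.
Proof.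
move=> sk fb.
have -> : size s = \sum_(x <- s) 1 by rewrite sum1_size.
have le : (\sum_(x <- s) 1 <= \sum_(x <- s) \sum_(c <- undup ks) (key x == c))%N.
  rewrite big_seq [X in (_ <= X)%N]big_seq; apply: leq_sum => x xs.
  rewrite (bigD1_seq (key x)) ?undup_uniq ?mem_undup ?sk //= eqxx; exact: leq_addr.
apply: leq_trans le _; rewrite exchange_big /=.
apply: (@leq_trans (\sum_(c <- undup ks) m)).
  rewrite big_seq [X in (_ <= X)%N]big_seq; apply: leq_sum => c; rewrite mem_undup => cks.
  by apply: leq_trans (fb c cks); rewrite size_filter -sum1_count [leqRHS]big_mkcond leq_sum // => x _; case: eqP.
by rewrite big_const_seq count_predT iter_addn_0 mulnC leq_mul2r size_undup orbT.
Qed.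

Section FiniteAbelianGroup.
Variables (T : choiceType) (X : seq T) (op : T -> T -> T) (one : T) (inv : T -> T).
Hypotheses (opX : forall x y, x \in X -> y \in X -> op x y \in X) (oneX : one \in X)
  (invX : forall x, x \in X -> inv x \in X)
  (opA : forall x y z, x \in X -> y \in X -> z \in X -> op x (op y z) = op (op x y) z)
  (opC : forall x y, x \in X -> y \in X -> op x y = op y x)
  (op1 : forall x, x \in X -> op one x = x)
  (opV : forall x, x \in X -> op (inv x) x = one).

Definition carrier of (forall x y, x \in X -> y \in X -> op x y \in X) := seq_sub X.
Let G := carrier opX.
HB.instance Definition _ := Finite.on G.

Let mul (x y : G) : G := SeqSub (opX (valP x) (valP y)).
Let e : G := SeqSub oneX.
Let iv (x : G) : G := SeqSub (invX (valP x)).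

Let mulA : associative mul.
Proof. by move=> x y z; apply: val_inj; rewrite /= opA ?(valP x) ?(valP y) ?(valP z). Qed.
Let mul1 : left_id e mul.
Proof. by move=> x; apply: val_inj; rewrite /= op1 ?(valP x). Qed.
Let mulV : left_inverse e iv mul.
Proof. by move=> x; apply: val_inj; rewrite /= opV ?(valP x). Qed.

HB.instance Definition _ := Finite_isGroup.Build G mulA mul1 mulV.

(** The map to the [l]-th power has kernel and cokernel of equal order; [Q] is the cokernel and the
    filtered list is the kernel. *)
Lemma elementary_quotient l : prime l -> uniq X ->
  exists (Q : finGroupType) (f : T -> Q),
    [/\ (l.-abelem [set: Q]%SET)%g,
        forall x y, x \in X -> y \in X -> f (op x y) = (f x * f y)%g,
        forall q, exists2 x, x \in X & f x = q &
        (size [seq x <- X | iter l (op x) one == one] <= #|Q|)%N].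
Proof.
move=> lp uX.
pose A := [set: G]%G.
have comG (x y : G) : (x * y = y * x)%g.
  by apply: val_inj; rewrite /= opC ?(valP x) ?(valP y).
have abA : abelian A by apply/centsP => x _ y _; apply: comG.
pose pw (x : G) : G := (x ^+ l)%g.
have pwM : {in A &, {morph pw : x y / (x * y)%g}}.
  by move=> x y _ _; rewrite /pw expgMn //; apply: comG.
pose P := Morphism pwM; pose B := (P @* A)%G.
have sB : B \subset A by apply: finset.subsetT.
have nB (x : G) : x \in 'N(B)%g by apply: (fintype.subsetP (sub_abelian_norm abA sB)); rewrite inE.
pose Q : finGroupType := coset_of B.
pose f (x : T) : Q := coset B (insubd e x : G).
have QT : [set: Q]%SET = (A / B)%g.
  apply/setP => q; rewrite inE; apply/esym; have [x nx ->] := cosetP q.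
  by apply: mem_quotient; rewrite inE.
exists Q, f; split.
- rewrite abelemE //; apply/andP; split.
    apply/centsP => q1 _ q2 _; have [x nx ->] := cosetP q1; have [y ny ->] := cosetP q2.
    by rewrite /commute -!morphM // comG.
  apply/exponentP => q _; have [x nx ->] := cosetP q.
  by rewrite -morphX //; apply: coset_id; apply/morphimP; exists x; rewrite ?inE.
- move=> x y xX yX; rewrite /f -morphM //; congr (coset B _).
  apply: val_inj; rewrite /= !insubdK //; exact: opX.
- move=> q; have [x nx ->] := cosetP q.
  exists (val x); first exact: valP.
  by rewrite /f; congr (coset B _); apply: val_inj; rewrite insubdK ?(valP x).
have -> : #|Q| = #|('ker P)%g|.
  have -> : #|Q| = #|(A / B)%g| by rewrite -QT cardsT.
  rewrite card_quotient; last by apply/fintype.subsetP => x _; apply: nB.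
  have := card_morphim P A; rewrite finset.setIid => cB.
  have kA : ('ker P \subset A)%g by apply: finset.subsetT.
  have l1 : (#|(P @* A)%g| * #|A : B|%g = #|A|)%N := Lagrange sB.
  have l2 := Lagrange kA; rewrite -cB in l2.
  apply/eqP; rewrite -(@eqn_pmul2l #|(P @* A)%g|) ?cardG_gt0 //.
  by rewrite l1 -l2 mulnC.
have iterE (x : G) m : val (x ^+ m)%g = iter m (op (val x)) one.
  by elim: m => [|m IH] //; rewrite expgS /= IH.
have lift (x : T) : x \in X -> exists y : G, val y = x.
  by move=> xX; exists (SeqSub xX).
pose g (x : T) : G := insubd e x.
rewrite -(size_map g) cardE; apply: uniq_leq_size.
  rewrite map_inj_in_uniq ?filter_uniq // => x y; rewrite !mem_filter => /andP[_ xX] /andP[_ yX] E.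
  by rewrite -(insubdK e xX) -(insubdK e yX) -!/(g _) E.
move=> _ /mapP[x + ->]; rewrite mem_filter mem_enum => /andP[/eqP xl xX].
apply/kerP; rewrite ?inE //=; apply: val_inj; rewrite /pw iterE /=.
by rewrite /g insubdK.
Qed.

End FiniteAbelianGroup.

(** * Units modulo [l]-th powers *)

Section Units.
Variables (n : nat) (k : set algC).
Hypothesis nk : number_field n k.

Lemma bounded_conj_finite (e : 'I_n -> algCaut) (b : 'I_n -> algC) (A : 'I_n -> 'I_n -> algC) (m : nat) :
  (0 < m)%N ->
  (forall x, k x -> x = \sum_j (\sum_i A j i * e i x) * b j) ->
  (forall x j, OO k x -> m%:R * (\sum_i A j i * e i x) \in Num.int) ->
  exists C0 : nat, forall s, uniq s ->
    (forall x, x \in s -> OO k x /\ forall i, `|e i x| <= 2) -> (size s <= C0)%N.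
Proof.
move=> m0 xE Cint.
pose C x j := \sum_i A j i * e i x.
pose B : algC := m%:R * \sum_j \sum_i `|A j i| * 2.
have B0 : 0 <= B by rewrite mulr_ge0 ?ler0n // sumr_ge0 // => j _; rewrite sumr_ge0 // => i _; rewrite mulr_ge0.
pose K := (Num.bound B).+1.
have BK : B < K%:R by apply: lt_trans (archi_boundP B0) _; rewrite ltr_nat.
pose z x j : int := Num.floor (m%:R * C x j).
have zE x j : OO k x -> m%:R * C x j = (z x j)%:~R.
  by move=> Ox; rewrite /z [RHS](floorK (Cint x j Ox)).
have zB x j : OO k x -> (forall i, `|e i x| <= 2) -> (`|z x j| < K)%N.
  move=> Ox ex; rewrite -(ltr_nat algC); apply: le_lt_trans BK.
  rewrite natr_absz intr_norm -zE // normrM ger0_norm ?ler0n // ler_wpM2l ?ler0n //.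
  apply: le_trans (ler_norm_sum _ _ _) _.
  apply: (@le_trans _ _ (\sum_i `|A j i| * 2)).
    by apply: ler_sum => i _; rewrite normrM ler_wpM2l.
  rewrite [leRHS](bigD1 j) //= lerDl sumr_ge0 // => j' _; rewrite sumr_ge0 // => i _; rewrite mulr_ge0.
pose key x : {ffun 'I_n -> bool * 'I_K} := [ffun j => ((z x j < 0), inord `|z x j|)].
exists #|{: {ffun 'I_n -> bool * 'I_K}}| => s us sP.
rewrite -(size_map key) cardE; apply: uniq_leq_size; last by move=> f; rewrite mem_enum.
rewrite map_inj_in_uniq // => x y xs ys /ffunP E.
have [[Ox xb] [Oy yb]] := (sP x xs, sP y ys).
have kx : k x by case: Ox. have ky : k y by case: Oy.
rewrite (xE x kx) (xE y ky); apply: eq_bigr => j _; congr (_ * _).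
apply: (@mulfI _ m%:R); first by rewrite pnatr_eq0 -lt0n.
rewrite -/(C x j) -/(C y j) !zE //; congr (_%:~R).
have := E j; rewrite !ffunE => -[sE /(congr1 val)]; rewrite /= !inordK ?zB // => aE.
by rewrite [z x j]intEsign [z y j]intEsign sE aE.
Qed.

Lemma pow2_level (y : algC) m : 1 <= y -> y <= 2 ^+ m ->
  exists2 t, (t <= m)%N & 2 ^+ t <= y <= 2 ^+ t.+1.
Proof.
move=> y1; elim: m => [|m IH] ym.
  by exists 0%N => //; rewrite expr0 expr1 y1 (le_trans ym) // expr0 ler1n.
have r2 : 2 ^+ m \is @Num.real algC by rewrite realX // realn.
have [le|lt] := real_leP (ger1_real y1) r2.
  by have [t tm ty] := IH le; exists t => //; apply: leqW.
exists m => //; by rewrite (ltW lt) ym.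
Qed.

Lemma growth_bound (a M K : nat) : (0 < a)%N ->
  (forall j, (M ^ j <= K * a ^ j)%N) -> (M <= a)%N.
Proof.
move=> a0 h; rewrite leqNgt; apply/negP => ltaM.
(* Bernoulli's inequality for [(1 + 1/a) ^ j], cleared of denominators. *)
have bern j : ((a + j) * a ^ j <= a * a.+1 ^ j)%N.
  elim: j => [|j IH]; first by rewrite !expn0 addn0.
  rewrite !expnS; apply: (@leq_trans (a.+1 * ((a + j) * a ^ j))).
    rewrite mulnA [in leqRHS]mulnA leq_mul2r; apply/orP; right; nia.
  by rewrite [in leqRHS]mulnCA leq_mul2l IH orbT.
have := h (a * K)%N.
have le : (a.+1 ^ (a * K) <= M ^ (a * K))%N.
  case E : (a * K)%N => [|j] //; by rewrite leq_exp2r.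
move=> /(leq_trans le) h2.
have := leq_trans (bern (a * K)%N) (leq_mul (leqnn a) h2).
rewrite mulnA leq_pmul2r ?expn_gt0 ?a0 //; lia.
Qed.

Lemma growth_step a b : (1 < a)%N -> (0 < b)%N -> (1 + b.-1 * a <= (a * b).-1)%N.
Proof. by case: b => // b; rewrite mulnS /=; lia. Qed.

(* The number of units all of whose conjugates have absolute value in
   [2^-T, 2^T] grows at most like T^n.  Products of members of [us] with [l]-th
   powers of such units are distinct up to the [l]-th roots of unity, so
   comparing T with [l * T] bounds [us], without Dirichlet's theorem. *)
Lemma units_bound l (us : seq algC) : prime l -> uniq us ->
  (forall u, u \in us -> [/\ OO k u, OO k u^-1 & u != 0]) ->
  (forall u v a, u \in us -> v \in us -> k a -> u = v * a ^+ l -> u = v) ->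
  (size us <= l ^ n.+1)%N.
Proof.
move=> lp uus usU usI; have l0 := prime_gt0 lp; have l1 := prime_gt1 lp.
have [e [b [A [m [_ [m0 _] xE _ Cint]]]]] := int_basis nk.
have [C0 C0P] := bounded_conj_finite m0 xE Cint.
pose U (T : nat) u := [/\ OO k u, OO k u^-1, u != 0 & forall i, 2 ^- T <= `|e i u| <= 2 ^+ T].
have pos2 T : 0 < 2 ^+ T :> algC by rewrite exprn_gt0.
have [c cP] : exists c, forall u, u \in us -> U c u.
  have h1 u : exists c, u \in us -> U c u.
    case: (boolP (u \in us)) => uu; last by exists 0%N.
    have [Ou OV u0] := usU u uu.
    pose B : algC := \sum_i (`|e i u| + `|e i u|^-1).
    have B0 i : 0 <= `|e i u| + `|e i u|^-1 by rewrite addr_ge0 ?invr_ge0.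
    have B0' : 0 <= B by apply: sumr_ge0.
    exists (Num.bound B) => _; split=> // i.
    have Bi : `|e i u| + `|e i u|^-1 <= B by rewrite /B (bigD1 i) //= lerDl sumr_ge0.
    have B2 : B <= 2 ^+ Num.bound B.
      apply: le_trans (ltW (archi_boundP B0')) _; rewrite -natrX ler_nat ltnW // ltn_expl //.
    have n0 : 0 < `|e i u| by rewrite normr_gt0 fmorph_eq0.
    rewrite -[X in _ <= X <= _]invrK lef_pV2 ?qualifE /= ?invr_gt0 //.
    apply/andP; split; apply: le_trans B2; apply: le_trans Bi.
      by rewrite lerDr.
    by rewrite invrK lerDl invr_ge0.
  have [cf cfP] := choice h1.
  exists (\max_(u <- us) cf u)%N => u uu.
  have [Ou OV u0 ub] := cfP u uu; split=> // i.
  have le : (cf u <= \max_(u <- us) cf u)%N by rewrite (big_rem u) //= leq_maxl.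
  have /andP[lb ubd] := ub i; apply/andP; split.
    by apply: le_trans lb; rewrite lef_pV2 ?qualifE //= ler_eXn2l // ltr1n.
  by apply: le_trans ubd _; rewrite ler_eXn2l // ltr1n.
have Umul T T' u v : U T u -> U T' v -> U (T + T')%N (u * v).
  move=> [Ou OVu u0 ub] [Ov OVv v0 vb]; split.
  - exact: (OOM nk).
  - by rewrite invfM; apply: (OOM nk).
  - by rewrite mulf_neq0.
  move=> i; have [/andP[a1 a2] /andP[b1 b2]] := (ub i, vb i).
  rewrite rmorphM normrM exprD invfM; apply/andP; split.
    by rewrite ler_pM // invr_ge0 ltW.
  by rewrite ler_pM.
have U1 : U 0%N 1.
  split; rewrite ?invr1 ?oner_eq0 //; try exact: (OO1 nk).
  by move=> i; rewrite rmorph1 normr1 expr0 lexx.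
have Uexp T u j : U T u -> U (T * j)%N (u ^+ j).
  move=> Uu; elim: j => [|j IH]; first by rewrite muln0.
  by rewrite exprS mulnS; apply: Umul.
(* Units are sorted by the dyadic levels of their conjugates. The quotient of two units in the same
   cell is an integer with all conjugates at most [2], and there are at most [C0] of these. *)
have count T s : uniq s -> (forall u, u \in s -> U T u) -> (size s <= (2 * T).+1 ^ n * C0)%N.
  move=> us' sU.
  have lev u i : exists t : 'I_(2 * T).+1, u \in s ->
      2 ^+ t <= 2 ^+ T * `|e i u| <= 2 ^+ t.+1.
    case: (boolP (u \in s)) => uu; last by exists ord0.
    have [_ _ _ ub] := sU u uu; have /andP[a1 a2] := ub i.
    have [t tT tP] : exists2 t, (t <= 2 * T)%N & 2 ^+ t <= 2 ^+ T * `|e i u| <= 2 ^+ t.+1.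
      apply: pow2_level; first by rewrite mulrC -ler_pdivrMr // mul1r.
      by rewrite mul2n -addnn exprD ler_pM2l.
    by exists (Ordinal (tT : (t < (2 * T).+1)%N)).
  have [key keyP] : exists key : algC -> {ffun 'I_n -> 'I_(2 * T).+1}, forall u i, u \in s ->
      2 ^+ (key u i) <= 2 ^+ T * `|e i u| <= 2 ^+ (key u i).+1.
    have h2 u : exists f : {ffun 'I_n -> 'I_(2 * T).+1}, forall i, u \in s ->
      2 ^+ (f i) <= 2 ^+ T * `|e i u| <= 2 ^+ (f i).+1.
      have [f fP] := choice (lev u); exists [ffun i => f i] => i.
      by rewrite ffunE; apply: fP.
    by have [key keyP] := choice h2; exists key.
  have -> : ((2 * T).+1 ^ n = size (enum {: {ffun 'I_n -> 'I_(2 * T).+1}}))%N.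
    by rewrite -cardE card_ffun !card_ord.
  apply: (@size_fibers _ _ key) => [x _|f _]; first by rewrite mem_enum.
  set s' := [seq x <- s | _].
  case E : s' => [|v s''] //; rewrite -E.
  have s'P u : u \in s' -> u \in s /\ key u = f.
    by rewrite mem_filter => /andP[/eqP].
  have vs' : v \in s' by rewrite E mem_head.
  have [vs vf] := s'P v vs'; have [Ov OV v0 vb] := sU v vs.
  rewrite -(size_map (fun u => u * v^-1)); apply: C0P.
    rewrite map_inj_uniq ?filter_uniq // => x y; apply: mulIf; by rewrite invr_eq0.
  move=> _ /mapP[u us2 ->]; have [uu uf] := s'P u us2; have [Ou _ u0 _] := sU u uu.
  split; first exact: (OOM nk).
  move=> i; rewrite rmorphM fmorphV normrM normfV.
  have n0 : 0 < `|e i v| by rewrite normr_gt0 fmorph_eq0.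
  rewrite ler_pdivrMr // -(ler_pM2l (pos2 T)).
  have /andP[_ a2] := keyP u i uu; have /andP[b1 _] := keyP v i vs.
  apply: le_trans a2 _; rewrite uf exprS mulrCA ler_pM2l ?ltr0n //.
  by rewrite -vf.
(* Each step multiplies members of [us] by [l]-th powers of the previous list. The height stays in
   range because [c + c * (l ^ j - 1) * l <= c * (l ^ j.+1 - 1)], and taking [l]-th powers costs at
   most a factor [l] in size. *)
have grow j : exists s, [/\ uniq s, forall u, u \in s -> U (c * (l ^ j).-1)%N u &
    (size us ^ j <= l ^ j * size s)%N].
  elim: j => [|j [s [us' sU sz]]].
    exists [:: 1]; split=> // u; rewrite inE => /eqP->.
    by rewrite expn0 muln0.
  pose w := undup [seq v ^+ l | v <- s].
  have wz : (size s <= size w * l)%N.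
    apply: (@size_fibers _ _ (fun v => v ^+ l)) => [v vs|a _].
      by rewrite mem_undup; apply/mapP; exists v.
    have ar : all (root ('X^l - a%:P)) [seq x <- s | x ^+ l == a].
      apply/allP => x; rewrite mem_filter => /andP[/eqP xa _].
      by rewrite /root !hornerE xa subrr.
    have pn0 : 'X^l - a%:P != 0 :> {poly algC} by rewrite -size_poly_gt0 size_XnsubC.
    have := max_poly_roots pn0 ar (filter_uniq _ us'); by rewrite size_XnsubC.
  exists [seq u * v | u <- us, v <- w]; split.
  - rewrite allpairs_uniq ?undup_uniq // => -[u v] [u' v'].
    move=> /allpairsP[[x y] [/= xu yw [-> ->]]] /allpairsP[[x' y'] [/= xu' yw' [-> ->]]] /= E.
    have [z zs zE] : exists2 z, z \in s & y = z ^+ l by move: yw; rewrite mem_undup => /mapP.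
    have [z' zs' zE'] : exists2 z, z \in s & y' = z ^+ l by move: yw'; rewrite mem_undup => /mapP.
    have [[kz _] _ z0 _] := sU z zs; have [[kz' _] _ z0' _] := sU z' zs'.
    have xx : x = x'.
      apply: (usI _ _ (z' / z)) => //; first by apply: (nfM nk) => //; apply: (nfV nk).
      rewrite expr_div_n mulrA -zE' -E -zE mulfK // zE expf_neq0 //.
    have [_ _ x0] := usU x xu.
    by congr (_, _) => //; apply: (mulfI x0); rewrite E xx.
  - move=> _ /allpairsP[[x y] [/= xu yw ->]].
    have [z zs ->] : exists2 z, z \in s & y = z ^+ l by move: yw; rewrite mem_undup => /mapP.
    have := Umul _ _ _ _ (cP x xu) (Uexp _ _ l (sU z zs)).
    have [Oz OVz z0 _] := sU z zs; have [Ox OVx x0 _] := cP x xu.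
    case=> H1 H2 H3 H4; split=> // i; have /andP[a1 a2] := H4 i.
    have le : (c + c * (l ^ j).-1 * l <= c * (l ^ j.+1).-1)%N.
      rewrite -[X in (X + _)%N]muln1 -mulnA -mulnDr leq_mul2l; apply/orP; right.
      by rewrite expnS growth_step // expn_gt0 l0.
    apply/andP; split.
      by apply: le_trans a1; rewrite lef_pV2 ?qualifE //= ler_eXn2l // ltr1n.
    by apply: le_trans a2 _; rewrite ler_eXn2l // ltr1n.
  rewrite size_allpairs !expnS; apply: leq_trans (leq_mul (leqnn _) sz) _.
  apply: leq_trans (leq_mul (leqnn _) (leq_mul (leqnn _) wz)) _.
  by rewrite leq_eqVlt; apply/orP; left; apply/eqP; ring.
apply: (@growth_bound _ _ (C0 * (2 * c).+1 ^ n)%N); first by rewrite expn_gt0 l0.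
move=> j; have [s [us' sU sz]] := grow j.
apply: leq_trans sz _; have := count _ s us' sU.
have le : ((2 * (c * (l ^ j).-1)).+1 <= (2 * c).+1 * l ^ j)%N.
  have : (0 < l ^ j)%N by rewrite expn_gt0 l0.
  by case: (l ^ j)%N => // a _ /=; rewrite mulnS mulSn; lia.
have le2 : ((2 * (c * (l ^ j).-1)).+1 ^ n <= (2 * c).+1 ^ n * (l ^ j) ^ n)%N.
  rewrite -expnMn; case: (n) => // n'; by rewrite leq_exp2r.
move=> h; rewrite -expnM [(n.+1 * j)%N]mulSn expnD [(n * j)%N]mulnC expnM.
set L := (l ^ j)%N in h le2 *; set q := (_ ^ n)%N in h le2.
have : (size s <= (2 * c).+1 ^ n * L ^ n * C0)%N by apply: leq_trans h _; rewrite leq_mul2r le2 orbT.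
move=> h2; apply: leq_trans (leq_mul (leqnn L) h2) _.
by rewrite leq_eqVlt; apply/orP; left; apply/eqP; ring.
Qed.

End Units.

(** * Finiteness of the class group *)

Section ClassGroup.
Variables (n : nat) (k : set algC).
Hypothesis nk : number_field n k.

(* Hurwitz: by the box principle some bounded multiple of any element of k is
   close to an integer for all embeddings at once. *)
Lemma hurwitz (e : 'I_n -> algCaut) (b : 'I_n -> algC) (A : 'I_n -> 'I_n -> algC) :
  (0 < n)%N -> (forall j, OO k (b j)) ->
  (forall x, k x -> x = \sum_j (\sum_i A j i * e i x) * b j) ->
  (forall x j, k x -> \sum_i A j i * e i x \in Crat) ->
  exists2 M : nat, (0 < M)%N & forall x, k x -> exists t w,
    [/\ (0 < t <= M)%N, OO k w & forall i, `|e i (t%:R * x - w)| < 1].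
Proof.
move=> n0 bO xE Crt.
pose B : algC := \sum_i \sum_j `|e i (b j)|.
have B0 : 0 <= B by apply: sumr_ge0 => i _; apply: sumr_ge0.
pose q := (Num.bound B).+1.
have Bq : B < q%:R by apply: lt_trans (archi_boundP B0) _; rewrite ltr_nat.
have q0 : (0 : rat) < q%:R by rewrite ltr0n.
exists (q ^ n)%N => [|x kx]; first by rewrite expn_gt0.
have [c cE] : exists c : 'I_n -> rat, forall j, \sum_i A j i * e i x = ratr (c j).
  have h j : exists c : rat, \sum_i A j i * e i x = ratr c.
    by have /CratP[c ->] := Crt x j kx; exists c.
  by have [c cE] := choice h; exists c.
pose fr (t : nat) j : rat := t%:R * c j - (Num.floor (t%:R * c j))%:~R.
have fr0 t j : 0 <= fr t j by rewrite subr_ge0 floor_le.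
have fr1 t j : fr t j < 1 by rewrite ltrBlDl; have := lt_succ_floor (t%:R * c j); rewrite intrD.
have lt t j : (Num.truncn (q%:R * fr t j) < q)%N.
  rewrite -(ltr_nat rat); apply: (@le_lt_trans _ _ (q%:R * fr t j)).
    by rewrite truncn_le ?mulr_ge0 // ltW.
  by rewrite -[ltRHS]mulr1 ltr_pM2l.
pose key t : {ffun 'I_n -> 'I_q} := [ffun j => Ordinal (lt t j)].
have [t1 [t2 [lt12 le2 kE]]] : exists t1 t2, [/\ (t1 < t2)%N, (t2 <= q ^ n)%N & key t1 = key t2].
  apply: contrapT => h.
  have : (size [seq key t | t <- iota 0 (q ^ n).+1] <= size (enum {: {ffun 'I_n -> 'I_q}}))%N.
    apply: uniq_leq_size; last by move=> f; rewrite mem_enum.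
    rewrite map_inj_in_uniq ?iota_uniq // => t1 t2; rewrite !mem_iota !add0n /= !ltnS => l1 l2 E.
    case: (ltngtP t1 t2) => // lt12; case: h; first by exists t1, t2.
    by exists t2, t1.
  by rewrite size_map size_iota -cardE card_ffun !card_ord ltnn.
pose fl j : int := Num.floor (t2%:R * c j) - Num.floor (t1%:R * c j).
pose d j : rat := fr t2 j - fr t1 j.
have dE j : (t2 - t1)%:R * c j = (fl j)%:~R + d j.
  rewrite natrB ?(ltnW lt12) // /d /fr /fl rmorphB /=; ring.
have dB j : q%:R * `|d j| < 1.
  have := congr1 (fun f : {ffun 'I_n -> 'I_q} => val (f j)) kE.
  rewrite !ffunE /= => E.
  rewrite -[q%:R]ger0_norm ?ler0n // -normrM /d mulrBr.
  have t0 t : 0 <= q%:R * fr t j by rewrite mulr_ge0 // ltW.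
  have h1 t : (Num.truncn (q%:R * fr t j))%:R <= q%:R * fr t j by rewrite truncn_le.
  have h2 t : q%:R * fr t j < (Num.truncn (q%:R * fr t j)).+1%:R by rewrite truncnS_gt.
  have [a1 a2] := (h1 t1, h2 t1); have [b1 b2] := (h1 t2, h2 t2).
  rewrite -E in b1 b2; rewrite -natr1 in a2 b2.
  rewrite ltr_norml; apply/andP; split; lra.
pose w := \sum_j (fl j)%:~R * b j.
exists (t2 - t1)%N, w; split.
- by rewrite subn_gt0 lt12 (leq_trans (leq_subr _ _)).
- apply: (omod_sum (k := k)); first exact: (omod_OO nk).
  move=> j _; apply: (OOM nk) => //; split; first exact: nf_int nk _.
  by rewrite /= rpred_int.
move=> i.
have -> : (t2 - t1)%:R * x - w = \sum_j ratr (d j) * b j.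
  rewrite {1}(xE x kx) mulr_sumr /w -sumrB; apply: eq_bigr => j _.
  rewrite cE mulrA -mulrBl; congr (_ * _).
  by rewrite -ratr_nat -rmorphM /= dE rmorphD /= ratr_int addrC addKr.
rewrite rmorph_sum; apply: le_lt_trans (ler_norm_sum _ _ _) _.
have qp : 0 < q%:R :> algC by rewrite ltr0n.
rewrite -(ltr_pM2l qp) mulr1; apply: le_lt_trans Bq.
apply: (@le_trans _ _ (\sum_j `|e i (b j)|)); last first.
  rewrite /B [leRHS](bigD1 i) //= lerDl sumr_ge0 // => i' _; exact: sumr_ge0.
rewrite mulr_sumr; apply: ler_sum => j _.
rewrite rmorphM fmorph_rat normrM mulrA -[leRHS]mul1r ler_wpM2r //.
by have := dB j; rewrite -(ltr_rat algC) rmorphM /= ratr_norm ratr_nat rmorph1 => /ltW.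
Qed.

Lemma embedding_norm (e : 'I_n -> algCaut) x :
  (forall s : algCaut, exists i, forall x, k x -> s x = e i x) ->
  (forall i j, (forall x, k x -> e i x = e j x) -> i = j) ->
  OO k x -> \prod_i e i x \in Num.int.
Proof.
move=> esurj einj [kx xA]; apply: Cint_rat_Aint; last first.
  by apply: rpred_prod => i _; rewrite Aint_aut.
apply: fixed_rat => s.
have [p pE] := choice (fun i => esurj (acomp s (e i))).
have pI : injective p.
  move=> i j E; apply: einj => y ky; apply: (fmorph_inj s).
  by rewrite -!acompE !pE ?E.
rewrite rmorph_prod [RHS](reindex_inj pI) /=; apply: eq_bigr => i _.
by rewrite -pE.
Qed.

(** If [be] has least norm among the nonzero elements of [I], then [T * I] lies in [be * OO k].
    Hence [J = (T / be) * I] lies between [T * OO k] and [OO k]: it is a union of classes modulo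
    [T], and [cls] lists all such unions. *)
Lemma class_group_finite : exists cls : seq (set algC), forall I, frid k I ->
  exists J a, [/\ J \in cls, frid k J, k a, a != 0 & I = span_mul (prin k a) J].
Proof.
have [e [b [A [m [[esurj einj] [m0 bO] xE Crt Cint]]]]] := int_basis nk.
have n0 : (0 < n)%N by have [i _] := esurj (idfun : algCaut); case: (n) i => // -[].
have [M M0 MP] := hurwitz n0 bO xE Crt.
(* Every multiplier [t <= M] from the box principle divides [M!], so one multiplier works for all
   elements. *)
pose T := M`!; have T0 : (0 < T)%N by apply: fact_gt0.
have [d d0 /(_ T T0)[N _ [s [us sO sP sr] sN]]] := OO_mod nk.
pose cl (mask : seq bool) := [set x | OO k x /\ exists2 y, y \in seq.mask mask s & prin k T%:R (x - y)].
exists [seq cl (tval t) | t <- enum {: (size s).-tuple bool}] => I fI.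
have [oI _] := fI; have [kI I0 ID IM] := oI.
pose nm x := \prod_i e i x.
have [D D0 DI] : exists2 D : nat, (0 < D)%N & forall x, I x -> OO k (D%:R * x).
  have [w [w1 w2 w12]] := fI.2.
  have [D D0 DA] := Aint_multiple_fin (fun i : 'I_(size w) => (nth (0, 0) w i).1).
  exists D => // x Ix; split; first by apply: (nfM nk); [apply: (nf_nat nk)|apply: kI].
  have -> : x = \sum_(i < size w) x * ((nth (0, 0) w i).1 * (nth (0, 0) w i).2).
    by rewrite -mulr_sumr -(big_mkord xpredT (fun i => (nth (0, 0) w i).1 * (nth (0, 0) w i).2)) -(big_nth (0, 0) xpredT (fun p => p.1 * p.2)) w12 mulr1.
  rewrite /= mulr_sumr rpred_sum // => i _.
  have iw : nth (0, 0) w i \in w by apply: mem_nth.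
  rewrite (_ : _ * _ = (D%:R * (nth (0, 0) w i).1) * (x * (nth (0, 0) w i).2)); last by ring.
  by rewrite rpredM //; have [_ h] := w2 _ iw; apply: h.
pose Q (v : nat) := `[< exists x, [/\ I x, x != 0 & `|nm (D%:R * x)| = v%:R] >].
have nmint x : I x -> exists v : nat, `|nm (D%:R * x)| = v%:R.
  move=> Ix; have /intrP[z zE] := embedding_norm esurj einj (DI x Ix).
  by exists `|z|%N; rewrite /nm zE natr_absz intr_norm.
have exQ : exists v, Q v.
  have [_ [_ _ [x Ix x0]]] := (frid_fractional nk I).1 fI.
  by have [v vE] := nmint x Ix; exists v; apply/asboolP; exists x.
have [v /asboolP[be [Ibe be0 beE]] vmin] := ex_minnP exQ.
have kbe : k be by apply: kI.
have div x : I x -> OO k (T%:R * (x / be)).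
  move=> Ix; have [t [w [/andP[t0 tM] Ow wE]]] := MP (x / be) (nfM nk (kI _ Ix) (nfV nk kbe)).
  (* A member of [I] all of whose conjugates are smaller than those of [be]; minimality of the norm
     forces it to vanish. *)
  pose y := t%:R * x - w * be.
  have Iy : I y.
    apply: (omodB nk) => //; [apply: IM => //; apply: (OO_nat nk)|exact: IM].
  have y0 : y = 0.
    apply/eqP; apply/negP => /negP y0; have [u uE] := nmint y Iy.
    have : Q u by apply/asboolP; exists y.
    move=> /vmin; apply/negP; rewrite -ltnNge -(ltr_nat algC) -uE -beE.
    have yE : D%:R * y = (D%:R * be) * (t%:R * (x / be) - w).
      by rewrite /y; field.
    rewrite yE /nm; under eq_bigr do rewrite rmorphM; rewrite big_split normrM /=.
    rewrite -[ltRHS]mulr1 ltr_pM2l; last first.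
      rewrite normr_gt0; apply/prodf_neq0 => i _.
      by rewrite fmorph_eq0 mulf_neq0 // pnatr_eq0 -lt0n.
    rewrite normr_prod (bigD1 (Ordinal n0)) //=.
    apply: (@le_lt_trans _ _ `|e (Ordinal n0) (t%:R * (x / be) - w)|); last exact: wE.
    rewrite ler_piMr // prodr_ile1 // => i _; by rewrite normr_ge0 ltW.
  have E : t%:R * (x / be) = w.
    by apply/eqP; rewrite mulrA -subr_eq0 -(mulIr_eq0 _ (mulIf be0)) mulrBl mulfVK // -/y y0.
  have tT : (t %| T)%N by apply: dvdn_fact; rewrite t0.
  rewrite -(divnK tT) natrM -mulrA E; apply: (OOM nk) => //; exact: (OO_nat nk).
pose a := T%:R / be.
have Tn0 : T%:R != 0 :> algC by rewrite pnatr_eq0 -lt0n.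
have ka : k a by apply: (nfM nk); [apply: (nf_nat nk)|apply: (nfV nk)].
have a0 : a != 0 by rewrite mulf_neq0 // invr_eq0.
pose J := span_mul (prin k a) I.
have fJ : frid k J by apply: (frid_mul nk) => //; apply: (frid_prin nk).
have JE : J = [set a * x | x in I] by apply: (span_prin nk).
have JO : J `<=` OO k.
  by rewrite JE => _ [x Ix <-]; rewrite /a mulrAC -mulrA; apply: div.
have JT : J T%:R by rewrite JE; exists be => //; rewrite mulfVK.
have oJ := frid_omod fJ.
exists J, a^-1; split=> //.
- apply/mapP; exists (map_tuple (fun y => `[< J y >]) (in_tuple s)); first by rewrite mem_enum.
  rewrite /cl /= -filter_mask eqEsubset; split.
    move=> x Jx; split; first exact: JO.
    have [y ys Pxy] := sr x (JO x Jx); exists y => //.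
    rewrite mem_filter ys andbT; apply/asboolP.
    have -> : y = x - (x - y) by ring.
    apply: (omodB nk) => //; exact: (prin_sub oJ JT).
  move=> x [Ox [y]]; rewrite mem_filter => /andP[/asboolP Jy ys] Pxy.
  have -> : x = (x - y) + y by ring.
  by have [_ _ JD _] := oJ; apply: JD => //; apply: (prin_sub oJ JT).
- exact: (nfV nk).
- by rewrite invr_eq0.
have oJ' := oJ; rewrite (span_prin nk) // JE eqEsubset; split=> [x Ix|_ [_ [x Ix <-] <-]].
  by exists (a * x); [exists x|rewrite mulKf].
by rewrite mulKf.
Qed.

Lemma ideal_class_eq I J : frid k I -> frid k J ->
  ideal_class k I = ideal_class k J <-> exists a, [/\ k a, a != 0 & I = span_mul (prin k a) J].
Proof.
move=> fI fJ; have oI := frid_omod fI; have oJ := frid_omod fJ.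
split.
  move=> E; have : ideal_class k I I.
    exists 1; first by split; [exact: nf1 nk|exact: oner_neq0].
    by rewrite eqEsubset; split=> [_ [x Ix <-]|x Ix]; [|exists x]; rewrite ?mul1r.
  rewrite E => -[a [ka a0] <-]; exists a; split=> //.
  by rewrite (span_prin nk).
move=> [a [ka a0 ->]]; rewrite (span_prin nk) // eqEsubset; split=> X [c [kc c0] <-].
  exists (c * a); first by split; [apply: (nfM nk)|rewrite mulf_neq0].
  rewrite eqEsubset; split=> [_ [x Jx <-]|_ [_ [x Jx <-] <-]]; last by exists x; rewrite ?mulrA.
  by exists (a * x); [exists x|rewrite mulrA].
exists (c / a); first by split; [apply: (nfM nk) => //; apply: (nfV nk)|rewrite mulf_neq0 ?invr_eq0].
rewrite eqEsubset; split=> [_ [_ [x Jx <-] <-]|_ [x Jx <-]].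
  by exists x => //; rewrite mulrA mulfVK.
by exists (a * x); [exists x|rewrite mulrA mulfVK].
Qed.

Lemma class_mulE I J : frid k I -> frid k J ->
  class_mul (ideal_class k I) (ideal_class k J) = ideal_class k (span_mul I J).
Proof.
move=> fI fJ; have [oI oJ] := (frid_omod fI, frid_omod fJ).
have oIJ := frid_omod (frid_mul nk fI fJ).
have key a c : span_mul [set a * x | x in I] [set c * x | x in J] = [set (a * c) * x | x in span_mul I J].
  rewrite eqEsubset; split.
    apply: span_mul_ind.
    - by exists 0; [exact: span_mul0|rewrite mulr0].
    - by move=> _ _ [x Ix <-] [y Iy <-]; exists (x + y); [exact: span_mulD|rewrite mulrDr].
    by move=> _ _ [x Ix <-] [y Jy <-]; exists (x * y); [exact: mem_span_mul|rewrite mulrACA].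
  move=> _ [x xIJ <-]; move: x xIJ.
  apply: (@span_mul_ind _ _ [set x | span_mul [set a * x0 | x0 in I] [set c * x0 | x0 in J] (a * c * x)]) => /=.
  - by rewrite mulr0; apply: span_mul0.
  - by move=> x y hx hy; rewrite mulrDr; apply: span_mulD.
  by move=> x y Ix Jy; rewrite mulrACA; apply: mem_span_mul; [exists x|exists y].
rewrite eqEsubset; split.
  move=> _ [_ [a [ka a0] <-] [_ [c [kc c0] <-] <-]]; rewrite key.
  by exists (a * c) => //; split; [apply: (nfM nk)|rewrite mulf_neq0].
move=> _ [a [ka a0] <-]; exists [set a * x | x in I]; first by exists a.
exists [set 1 * x | x in J]; first by exists 1 => //; split; [exact: nf1 nk|exact: oner_neq0].
by rewrite key mulr1.
Qed.

End ClassGroup.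

(** * The Selmer group *)

Section Selmer.
Variables (n : nat) (k : set algC).
Hypothesis nk : number_field n k.

Lemma iter_class_mul I l : frid k I ->
  iter l (class_mul (ideal_class k I)) (ideal_class k (OO k)) = ideal_class k (ipow k I l).
Proof.
move=> fI; elim: l => [|l IH] //=; rewrite IH (class_mulE nk) //.
exact: (frid_ipow _ nk).
Qed.

(** The members of [Is] represent distinct classes killed by [l], and these are no more numerous
    than the class group modulo [l]-th powers, which is [Q]. *)
Lemma class_quotient l : prime l -> exists Q : finGroupType,
  class_group_abelem_quotient l k Q /\
  forall Is : seq (set algC), uniq Is ->
    (forall I, I \in Is -> frid k I /\ exists a, [/\ k a, a != 0 & ipow k I l = prin k a]) ->
    (forall I J a, I \in Is -> J \in Is -> k a -> a != 0 -> I = span_mul (prin k a) J -> I = J) ->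
  (size Is <= #|Q|)%N.
Proof.
move=> lp; have [cls clsP] := class_group_finite nk.
pose X := undup [seq ideal_class k J | J <- cls & `[< frid k J >]].
have XP c : c \in X <-> exists2 I, frid k I & c = ideal_class k I.
  rewrite mem_undup; split.
    by move=> /mapP[J + ->]; rewrite mem_filter => /andP[/asboolP fJ _]; exists J.
  move=> [I fI ->]; have [J [a [Jc fJ ka a0 IE]]] := clsP I fI.
  apply/mapP; exists J; first by rewrite mem_filter Jc andbT; apply/asboolP.
  by apply/(ideal_class_eq nk) => //; exists a.
have fO := frid_OO nk.
have oO := omod_OO nk.
have [inv invP] : exists inv : set (set algC) -> set (set algC), forall c, c \in X ->
    exists I, [/\ frid k I, c = ideal_class k I & inv c = ideal_class k (dual k I)].
  have h c : exists d, c \in X -> exists I, [/\ frid k I, c = ideal_class k I & d = ideal_class k (dual k I)].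
    have [cX|nc] := boolP (c \in X); last by exists set0.
    have [I fI ->] := (XP c).1 cX; exists (ideal_class k (dual k I)) => _.
    by exists I.
  by have [inv invP] := choice h; exists inv.
have [|||||||Q [f [abQ fM fs fX]]] := @elementary_quotient _ X class_mul (ideal_class k (OO k)) inv _ _ _ _ _ _ _ l lp (undup_uniq _).
- move=> c d /XP[I fI ->] /XP[J fJ ->]; rewrite (class_mulE nk) //.
  by apply/XP; exists (span_mul I J) => //; apply: (frid_mul nk).
- by apply/XP; exists (OO k).
- move=> c /invP[I [fI _ ->]]; apply/XP; exists (dual k I) => //.
  exact: (frid_dual nk).
- move=> c d e /XP[I fI ->] /XP[J fJ ->] /XP[K fK ->].
  by rewrite !(class_mulE nk) ?span_mulA //; apply: (frid_mul nk).
- move=> c d /XP[I fI ->] /XP[J fJ ->]; by rewrite !(class_mulE nk) // span_mulC.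
- move=> c /XP[I fI ->]; rewrite (class_mulE nk) // (span_OO nk) //.
  exact: frid_omod.
- move=> c /invP[I [fI -> ->]]; rewrite (class_mulE nk) //; last exact: (frid_dual nk).
  by rewrite span_mulC (frid_mul_dual nk).
have cgX c : class_group k c <-> c \in X.
  split; first by move=> [I /(frid_fractional nk) fI <-]; apply/XP; exists I.
  by move=> /XP[I fI ->]; exists I => //; apply/(frid_fractional nk).
exists Q; split.
  split=> //; exists f; split; first by move=> c d /cgX cX /cgX dX; apply: fM.
  by move=> q; have [c /cgX cX cq] := fs q; exists c.
move=> Is uIs IsP IsI; apply: leq_trans fX.
rewrite -(size_map (ideal_class k)); apply: uniq_leq_size.
  rewrite map_inj_in_uniq // => I J Ii Ji E.
  have [fI _] := IsP I Ii; have [fJ _] := IsP J Ji.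
  have [a [ka a0 IE]] := (ideal_class_eq nk fI fJ).1 E.
  exact: (IsI I J a).
move=> _ /mapP[I Ii ->]; have [fI [a [ka a0 aE]]] := IsP I Ii.
rewrite mem_filter; apply/andP; split; last by apply/XP; exists I.
apply/eqP; rewrite iter_class_mul // aE; apply/(ideal_class_eq nk) => //.
  exact: (frid_prin nk).
exists a; split=> //; rewrite span_mulC (span_OO nk) //.
exact: frid_omod (frid_prin nk ka a0).
Qed.

Lemma maxid_prod_mem P a b : maxid k P -> OO k a -> OO k b -> P (a * b) -> P a \/ P b.
Proof.
move=> [[oP PO] _ P1 Pm] Oa Ob Pab; have [Pa|nPa] := pselect (P a); first by left.
right; have [y Oy Py] := Pm a Oa nPa; have [_ _ PD PM] := oP.
have -> : b = b * (1 - a * y) + y * (a * b) by ring.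
by apply: PD; apply: PM.
Qed.

Lemma maxid_nat_prime P S : maxid k P -> (0 < S)%N -> P S%:R ->
  exists2 p, p \in primes S & P p%:R.
Proof.
move=> mP; have [N] := ubnP S; elim: N S => // N IH S ltN S0 PS.
have [S1|S1] := leqP S 1.
  by have [_ _ P1 _] := mP; case: P1; have -> : 1 = S%:R :> algC by case: S S0 S1 {ltN PS} => [|[]].
have pS := pdiv_prime S1; have dS := pdiv_dvd S.
have E : S = (pdiv S * (S %/ pdiv S))%N by rewrite mulnC divnK.
have d0 : (0 < S %/ pdiv S)%N by rewrite divn_gt0 ?pdiv_gt0 // dvdn_leq.
have := PS; rewrite {1}E natrM => /(maxid_prod_mem mP (OO_nat nk _) (OO_nat nk _))[h|h].
  by exists (pdiv S) => //; rewrite mem_primes pS S0.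
have [|p pp Pp] := IH _ _ d0 h.
  by apply: leq_trans (ltn_Pdiv (prime_gt1 pS) S0) _.
exists p => //; rewrite E primesM ?pdiv_gt0 //; by rewrite pp orbT.
Qed.

Lemma maxids_over p : prime p -> exists s, [/\ uniq s, (size s <= n)%N,
  forall P, P \in s -> maxid k P & forall P, maxid k P -> P p%:R -> P \in s].
Proof.
move=> pp.
pose Q N := `[< exists s, [/\ uniq s, forall P, P \in s -> maxid k P /\ P p%:R & size s = N] >].
have exQ : exists N, Q N by exists 0%N; apply/asboolP; exists [::].
have bQ N : Q N -> (N <= n)%N by move=> /asboolP[s [us sP <-]]; apply: (maxid_over_prime nk pp us sP).
have [N /asboolP[s [us sP sN]] Nmax] := ex_maxnP exQ bQ.
exists s; split=> //; first by rewrite sN; apply: bQ; apply/asboolP; exists s.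
  by move=> P /sP[].
move=> P mP Pp; apply/negP => /negP nPs.
have : Q N.+1.
  apply/asboolP; exists (P :: s); split; rewrite /= ?nPs ?sN //.
  by move=> P'; rewrite inE => /orP[/eqP->|/sP].
by move=> /Nmax; rewrite ltnn.
Qed.

Lemma maxids_list S : (0 < S)%N -> exists s, [/\ (size s <= n * size (primes S))%N,
  forall P, P \in s -> maxid k P & forall P, maxid k P -> P S%:R -> P \in s].
Proof.
move=> S0.
have h p : exists s, prime p -> [/\ uniq s, (size s <= n)%N,
    forall P, P \in s -> maxid k P & forall P, maxid k P -> P p%:R -> P \in s].
  have [pp|np] := boolP (prime p); last by exists [::].
  by have [s sP] := maxids_over pp; exists s.
have [f fP] := choice h.
exists (flatten [seq f p | p <- primes S]); split.
- rewrite size_flatten /shape -map_comp sumnE big_map.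
  apply: (@leq_trans (\sum_(p <- primes S) n)).
    rewrite big_seq [leqRHS]big_seq; apply: leq_sum => p; rewrite mem_primes => /andP[pp _].
    by have [] := fP p pp.
  by rewrite big_const_seq count_predT iter_addn_0.
- move=> P /flatten_mapP[p]; rewrite mem_primes => /andP[pp _].
  by have [_ _ g _] := fP p pp; apply: g.
move=> P mP PS; have [p pS Pp] := maxid_nat_prime mP S0 PS.
apply/flatten_mapP; exists p => //; move: pS; rewrite mem_primes => /andP[pp _].
by have [_ _ _ g] := fP p pp; apply: g.
Qed.

Definition pexp (Ps : seq (set algC)) (e : nat -> nat) : set algC :=
  foldr span_mul (OO k) [seq ipow k (nth set0 Ps i) (e i) | i <- iota 0 (size Ps)].

Section Pexp.
Variable Ps : seq (set algC).
Hypothesis PsP : forall P, P \in Ps -> frid k P /\ P `<=` OO k.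

Lemma pexp_frid e : frid k (pexp Ps e) /\ pexp Ps e `<=` OO k.
Proof.
rewrite /pexp.
have : forall i, i \in iota 0 (size Ps) -> frid k (nth set0 Ps i) /\ nth set0 Ps i `<=` OO k.
  by move=> i; rewrite mem_iota add0n /= => lti; apply: PsP; apply: mem_nth.
elim: (iota 0 (size Ps)) => [|i s IH] h /=; first by split=> //; apply: (frid_OO nk).
have [f1 s1] := h i (mem_head _ _).
have [f2 s2] : frid k (foldr span_mul (OO k) [seq ipow k (nth set0 Ps i0) (e i0) | i0 <- s]) /\
   foldr span_mul (OO k) [seq ipow k (nth set0 Ps i0) (e i0) | i0 <- s] `<=` OO k.
  by apply: IH => j js; apply: h; rewrite inE js orbT.
split; first by apply: (frid_mul nk) => //; apply: (frid_ipow _ nk).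
by apply: (span_subOO nk) => //; apply: (ipow_subOO nk).
Qed.

Lemma pexpD e e' : pexp Ps (fun i => e i + e' i)%N = span_mul (pexp Ps e) (pexp Ps e').
Proof.
rewrite /pexp.
have : forall i, i \in iota 0 (size Ps) -> frid k (nth set0 Ps i).
  by move=> i; rewrite mem_iota add0n /= => lti; have [] := PsP (mem_nth set0 lti).
elim: (iota 0 (size Ps)) => [|i s IH] h /=.
  by rewrite (span_OO nk) //; apply: (omod_OO nk).
rewrite IH => [|j js]; last by apply: h; rewrite inE js orbT.
rewrite (ipowD _ _ nk); last by apply: frid_omod; apply: h; rewrite mem_head.
rewrite -!span_mulA; congr span_mul; rewrite !span_mulA; congr span_mul.
by rewrite span_mulC.
Qed.

Lemma pexp0 : pexp Ps (fun=> 0%N) = OO k.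
Proof.
rewrite /pexp; elim: (iota 0 (size Ps)) => [|i s IH] //=.
by rewrite IH (span_OO nk) //; apply: (omod_OO nk).
Qed.

Lemma pexpM e l : pexp Ps (fun i => l * e i)%N = ipow k (pexp Ps e) l.
Proof.
elim: l => [|l IH] /=; first by rewrite -[RHS]pexp0.
by rewrite -IH -pexpD; congr pexp; apply/funext => i; rewrite mulSn.
Qed.

Lemma pexp_delta P : P \in Ps -> exists e, pexp Ps e = P.
Proof.
move=> PPs; pose i := index P Ps; exists (fun j => (j == i)%N : nat).
have [fP _] := PsP PPs; have oP := frid_omod fP.
have iPs : (i < size Ps)%N by rewrite index_mem.
have iP : nth set0 Ps i = P by rewrite nth_index.
have key s : uniq s -> foldr span_mul (OO k) [seq ipow k (nth set0 Ps j) (j == i)%N | j <- s] =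
    if i \in s then P else OO k.
  elim: s => [|j s IH] //= /andP[njs us]; rewrite IH // inE eq_sym.
  have [ij|nij] := eqVneq i j; last by rewrite /= (span_OO nk) //; case: ifP => _ //; apply: (omod_OO nk).
  by rewrite -ij in njs *; rewrite (negbTE njs) /= iP !(span_OOr nk) //.
by rewrite /pexp key ?iota_uniq // mem_iota add0n iPs.
Qed.

End Pexp.

(** Induction on the index; the power of [S] in [B] forces each maximal ideal that is split off into
    [Ps]. *)
Lemma frid_factor S Ps B : (0 < S)%N -> (forall P, P \in Ps -> maxid k P) ->
  (forall P, maxid k P -> P S%:R -> P \in Ps) ->
  frid k B -> B `<=` OO k -> (exists M, B (S%:R ^+ M)) -> exists e, B = pexp Ps e.
Proof.
move=> S0 Pm Pall fB BO [M BM].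
have PsP P : P \in Ps -> frid k P /\ P `<=` OO k.
  by move=> /Pm mP; split; [apply: (maxid_frid nk)|case: mP => -[]].
have [N iN] := idx_frid nk fB BO (fun x h => h : OO k x).
have [m] := ubnP N; elim: m N B fB BO BM iN => // m IH N B fB BO BM iN ltN.
have [B1|B1] := pselect (B 1).
  by exists (fun=> 0%N); rewrite pexp0 (omod_1 (frid_omod fB) BO).
have [P [J' [M' [mP BP [fJ' JO'] BE [ltM iM]]]]] := frid_split nk fB BO iN B1.
have [[oP PO] _ _ _] := mP.
have PPs : P \in Ps.
  apply: Pall => //; have := BP _ BM; elim: (M) => [|M1 IHM].
    by rewrite expr0; have [_ _ P1 _] := mP => /P1.
  rewrite exprS => /(maxid_prod_mem mP) -[]//; first exact: (OO_nat nk).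
  by apply: (OOX nk); apply: (OO_nat nk).
have [e eE] : exists e, J' = pexp Ps e.
  apply: (IH M') => //; last exact: leq_trans ltM _.
  rewrite BE in BM; exact: (span_subl (frid_omod fJ') PO BM).
have [e' eE'] := pexp_delta PsP PPs.
by exists (fun i => e' i + e i)%N; rewrite (pexpD PsP) eE' -eE.
Qed.

Lemma prin_eq a b : k a -> a != 0 -> k b -> b != 0 -> prin k a = prin k b ->
  exists u, [/\ OO k u, OO k u^-1, u != 0 & a = u * b].
Proof.
move=> ka a0 kb b0 E.
have [u Ou uE] : prin k b a by rewrite -E; apply: (prin_mem nk).
have [v Ov vE] : prin k a b by rewrite E; apply: (prin_mem nk).
have uv : u * v = 1.
  by apply: (mulfI b0); rewrite mulr1 mulrA uE vE.
have u0 : u != 0 by apply: contra_eq_neq uv => ->; rewrite mul0r eq_sym oner_neq0.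
exists u; split=> //; last by rewrite mulrC.
by rewrite (_ : u^-1 = v) //; apply: (mulfI u0); rewrite uv divff.
Qed.

Lemma span_prin_prin a b : k a -> k b -> span_mul (prin k a) (prin k b) = prin k (a * b).
Proof.
move=> ka kb; rewrite (span_prin nk); last first.
  split=> [_ [x [kx _] <-]||_ _ [x Ox <-] [y Oy <-]|c _ Oc [x Ox <-]].
  - exact: (nfM nk).
  - by exists 0; [apply: (OO0 nk)|rewrite mulr0].
  - by exists (x + y); [apply: (OOD nk)|rewrite mulrDr].
  by exists (c * x); [apply: (OOM nk)|rewrite mulrCA].
rewrite eqEsubset; split=> [_ [_ [x Ox <-] <-]|_ [x Ox <-]].
  by exists x; rewrite ?mulrA.
by exists (b * x); [exists x|rewrite mulrA].
Qed.

(* The principal ideal of [g] is an [l]-th power [A ^ l] up to ideals dividing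
   powers of [S]. *)
Definition selmer (l S : nat) (g : algC) : Prop :=
  [/\ k g, g != 0 & exists A, [/\ frid k A, ipow k A l `<=` prin k g &
      exists M, ipow k A l (S%:R ^+ M * g)]].

(** Three nested fibrations, one for each factor: the exponents modulo [l] at the primes over [S];
    then the ideal class of the [l]-th root relative to a fixed member, which is killed by [l]; then
    a unit modulo [l]-th powers. *)
Lemma selmer_bound l : prime l -> exists Q : finGroupType,
  class_group_abelem_quotient l k Q /\
  forall (S : nat) (gs : seq algC), (0 < S)%N -> uniq gs ->
   (forall g, g \in gs -> selmer l S g) ->
   (forall g g' a, g \in gs -> g' \in gs -> k a -> g = g' * a ^+ l -> g = g') ->
   (size gs <= l ^ (n * size (primes S)) * (#|Q| * l ^ n.+1))%N.
Proof.
move=> lp; have l0 := prime_gt0 lp; have [Q [QP Qb]] := class_quotient lp.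
exists Q; split=> // S gs S0 ugs gsP gsI.
have [Ps [szP Pm Pall]] := maxids_list S0.
have PsP P : P \in Ps -> frid k P /\ P `<=` OO k.
  by move=> /Pm mP; split; [apply: (maxid_frid nk)|case: mP => -[]].
pose r := size Ps.
have ex g : exists fA : {ffun 'I_r -> 'I_l} * set algC, g \in gs ->
   frid k fA.2 /\ ipow k fA.2 l = span_mul (prin k g) (pexp Ps (fun i => nth 0%N [seq val (fA.1 j) | j <- enum 'I_r] i)).
  have [ggs|ng] := boolP (g \in gs); last by exists ([ffun=> Ordinal l0], set0).
  have [kg g0 [A [fA Ag [M AM]]]] := gsP g ggs.
  have kV : k g^-1 by apply: (nfV nk).
  have gV0 : g^-1 != 0 by rewrite invr_eq0.
  have fAl := frid_ipow l nk fA; have oAl := frid_omod fAl.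
  pose B := span_mul (prin k g^-1) (ipow k A l).
  have fB : frid k B by apply: (frid_mul nk) => //; apply: (frid_prin nk).
  have BE : B = [set g^-1 * x | x in ipow k A l] by apply: (span_prin nk).
  have [e eE] : exists e, B = pexp Ps e.
    apply: (@frid_factor S) => //.
      by rewrite BE => _ [x /Ag [y Oy <-] <-]; rewrite mulKf.
    by exists M; rewrite BE; exists (S%:R ^+ M * g) => //; rewrite mulrCA mulVf ?mulr1.
  pose e1 i := (e i %/ l)%N; pose e0 i := (e i %% l)%N.
  have [fe1 _] := pexp_frid PsP e1.
  (* The quotients [e %/ l] are absorbed into the [l]-th root, so that only the remainders are left
     as data. *)
  pose A' := span_mul A (dual k (pexp Ps e1)).
  have lt i : (e0 i < l)%N by rewrite ltn_mod.
  exists ([ffun i : 'I_r => Ordinal (lt i)], A') => _; split=> /=.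
    by apply: (frid_mul nk) => //; apply: (frid_dual nk).
  have e0E : pexp Ps e0 = pexp Ps (fun i => nth 0%N [seq val ([ffun i : 'I_r => Ordinal (lt i)] j) | j <- enum 'I_r] i).
    rewrite /pexp; congr foldr; apply/eq_in_map => i; rewrite mem_iota add0n /= => lti.
    by rewrite (nth_map (Ordinal lti)) ?size_enum_ord // ffunE /= nth_enum_ord.
  rewrite -e0E (ipowM _ _ _ nk).
  have fd : frid k (ipow k (pexp Ps e1) l) by apply: (frid_ipow _ nk).
  have dE : ipow k (dual k (pexp Ps e1)) l = dual k (ipow k (pexp Ps e1) l).
    apply: (frid_cancel nk fd); [exact: frid_omod (frid_ipow _ nk (frid_dual nk fe1))|exact: frid_omod (frid_dual nk fd)|].
    rewrite (frid_mul_dual nk fd) -(ipowM _ _ _ nk) (frid_mul_dual nk fe1).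
    elim: (l) => //= l' ->; exact: (span_OO nk (omod_OO nk)).
  have BE2 : B = span_mul (ipow k (pexp Ps e1) l) (pexp Ps e0).
    rewrite eE -(pexpM PsP) -(pexpD PsP); congr pexp; apply/funext => i.
    by rewrite /e1 /e0 mulnC -divn_eq.
  have AB : ipow k A l = span_mul (prin k g) B.
    rewrite /B span_mulA span_prin_prin // divff //.
    rewrite (_ : prin k 1 = OO k) ?(span_OO nk) //.
    by rewrite eqEsubset; split=> [_ [x Ox <-]|x Ox]; [|exists x]; rewrite ?mul1r.
  rewrite dE AB BE2 span_mulA -span_mulA -span_mulA [span_mul (pexp Ps e0) _]span_mulC.
  congr span_mul; rewrite span_mulA (frid_mul_dual nk fd) (span_OO nk) //.
  by have [fe0 _] := pexp_frid PsP e0; apply: frid_omod.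
have [key keyP] := choice ex.
have szr : (l ^ r <= l ^ (n * size (primes S)))%N by rewrite leq_pexp2l.
apply: (@leq_trans (l ^ r * (#|Q| * l ^ n.+1))); last by rewrite leq_mul2r szr orbT.
have -> : (l ^ r = size (enum {: {ffun 'I_r -> 'I_l}}))%N by rewrite -cardE card_ffun !card_ord.
apply: (@size_fibers _ _ (fun g => (key g).1)) => [g _|f _]; first by rewrite mem_enum.
set gs1 := [seq x <- gs | _].
have gs1P g : g \in gs1 -> g \in gs /\ (key g).1 = f by rewrite mem_filter => /andP[/eqP].
pose D := pexp Ps (fun i => nth 0%N [seq val (f j) | j <- enum 'I_r] i).
have [fD _] : frid k D /\ D `<=` OO k := pexp_frid PsP _.
have gsA g : g \in gs1 -> [/\ k g, g != 0, frid k (key g).2 & ipow k (key g).2 l = span_mul (prin k g) D].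
  move=> /gs1P[gg gf]; have [kg g0 _] := gsP g gg; have [fA AE] := keyP g gg.
  by rewrite gf in AE.
case E1 : gs1 => [|h gs1'] //; rewrite -E1.
have hgs : h \in gs1 by rewrite E1 mem_head.
have [kh h0 fAh AhE] := gsA h hgs.
(* Dividing by the root ideal of the reference [h] cancels the common exponents: the [l]-th power of
   [I g] is principal, generated by [g / h]. *)
pose I g := span_mul (key g).2 (dual k (key h).2).
have fI g : g \in gs1 -> frid k (I g).
  by move=> /gsA[_ _ fA _]; apply: (frid_mul nk) => //; apply: (frid_dual nk).
have IA g : g \in gs1 -> span_mul (I g) (key h).2 = (key g).2.
  move=> /gsA[_ _ fA _]; rewrite /I -span_mulA [span_mul (dual _ _) _]span_mulC.
  by rewrite (frid_mul_dual nk fAh) (span_OOr nk) //; apply: frid_omod.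
have Il g : g \in gs1 -> ipow k (I g) l = prin k (g / h).
  move=> gg; have [kg g0 fA AE] := gsA g gg.
  have kgh : k (g / h) by apply: (nfM nk) => //; apply: (nfV nk).
  have gh0 : g / h != 0 by rewrite mulf_neq0 ?invr_eq0.
  have fhD : frid k (span_mul (prin k h) D).
    by apply: (frid_mul nk) => //; apply: (frid_prin nk).
  apply: (frid_cancel nk fhD).
  - exact: frid_omod (frid_ipow _ nk (fI g gg)).
  - exact: frid_omod (frid_prin nk kgh gh0).
  rewrite span_mulC -AhE -(ipowM _ _ _ nk) IA // AE.
  by rewrite AhE [RHS]span_mulC span_mulA span_prin_prin // divfK.
pose ks := undup [seq ideal_class k (I g) | g <- gs1].
have [rep repP] : exists rep : set (set algC) -> algC, forall c, c \in ks ->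
    rep c \in gs1 /\ c = ideal_class k (I (rep c)).
  have h1 c : exists g, c \in ks -> g \in gs1 /\ c = ideal_class k (I g).
    have [|nc] := boolP (c \in ks); last by exists 0.
    by rewrite mem_undup => /mapP[g gg ->]; exists g.
  by have [rep repP] := choice h1; exists rep.
have szks : (size ks <= #|Q|)%N.
  rewrite -(size_map (fun c => I (rep c))); apply: Qb.
  - rewrite map_inj_in_uniq ?undup_uniq // => c d cks dks E.
    by rewrite (repP c cks).2 (repP d dks).2 E.
  - move=> _ /mapP[c cks ->]; have [rg _] := repP c cks; split; first exact: fI.
    have [kg g0 _ _] := gsA _ rg; exists (rep c / h); split; last exact: Il.
      by apply: (nfM nk) => //; apply: (nfV nk).
    by rewrite mulf_neq0 ?invr_eq0.
  move=> _ _ a /mapP[c cks ->] /mapP[d dks ->] ka a0 E.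
  have [rc cE] := repP c cks; have [rd dE] := repP d dks.
  suff -> : c = d by [].
  rewrite [LHS]cE [RHS]dE; apply/(ideal_class_eq nk (fI _ rc) (fI _ rd)); by exists a.
apply: (@leq_trans (size ks * l ^ n.+1)); last by rewrite leq_mul2r szks orbT.
apply: (@size_fibers _ _ (fun g => ideal_class k (I g))) => [g gg|c cks].
  by rewrite mem_undup; apply/mapP; exists g.
set gs2 := [seq x <- gs1 | _].
have gs2P g : g \in gs2 -> g \in gs1 /\ ideal_class k (I g) = c.
  by rewrite mem_filter => /andP[/eqP].
case E2 : gs2 => [|h2 gs2'] //; rewrite -E2.
have h2s : h2 \in gs2 by rewrite E2 mem_head.
have [h2g h2c] := gs2P h2 h2s; have [kh2 h20 fAh2 Ah2E] := gsA h2 h2g.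
have [u uP] : exists u : algC -> algC, forall g, g \in gs2 ->
    [/\ OO k (u g), OO k (u g)^-1, u g != 0 &
       exists a, [/\ k a, a != 0 & g = u g * (a ^+ l * h2)]].
  have h1 g : exists u, g \in gs2 -> [/\ OO k u, OO k u^-1, u != 0 &
       exists a, [/\ k a, a != 0 & g = u * (a ^+ l * h2)]].
    have [gg|ng] := boolP (g \in gs2); last by exists 0.
    have [gg1 gc] := gs2P g gg; have [kg g0 fA AE] := gsA g gg1.
    have [a [ka a0 aE]] : exists a, [/\ k a, a != 0 & I g = span_mul (prin k a) (I h2)].
      by apply/(ideal_class_eq nk (fI _ gg1) (fI _ h2g)); rewrite gc h2c.
    have {}aE : (key g).2 = span_mul (prin k a) (key h2).2.
      by rewrite -(IA g) // aE -span_mulA IA.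
    have kal : k (a ^+ l * h2) by apply: (nfM nk) => //; apply: (nfX nk).
    have al0 : a ^+ l * h2 != 0 by rewrite mulf_neq0 // expf_neq0.
    have pE : prin k g = prin k (a ^+ l * h2).
      apply: (frid_cancel nk fD); [exact: frid_omod (frid_prin nk kg g0)|exact: frid_omod (frid_prin nk kal al0)|].
      rewrite span_mulC -AE aE (ipowM _ _ _ nk) (ipow_prin _ nk) // Ah2E span_mulA.
      by rewrite span_prin_prin //; [rewrite span_mulC|apply: (nfX nk)].
    have [v [Ov OV v0 vE]] := prin_eq kg g0 kal al0 pE.
    by exists v => _; split=> //; exists a.
  by have [u uP] := choice h1; exists u.
have uI g g' b : g \in gs2 -> g' \in gs2 -> k b -> u g = u g' * b ^+ l -> g = g'.
  move=> gg gg' kb E; have [_ _ _ [a [ka a0 aE]]] := uP g gg.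
  have [_ _ _ [a' [ka' a'0 aE']]] := uP g' gg'.
  apply: (gsI _ _ (b * a / a')).
  - by have [/gs1P[]] := gs2P g gg.
  - by have [/gs1P[]] := gs2P g' gg'.
  - by apply: (nfM nk); [apply: (nfM nk)|apply: (nfV nk)].
  rewrite [LHS]aE [X in _ = X * _]aE' E !exprMn exprVn; field.
  by rewrite expf_neq0.
rewrite -(size_map u); apply: (units_bound nk lp).
- rewrite map_inj_in_uniq ?filter_uniq //; last by move=> g g' gg gg' E; apply: (uI g g' 1) => //; [exact: nf1 nk|rewrite expr1n mulr1].
- by move=> _ /mapP[g gg ->]; have [] := uP g gg.
move=> _ _ a /mapP[g gg ->] /mapP[g' gg' ->] ka E; by rewrite (uI g g' a).
Qed.

End Selmer.

(** * Relative discriminants *)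

Lemma det_expand (R : comNzRingType) (n r : nat) (C : 'I_n -> 'I_r -> R) (B : 'I_n -> 'I_r -> 'I_n -> R) :
  \det (\matrix_(i, j) \sum_a C i a * B i a j) =
  \sum_(f : {ffun 'I_n -> 'I_r}) (\prod_i C i (f i)) * \det (\matrix_(i, j) B i (f i) j).
Proof.
rewrite /determinant.
under eq_bigr => s _.
  under eq_bigr => i _ do rewrite mxE.
  rewrite (bigA_distr_bigA (fun i a => C i a * B i a (s i))) mulr_sumr /=.
  over.
rewrite exchange_big /=; apply: eq_bigr => f _.
rewrite mulr_sumr; apply: eq_bigr => s _.
rewrite big_split /= mulrCA; congr (_ * (_ * _)).
by apply: eq_bigr => i _; rewrite mxE.
Qed.

Section GalRep.
Variables (m n : nat) (k K : set algC) (G : finGroupType) (phi : algCaut -> G).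
Hypotheses (nk : number_field m k) (nK : number_field n K) (gr : galrep k K phi).

Let kK : k `<=` K. Proof. by case: gr. Qed.
Let phiM s t : fixes k s -> fixes k t -> phi (acomp s t) = (phi s * phi t)%g.
Proof. by case: gr => _ h _ _ _; apply: h. Qed.
Let phi1 s : fixes k s -> phi s = 1%g <-> fixes K s.
Proof. by case: gr => _ _ _ h _; apply: h. Qed.

Lemma gal_agree s t : fixes k s -> fixes k t -> phi s = phi t ->
  forall x, K x -> s x = t x.
Proof.
move=> fs ft E x Kx; have [r fr rE] : exists2 r, fixes k r & phi r = (phi t)^-1%g.
  by case: gr => _ _ h _ _; apply: h.
have h u : fixes k u -> phi u = phi t -> r (u x) = x.
  move=> fu uE; have fru := fixes_comp fr fu.
  have : fixes K (acomp r u) by apply/(phi1 fru); rewrite phiM // rE uE mulVg.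
  by move=> /(_ x Kx).
by apply: (fmorph_inj r); rewrite !h.
Qed.

Lemma gal_agreeP s t : fixes k s -> fixes k t ->
  (forall x, K x -> s x = t x) -> phi s = phi t.
Proof.
move=> fs ft E; have [r fr rE] : exists2 r, fixes k r & phi r = (phi t)^-1%g.
  by case: gr => _ _ h _ _; apply: h.
have frs := fixes_comp fr fs; have frt := fixes_comp fr ft.
have h : fixes K (acomp r s).
  have : fixes K (acomp r t) by apply/(phi1 frt); rewrite phiM // rE mulVg.
  by move=> h x Kx; rewrite acompE E //; apply: h.
have := (phi1 frs).2 h; rewrite phiM // rE => /(canRL (mulKVg _)).
by rewrite mulg1.
Qed.

(** A chosen automorphism for every group element; it is multiplicative only after restriction to
    [K]. *)
Definition gsec : G -> algCaut :=
  projT1 (choice (fun g => let: ex_intro2 s fs sg := (let: And5 _ _ h _ _ := gr in h) g in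
    ex_intro (fun s => fixes k s /\ phi s = g) s (conj fs sg))).

Lemma gsec_fix g : fixes k (gsec g).
Proof. by rewrite /gsec; case: choice => f /= h; have [] := h g. Qed.
Lemma gsecK g : phi (gsec g) = g.
Proof. by rewrite /gsec; case: choice => f /= h; have [] := h g. Qed.

Lemma gsecE s x : fixes k s -> K x -> s x = gsec (phi s) x.
Proof. by move=> fs; apply: gal_agree => //; rewrite ?gsecK //; apply: gsec_fix. Qed.

Lemma gsecM g h x : K x -> gsec (g * h)%g x = gsec g (gsec h x).
Proof.
move=> Kx; rewrite -acompE; apply: gal_agree => //; try exact: gsec_fix.
  by apply: fixes_comp; apply: gsec_fix.
by rewrite phiM ?gsecK //; apply: gsec_fix.
Qed.

Lemma gsec1 x : K x -> gsec 1%g x = x.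
Proof. by apply: (phi1 (gsec_fix _)).1; rewrite gsecK. Qed.

Lemma gal_stable s x : fixes k s -> K x -> K (s x).
Proof. by case: gr => _ _ _ _ h; apply: h. Qed.

Lemma gsec_stable g x : K x -> K (gsec g x).
Proof. by apply: gal_stable; apply: gsec_fix. Qed.

Lemma gal_fixed x : K x -> (forall g, gsec g x = x) -> k x.
Proof.
by move=> Kx h; apply: (number_field_fixed nk) => s fs; rewrite gsecE.
Qed.

Lemma gal_trace x : K x -> k (\sum_g gsec g x).
Proof.
move=> Kx; apply: gal_fixed.
  by apply: (nf_sum nK) => g _; apply: gsec_stable.
move=> g; rewrite rmorph_sum [RHS](reindex_inj (mulgI g)) /=.
by apply: eq_bigr => h _; rewrite gsecM.
Qed.

Local Notation N := #|G|.
(** The matrix of conjugates; the square of its determinant is the discriminant of the tuple [b]. *)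
Definition gmat (b : 'I_N -> algC) : 'M[algC]_N := \matrix_(i, j) gsec (enum_val i) (b j).

Lemma gmat_basis b : (forall j, K (b j)) -> \det (gmat b) != 0 -> basis_over k K b.
Proof.
move=> Kb d0; have Vu : gmat b \in unitmx by rewrite unitmxE unitfE.
have uniqc (c c' : 'cV[algC]_N) : gmat b *m c = gmat b *m c' -> c = c'.
  by move=> E; rewrite -(mulKmx Vu c) E mulKmx.
split=> // x Kx.
pose X : 'cV[algC]_N := \col_i gsec (enum_val i) x.
pose c := invmx (gmat b) *m X.
have cE (i : 'I_N) : \sum_j gsec (enum_val i) (b j) * c j 0 = gsec (enum_val i) x.
  transitivity ((gmat b *m c) i 0); last by rewrite mulKVmx // mxE.
  by rewrite [RHS]mxE; apply: eq_bigr => j _; rewrite [gmat b _ _]mxE.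
have kc j : k (c j 0).
  apply: (number_field_fixed nk) => s fs.
  have E : map_mx s c = c; last by have := congr1 (fun M : 'cV[algC]_N => M j 0) E; rewrite [map_mx s c j 0]mxE.
  apply: uniqc; rewrite mulKVmx //; apply/colP => i; rewrite !mxE.
  pose i' := enum_rank ((phi s)^-1 * enum_val i)%g.
  have act y : K y -> gsec (enum_val i) y = s (gsec (enum_val i') y).
    move=> Ky; rewrite (gsecE fs (gsec_stable _ Ky)) -gsecM // /i' enum_rankK mulKVg //.
  rewrite act // -cE rmorph_sum; apply: eq_bigr => j' _.
  by rewrite !mxE rmorphM /= act.
exists (\row_j c j 0); split.
  split; first by move=> i; rewrite mxE.
  have := cE (enum_rank (1%g : G)); rewrite enum_rankK gsec1 // => <-.
  apply: eq_bigr => j _; rewrite [(\row_i _) 0 j]mxE gsec1 //; exact: mulrC.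
move=> c' [kc' xE]; apply/rowP => j; rewrite mxE.
have -> : c' 0 j = c'^T j 0 by rewrite mxE.
congr ((_ : matrix _ _ _) _ _); apply: uniqc; rewrite mulKVmx //.
apply/colP => i; rewrite !mxE xE rmorph_sum; apply: eq_bigr => j' _.
rewrite !mxE rmorphM /= mulrC; congr (_ * _).
by rewrite (gsec_fix _ (kc' j')).
Qed.

Lemma gmat_exists : exists b, (forall j, OO K (b j)) /\ \det (gmat b) != 0.
Proof.
have [th0 [e [Kth0 einj esurj]]] := number_field_emb nK.
have [c c0 thA] := Aint_multiple th0.
pose th := c%:R * th0.
have Kth : K th by apply: (nfM nK) => //; apply: (nf_nat nK).
have inj g h : gsec g th = gsec h th -> g = h.
  rewrite /th !rmorphM !rmorph_nat => /mulfI E.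
  have {}E : gsec g th0 = gsec h th0 by apply: E; rewrite pnatr_eq0 -lt0n.
  have [i iE] := esurj (gsec g); have [j jE] := esurj (gsec h).
  rewrite iE // jE // in E; have {}E := einj _ _ E; subst j.
  rewrite -[g]gsecK -[h]gsecK; apply: gal_agreeP; try exact: gsec_fix.
  by move=> x Kx; rewrite iE // jE.
exists (fun j => th ^+ j); split; first by move=> j; apply: (OOX nK).
have -> : gmat (fun j => th ^+ j) = (Vandermonde N (\row_i gsec (enum_val i) th))^T.
  by apply/matrixP => i j; rewrite !mxE rmorphXn.
rewrite det_tr det_Vandermonde; apply/prodf_neq0 => i _; apply/prodf_neq0 => j ltij.
rewrite !mxE subr_eq0; apply/eqP => /inj /enum_val_inj E.
by rewrite E ltnn in ltij.
Qed.

Lemma basis_over_coord n' (b : 'I_n' -> algC) : basis_over k K b ->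
  forall n'' (c : 'I_n'' -> algC), (forall i, K (c i)) ->
  exists P : 'M[algC]_(n'', n'), (forall i j, k (P i j)) /\ forall i, c i = \sum_j P i j * b j.
Proof.
move=> [Kb bu] n'' c Kc.
have [P PP] := choice (fun i => let: ex_intro P (conj h _) := bu (c i) (Kc i) in
  ex_intro (fun P : 'rV[algC]_n' => (forall j, k (P 0 j)) /\ c i = \sum_j P 0 j * b j) P h).
exists (\matrix_(i, j) P i 0 j); split=> [i j|i]; first by rewrite mxE; have [] := PP i.
by have [_ ->] := PP i; apply: eq_bigr => j _; rewrite mxE.
Qed.

Lemma basis_over_uniq n' (b : 'I_n' -> algC) : basis_over k K b ->
  forall c c' : 'rV[algC]_n', (forall j, k (c 0 j)) -> (forall j, k (c' 0 j)) ->
  \sum_j c 0 j * b j = \sum_j c' 0 j * b j -> c = c'.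
Proof.
move=> [Kb bu] c c' kc kc' E.
have Kx : K (\sum_j c 0 j * b j).
  by apply: (nf_sum nK) => j _; apply: (nfM nK) => //; apply: kK.
have [d [_ du]] := bu _ Kx.
by rewrite -(du c) // -(du c').
Qed.

Lemma basis_over_size n' n'' (b : 'I_n' -> algC) (c : 'I_n'' -> algC) :
  basis_over k K b -> basis_over k K c -> (n' <= n'')%N.
Proof.
move=> bb bc; have [Kb _] := bb; have [Kc _] := bc.
have [P [kP PE]] := basis_over_coord bc Kb; have [Q [kQ QE]] := basis_over_coord bb Kc.
apply: (@mulmx1_min _ _ _ P Q); apply/row_matrixP => i.
apply: (basis_over_uniq bb).
- move=> j; rewrite !mxE; apply: (nf_sum nk) => a _; exact: (nfM nk).
- by move=> j; rewrite !mxE; apply: (nf_nat nk).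
transitivity (b i); last first.
  rewrite (bigD1 i) //= !mxE eqxx mul1r big1 ?addr0 // => j ji.
  by rewrite !mxE eq_sym (negbTE ji) mul0r.
rewrite [RHS]PE; under [RHS]eq_bigr do rewrite QE mulr_sumr.
rewrite exchange_big /=; apply: eq_bigr => j _; rewrite !mxE mulr_suml.
by apply: eq_bigr => a _; rewrite mulrA.
Qed.

Lemma basis_over_gmat n' (b : 'I_n' -> algC) : basis_over k K b ->
  exists (e : n' = N), \det (gmat (fun j => b (cast_ord (esym e) j))) != 0.
Proof.
move=> bb; have [b0 [Ob0 d0]] := gmat_exists.
have Kb0 j : K (b0 j) by case: (Ob0 j).
have bb0 := gmat_basis Kb0 d0.
have e : n' = N by apply/eqP; rewrite eqn_leq !(basis_over_size bb bb0, basis_over_size bb0 bb).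
subst n'; exists erefl.
have -> : (fun j => b (cast_ord (esym erefl) j)) = b.
  by apply/funext => j; rewrite cast_ord_id.
have [Q [kQ QE]] := basis_over_coord bb Kb0.
have E : gmat b0 = gmat b *m Q^T.
  apply/matrixP => i j; rewrite !mxE QE rmorph_sum; apply: eq_bigr => a _.
  by rewrite rmorphM /= !mxE mulrC (gsec_fix _ (kQ _ _)).
by apply: contraNneq d0 => d0; rewrite E det_mulmx d0 mul0r.
Qed.

(** The matrix of conjugates diagonalises multiplication by [x], with the conjugates of [x] as
    eigenvalues. *)
Lemma is_traceE x t : K x -> is_trace k K x t -> t = \sum_g gsec g x.
Proof.
move=> Kx [n' [b [M [bb kM ME ->]]]].
have [e d0] := basis_over_gmat bb; subst n'.
have bE : (fun j => b (cast_ord (esym erefl) j)) = b by apply/funext => j; rewrite cast_ord_id.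
rewrite bE in d0.
pose W := (gmat b)^T; have Wu : W \in unitmx by rewrite unitmx_tr unitmxE unitfE.
pose D := diag_mx (\row_(i < N) gsec (enum_val (i : 'I_N)) x).
have MW : M *m W = W *m D.
  apply/matrixP => i j; rewrite mul_mx_diag !mxE -rmorphM mulrC ME rmorph_sum.
  apply: eq_bigr => a _; rewrite !mxE rmorphM /=; congr (_ * _).
  by rewrite (gsec_fix _ (kM _ _)).
have -> : M = W *m D *m invmx W by rewrite -MW mulmxK.
rewrite -mulmxA mxtrace_mulC mulmxKV // /D mxtrace_diag.
rewrite (reindex_onto (fun i : 'I_N => enum_val i) enum_rank) /=; last by move=> g _; rewrite enum_rankK.
apply: eq_big => [i|i _]; first by rewrite enum_valK eqxx.
by rewrite mxE.
Qed.

Lemma is_trace_exists x : K x -> is_trace k K x (\sum_g gsec g x).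
Proof.
move=> Kx; have [b [Ob d0]] := gmat_exists.
have Kb j : K (b j) by case: (Ob j).
have bb := gmat_basis Kb d0.
have [M [kM ME]] := basis_over_coord bb (fun i => nfM nK Kx (Kb i)).
have h : is_trace k K x (\tr M) by exists N, b, M.
by rewrite -(is_traceE Kx h).
Qed.

Lemma basis_discriminantsE : basis_discriminants k K =
  [set d | exists b, [/\ forall j, OO K (b j), \det (gmat b) != 0 & d = \det (gmat b) ^+ 2]].
Proof.
have TE (b : 'I_N -> algC) (T : 'M[algC]_N) : (forall i j, T i j = \sum_g gsec g (b i * b j)) ->
    \det T = \det (gmat b) ^+ 2.
  move=> h; have -> : T = (gmat b)^T *m gmat b.
    apply/matrixP => i j; rewrite h !mxE.
    rewrite (reindex_onto (fun i : 'I_N => enum_val i) enum_rank) /=; last by move=> g _; rewrite enum_rankK.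
    apply: eq_big => [a|a _]; first by rewrite enum_valK eqxx.
    by rewrite !mxE rmorphM.
  by rewrite det_mulmx det_tr expr2.
rewrite eqEsubset; split=> d.
  move=> [n' [b [T [bb bA bT ->]]]]; have [e d0] := basis_over_gmat bb; subst n'.
  have bE : (fun j => b (cast_ord (esym erefl) j)) = b by apply/funext => j; rewrite cast_ord_id.
  rewrite bE in d0; have [Kb _] := bb; exists b; split=> //; first by move=> j; split=> //; apply: bA.
  by apply: TE => i j; apply: is_traceE => //; apply: (nfM nK).
move=> [b [Ob d0 ->]].
have Kb j : K (b j) by case: (Ob j).
exists N, b, (\matrix_(i, j) \sum_g gsec g (b i * b j)); split.
- exact: gmat_basis.
- by move=> i; case: (Ob i).
- by move=> i j; rewrite mxE; apply: is_trace_exists; apply: (nfM nK).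
by apply/esym/TE => i j; rewrite mxE.
Qed.


Lemma OO_gsec g x : OO K x -> OO K (gsec g x).
Proof. by move=> [Kx xA]; split; [apply: gsec_stable|rewrite /= Aint_aut]. Qed.

Lemma nf_det n' (k' : set algC) d (M : 'M[algC]_d) : number_field n' k' ->
  (forall i j, k' (M i j)) -> k' (\det M).
Proof.
move=> nk' kM; apply: (nf_sum nk') => s _; apply: (nfM nk').
  by apply: (nfX nk'); apply: (nfN nk'); apply: (nf1 nk').
by apply: (nf_prod nk').
Qed.

Lemma Aint_det d (M : 'M[algC]_d) : (forall i j, M i j \in Aint) -> \det M \in Aint.
Proof.
move=> MA; apply: rpred_sum => s _; rewrite rpredMsign; exact: rpred_prod.
Qed.

Lemma OO_det2 b : (forall j, OO K (b j)) -> OO k (\det (gmat b) ^+ 2).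
Proof.
move=> Ob; split; last first.
  by rewrite /= rpredX // Aint_det // => i j; rewrite mxE Aint_aut; case: (Ob j).
have [d0|d0] := eqVneq (\det (gmat b)) 0; first by rewrite d0 expr0n; apply: (nf0 nk).
have Kb j : K (b j) by case: (Ob j).
have -> : \det (gmat b) ^+ 2 = \det ((gmat b)^T *m gmat b) by rewrite det_mulmx det_tr expr2.
apply: (nf_det nk) => i j.
have -> : ((gmat b)^T *m gmat b) i j = \sum_g gsec g (b i * b j).
  rewrite !mxE [RHS](reindex_onto (fun i : 'I_N => enum_val i) enum_rank) /=; last by move=> g _; rewrite enum_rankK.
  apply: eq_big => [a|a _]; first by rewrite enum_valK eqxx.
  by rewrite !mxE rmorphM.
by apply: gal_trace; apply: (nfM nK).
Qed.

Lemma disc_mem b : (forall j, OO K (b j)) -> discriminant k K (\det (gmat b) ^+ 2).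
Proof.
move=> Ob; have [d0|d0] := eqVneq (\det (gmat b)) 0.
  by rewrite d0 expr0n; apply: span_mul0.
rewrite -[_ ^+ 2]mul1r; apply: mem_span_mul; first exact: (OO1 nk).
by rewrite basis_discriminantsE; exists b.
Qed.

Lemma disc_frid : frid k (discriminant k K) /\ discriminant k K `<=` OO k.
Proof.
have BO : basis_discriminants k K `<=` OO k.
  by rewrite basis_discriminantsE => _ [b [Ob _ ->]]; apply: OO_det2.
have o : omod k (discriminant k K).
  rewrite /discriminant span_mulC; apply: (omod_span nk); last exact: (omod_OO nk).
  by move=> x /BO[].
have dO : discriminant k K `<=` OO k.
  by apply: span_mul_ind; [exact: (OO0 nk)|exact: (OOD nk)|move=> x y Ox /BO; apply: (OOM nk)].
split=> //; have [b [Ob d0]] := gmat_exists.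
by apply: (omod_frid nk o dO (disc_mem Ob)); rewrite expf_neq0.
Qed.

(* The system (x_i, y_i) exhibits [t] as an element of Noether's different. *)
Definition chr_system (w : seq (algC * algC)) (t : algC) : Prop :=
  (forall p, p \in w -> p.1 \in Aint /\ OO K p.2) /\
  forall s, fixes k s -> \sum_(p <- w) p.1 * s p.2 = if phi s == 1%g then t else 0.

(** Cramer's rule: [V * adj V] is scalar, so the column of the adjugate at the identity, multiplied
    by [det V], supplies the first components. *)
Lemma disc_chr t : discriminant k K t -> exists w, chr_system w t.
Proof.
apply: (@span_mul_ind _ _ [set t | exists w, chr_system w t]).
- by exists [::]; split=> // s _; rewrite big_nil; case: ifP.
- move=> x y [v [vP vE]] [w [wP wE]]; exists (v ++ w); split.
    by move=> p; rewrite mem_cat => /orP[/vP|/wP].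
  by move=> s fs; rewrite big_cat /= vE // wE //; case: ifP; rewrite ?addr0.
move=> a d [ka aA]; rewrite basis_discriminantsE => -[b [Ob d0 ->]].
pose V := gmat b; pose i1 : 'I_N := enum_rank (1%g : G).
have VA i j : V i j \in Aint by rewrite mxE Aint_aut; case: (Ob j).
exists [seq (a * (\det V * (\adj V) j i1), b j) | j <- enum 'I_N]; split.
  move=> _ /mapP[j _ ->]; split=> //=.
  rewrite rpredM // rpredM ?Aint_det // mxE /cofactor rpredMsign Aint_det // => i' j'.
  by rewrite !mxE; rewrite Aint_aut; case: (Ob (lift j j')).
move=> s fs; rewrite big_map big_enum /=.
pose i : 'I_N := enum_rank (phi s).
transitivity (a * \det V * ((V *m \adj V) i i1)).
  rewrite [in RHS]mxE mulr_sumr; apply: eq_bigr => j _.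
  rewrite [V i j]mxE enum_rankK -gsecE //; last by case: (Ob j).
  ring.
rewrite mul_mx_adj mxE /i /i1 (inj_eq enum_rank_inj).
by case: eqP => _; rewrite ?mulr1n ?mulr0n; ring.
Qed.

(** A converse of [disc_chr] up to radicals: [t ^+ #|G|] is the determinant of the scalar matrix
    [t], whose entries come from the system. Expanding it by rows leaves determinants of conjugates
    of integral tuples, and their squares are discriminants. *)
Lemma chr_prime P w t : primeZ P -> discriminant k K `<=` P -> chr_system w t -> P t.
Proof.
move=> pP dP [wP wE]; have [[PZ P0 PD PM] _ Pp] := pP.
have tA : t \in Aint.
  have := wE idfun (fun x _ => erefl); rewrite (_ : phi idfun = 1%g); last by apply/phi1.
  rewrite eqxx => <-; rewrite big_seq rpred_sum // => p pw.
  by have [pA [_ p2A]] := wP p pw; rewrite rpredM.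
apply: (primeX (m := N) pP tA).
have -> : t ^+ N = \det (t%:M : 'M[algC]_N) by rewrite det_scalar.
pose r := size w; pose x (a : 'I_r) := (nth (0, 0) w a).1; pose y (a : 'I_r) := (nth (0, 0) w a).2.
have xyP a : x a \in Aint /\ OO K (y a) by apply: wP; apply: mem_nth.
have -> : (t%:M : 'M[algC]_N) = \matrix_(i, j) \sum_a x a *
    gsec (enum_val j) (gsec (enum_val i)^-1%g (y a)).
  apply/matrixP => i j; rewrite !mxE.
  have := wE _ (gsec_fix (enum_val j * (enum_val i)^-1)%g); rewrite gsecK (big_nth (0, 0)) big_mkord.
  rewrite -eq_mulgV1 (inj_eq enum_val_inj) eq_sym => E.
  transitivity (if i == j then t else 0); first by case: eqP.
  rewrite -E; apply: eq_bigr => a _; rewrite gsecM //.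
  by have [_ []] := xyP a.
rewrite (det_expand (fun _ a => x a) (fun i a j => gsec (enum_val j) (gsec (enum_val i)^-1%g (y a)))).
elim/big_ind: _ => // f _; apply: (PM); first by apply: rpred_prod => i _; have [] := xyP (f i).
pose b i := gsec (enum_val i)^-1%g (y (f i)).
have Ob (i : 'I_N) : OO K (b i) by apply: OO_gsec; have [] := xyP (f i).
have -> : \det (\matrix_(i, j) gsec (enum_val j) (gsec (enum_val i)^-1%g (y (f i)))) = \det (gmat b).
  by rewrite -[RHS]det_tr; congr (\det _); apply/matrixP => i j; rewrite !mxE.
apply: (primeX (m := 2) pP).
  by apply: Aint_det => i j; rewrite mxE Aint_aut; case: (Ob j).
by apply: dP; apply: disc_mem.
Qed.

End GalRep.

(** * Discriminants in towers *)

(** A factor with a coefficient equal to [1] may be dropped, by the Prague theorem. *)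
Lemma Prague_peel (I : Type) (s : seq I) (F : I -> {poly algC}) q (f : {poly algC}) :
  (forall i, (F i)`_q = 1) -> f * \prod_(i <- s) F i \is a polyOver Aint ->
  f \is a polyOver Aint.
Proof.
move=> F1; elim: s f => [|i s IH] f; first by rewrite big_nil mulr1.
rewrite big_cons mulrA => /IH /Prague h; apply/polyOverP => j.
by have := h j q; rewrite F1 mulr1.
Qed.

Lemma dual_ipow n k I m : number_field n k -> frid k I ->
  dual k (ipow k I m) = ipow k (dual k I) m.
Proof.
move=> nk fI; have fd := frid_ipow m nk fI.
apply/esym/(frid_cancel nk fd).
- exact: frid_omod (frid_ipow _ nk (frid_dual nk fI)).
- exact: frid_omod (frid_dual nk fd).
rewrite (frid_mul_dual nk fd) -(ipowM _ _ _ nk) (frid_mul_dual nk fI).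
by elim: m {fd} => //= m ->; rewrite (span_OO nk) //; apply: (omod_OO nk).
Qed.

Section Codifferent.
Variables (m n : nat) (k K : set algC) (G : finGroupType) (phi : algCaut -> G).
Hypotheses (nk : number_field m k) (nK : number_field n K) (gr : galrep k K phi).

Local Notation V b := (gmat gr b).
Local Notation sg := (gsec gr).

Lemma gmat_nf b : (forall j, OO K (b j)) -> forall i j, K (V b i j).
Proof. by move=> Ob i j; rewrite mxE; apply: gsec_stable; case: (Ob j). Qed.

(** The discriminant only controls squares of determinants; a mixed product is handled by squaring
    and using that the integers are closed under square roots. *)
Lemma dual_disc_det b b' t : (forall j, OO K (b j)) -> (forall j, OO K (b' j)) ->
  dual k (discriminant k K) t -> t * (\det (V b) * \det (V b')) \in Aint.
Proof.
move=> Ob Ob' [_ tJ]; apply: (@Aint_expr_inj _ 2) => //.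
have -> : (t * (\det (V b) * \det (V b'))) ^+ 2 =
  (\det (V b) ^+ 2 * t) * (\det (V b') ^+ 2 * t) by ring.
by apply: rpredM; apply: tJ; apply: (disc_mem nk nK).
Qed.

Lemma dual_system (b z : 'I_#|G| -> algC) e : (forall j, K (b j)) ->
  (forall g, \sum_j sg g (b j) * z j = if g == 1%g then e else 0) -> k e ->
  forall g h, \sum_j sg g (b j) * sg h (z j) = if g == h then e else 0.
Proof.
move=> Kb zE ke g h; transitivity (sg h (\sum_j sg (h^-1 * g)%g (b j) * z j)).
  by rewrite rmorph_sum; apply: eq_bigr => j' _; rewrite rmorphM /= -gsecM // mulKVg.
rewrite zE -eq_mulVg1 eq_sym.
by case: eqP => _; rewrite ?rmorph0 // (gsec_fix gr h).
Qed.

(** [z] is the dual basis of [b] scaled by [det ^+ 2 * t]. Its traces against an integer [x] are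
    integral by Cramer's rule: the trace of [z_j * x] is [t] times the determinants of [b] and of
    [b] with [b_j] replaced by [x]. *)
Lemma codifferent b t : (forall j, OO K (b j)) -> dual k (discriminant k K) t ->
  exists z : 'I_#|G| -> algC, [/\ forall j, K (z j),
    forall g, \sum_j sg g (b j) * z j = if g == 1%g then \det (V b) ^+ 2 * t else 0
  & forall j x, OO K x -> \sum_g sg g (z j * x) \in Aint].
Proof.
move=> Ob tJ; pose i1 : 'I_#|G| := enum_rank (1%g : G).
have [kK _ _ _ _] := gr; have Kb j : K (b j) by case: (Ob j).
pose z j := t * (\det (V b) * (\adj (V b)) j i1).
have Kz j : K (z j).
  apply: (nfM nK); first by apply: kK; case: tJ.
  apply: (nfM nK); first by apply: (nf_det nK) => i j'; apply: gmat_nf.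
  rewrite mxE; apply: (nfM nK).
    by apply: (nfX nK); apply: (nfN nK); apply: (nf1 nK).
  by apply: (nf_det nK) => i' j'; rewrite !mxE; apply: gsec_stable.
have zE g : \sum_j sg g (b j) * z j = if g == 1%g then \det (V b) ^+ 2 * t else 0.
  transitivity (t * \det (V b) * ((V b *m \adj (V b)) (enum_rank g) i1)).
    rewrite [(V b *m _) _ _]mxE mulr_sumr; apply: eq_bigr => j _.
    rewrite [V b _ j]mxE enum_rankK /z; ring.
  rewrite mul_mx_adj mxE /i1 (inj_eq enum_rank_inj).
  by case: eqP => _; rewrite ?mulr1n ?mulr0n; ring.
exists z; split=> // j x Ox; have Kx : K x by case: Ox.
pose e := \det (V b) ^+ 2 * t.
have ke : k e.
  by apply: (nfM nk); [have [] := OO_det2 nk nK gr Ob|case: tJ].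
have zg := dual_system Kb zE ke.
pose b' j' := if j' == j then x else b j'.
have Ob' j' : OO K (b' j') by rewrite /b'; case: eqP.
have [D0|D0] := eqVneq (\det (V b)) 0.
  by rewrite big1 ?rpred0 // => g _; rewrite /z D0 mul0r mulr0 mul0r rmorph0.
have CE : (\sum_g sg g (z j * x)) * \det (V b) = e * \det (V b').
  rewrite mulr_suml (expand_det_col (V b') j) mulr_sumr.
  rewrite [LHS](reindex_onto (fun i : 'I_#|G| => enum_val i) enum_rank) /=; last by move=> g _; rewrite enum_rankK.
  transitivity (\sum_(i < #|G|) sg (enum_val (i : 'I_#|G|)) x * (\sum_j' \det (V b) *+ (j == j') * sg (enum_val i) (z j'))).
    apply: eq_big => [i|i _]; first by rewrite enum_valK eqxx.
    rewrite (bigD1 j) //= eqxx mulr1n big1 ?addr0; last first.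
      by move=> j' /negbTE jj; rewrite eq_sym jj mulr0n mul0r.
    rewrite rmorphM /=; ring.
  apply: eq_bigr => i _.
  have -> : cofactor (V b') i j = \adj (V b) j i.
    rewrite [RHS]mxE /cofactor; congr (_ * \det _); apply/matrixP => a c.
    by rewrite !mxE /b' [lift j c == j]eq_sym (negbTE (neq_lift j c)).
  have -> : V b' i j = sg (enum_val i) x by rewrite mxE /b' eqxx.
  rewrite mulrCA; congr (_ * _).
  transitivity (\sum_j' \sum_i' \adj (V b) j i' * V b i' j' * sg (enum_val i) (z j')).
    apply: eq_bigr => j' _; rewrite -mulr_suml; congr (_ * _).
    have := mul_adj_mx (V b) => /matrixP/(_ j j'); rewrite [RHS]mxE => <-.
    by rewrite [LHS]mxE.
  rewrite exchange_big /= (bigD1 i) //= [X in _ + X]big1 ?addr0.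
    under eq_bigr => j' _ do rewrite -mulrA [V b _ _]mxE.
    by rewrite -mulr_sumr zg eqxx mulrC.
  move=> i' ii; under eq_bigr => j' _ do rewrite -mulrA [V b _ _]mxE.
  by rewrite -mulr_sumr zg (inj_eq enum_val_inj) (negbTE ii) mulr0.
have -> : \sum_g sg g (z j * x) = t * (\det (V b) * \det (V b')).
  by apply: (mulIf D0); rewrite CE /e; ring.
exact: dual_disc_det.
Qed.

(** [e ^+ #|G|] is the determinant of the conjugates of [b] times that of the conjugates of [z].
    Multiplying the columns of the latter by the conjugates of [u] makes its row expansion run over
    integral tuples [u_c * z_j]. *)
Lemma disc_codiff (u : {poly algC}) (z : 'I_#|G| -> algC) b t e :
  (forall j, OO K (b j)) -> dual k (discriminant k K) t -> (forall j, K (z j)) ->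
  (forall g, \sum_j sg g (b j) * z j = if g == 1%g then e else 0) -> k e ->
  (forall c, K u`_c) -> (forall c j, u`_c * z j \in Aint) ->
  (t * e ^+ #|G|)%:P * \prod_g map_poly (sg g) u \is a polyOver Aint.
Proof.
move=> Ob tJ Kz zE ke Ku uz; have Kb j : K (b j) by case: (Ob j).
have zg := dual_system Kb zE ke.
pose S : 'M[algC]_#|G| := \matrix_(j, i) sg (enum_val i) (z j).
have VS : V b *m S = e%:M.
  apply/matrixP => i i'; rewrite !mxE; under eq_bigr => j _ do rewrite !mxE.
  by rewrite zg (inj_eq enum_val_inj); case: eqP; rewrite ?mulr1n ?mulr0n.
have -> : e ^+ #|G| = \det (V b) * \det S by rewrite -det_mulmx VS det_scalar.
pose SP : 'M[{poly algC}]_#|G| := \matrix_(j, i) \sum_(c < size u)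
  'X^c * (sg (enum_val i) (u`_c * z j))%:P.
have -> : (t * (\det (V b) * \det S))%:P * \prod_g map_poly (sg g) u =
    (t * \det (V b))%:P * \det SP.
  rewrite mulrA polyCM -mulrA; congr (_ * _).
  have -> : (\det S)%:P = \det (map_mx polyC S) by rewrite det_map_mx.
  have -> : \prod_g map_poly (sg g) u =
     \det (diag_mx (\row_(i < #|G|) map_poly (sg (enum_val (i : 'I_#|G|))) u)).
    rewrite det_diag (reindex_onto (fun i : 'I_#|G| => enum_val i) enum_rank) /=; last by move=> g _; rewrite enum_rankK.
    by apply: eq_big => [i|i _]; rewrite ?enum_valK ?eqxx // mxE.
  rewrite -det_mulmx; congr (\det _); apply/matrixP => j i.
  rewrite mul_mx_diag !mxE.
  have -> : map_poly (sg (enum_val i)) u = \sum_(c < size u) (sg (enum_val i) u`_c) *: 'X^c.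
    by rewrite /map_poly poly_def.
  rewrite mulr_sumr; apply: eq_bigr => c _.
  by rewrite rmorphM /= polyCM -mul_polyC; ring.
rewrite /SP (det_expand (fun _ c => 'X^c) (fun j c i => (sg (enum_val i) (u`_c * z j))%:P)).
rewrite mulr_sumr; apply: rpred_sum => f _.
rewrite mulrCA rpredM //; first by apply: rpred_prod => i _; rewrite polyOverXn.
pose b' (j : 'I_#|G|) := u`_(f j) * z j.
have -> : \matrix_(i, j) (sg (enum_val j) (u`_(f i) * z i))%:P = map_mx polyC (V b')^T.
  by apply/matrixP => i j; rewrite !mxE.
rewrite det_map_mx det_tr -polyCM polyOverC -mulrA; apply: dual_disc_det => // j.
by split; [apply: (nfM nK)|apply: uz].
Qed.

End Codifferent.

Section Tower.
Variables (m n n' : nat) (k K N : set algC) (G H : finGroupType) (phi : algCaut -> G).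
Variable p : {morphism [set: G]%SET >-> H}.
Hypotheses (nk : number_field m k) (nK : number_field n K) (nN : number_field n' N).
Hypotheses (gr : galrep k K phi) (grN : galrep k N (p \o phi)).

Local Notation lt h := (phi (gsec grN h)).

Lemma gsec_sub g x : N x -> gsec gr g x = gsec grN (p g) x.
Proof.
by move=> Nx; rewrite (gsecE grN (gsec_fix gr g) Nx) /= gsecK.
Qed.

Lemma lift_ker h : p (lt h) = h.
Proof. by have := gsecK grN h. Qed.

Lemma sum_fibers (F : G -> algC) :
  \sum_g F g = \sum_h \sum_(c in ('ker p)%g) F (lt h * c)%g.
Proof.
rewrite (partition_big p predT) //=; apply: eq_bigr => h _.
rewrite (reindex_onto (fun c => lt h * c)%g (fun g => (lt h)^-1 * g)%g) /=; last by move=> g _; rewrite mulKVg.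
apply: eq_bigl => c; rewrite mulKg eqxx andbT.
have -> : (c \in ('ker p)%g) = (p c == 1%g) by rewrite !inE.
by rewrite morphM ?inE // lift_ker -{2}[h]mulg1 (inj_eq (mulgI h)).
Qed.

Lemma ker_trace_OO x : OO K x -> OO N (\sum_(c in ('ker p)%g) gsec gr c x).
Proof.
move=> Ox; have [Kx xA] := Ox; split; last by apply: rpred_sum => c _; rewrite Aint_aut.
have [kN _ _ _ _] := grN.
have fsN s : fixes N s -> fixes k s by apply: fixesW.
apply: (number_field_fixed nN) => s fs.
rewrite rmorph_sum [RHS](reindex_inj (mulgI (phi s))) /=.
have ps : (phi s \in 'ker p)%g.
  have [_ _ _ grN1 _] := grN.
  by rewrite !inE; apply/eqP/(iffRL (grN1 _ (fsN _ fs))).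
apply: eq_big => c; first by rewrite groupMl.
by move=> _; rewrite gsecM // (gsecE gr (fsN _ fs) (gsec_stable gr _ Kx)).
Qed.

Lemma codiff_trace z x : N z -> (forall y, OO N y -> \sum_h gsec grN h (z * y) \in Aint) ->
  OO K x -> \sum_g gsec gr g (z * x) \in Aint.
Proof.
move=> Nz zA Ox; have Kx : K x by case: Ox.
suff -> : \sum_g gsec gr g (z * x) =
   \sum_h gsec grN h (z * \sum_(c in ('ker p)%g) gsec gr c x) by apply/zA/ker_trace_OO.
rewrite sum_fibers; apply: eq_bigr => h _; rewrite rmorphM /= rmorph_sum mulr_sumr.
apply: eq_bigr => c; rewrite !inE => /andP[_ /eqP pc].
rewrite rmorphM /=; congr (_ * _).
  by rewrite gsec_sub // morphM ?inE // pc mulg1 lift_ker.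
by rewrite gsecM // [RHS](gsecE gr (gsec_fix grN h)) //; apply: gsec_stable.
Qed.

(** Inserting the diagonal matrix of conjugates of [z] between [V^T] and [V] gives the matrix of
    traces of [z * b_i * b_j], which are integral by transitivity of the trace. Each conjugate over
    [N] occurs once for every element of the kernel. *)
Lemma disc_poly b (z : {poly algC}) : (forall j, OO K (b j)) -> (forall c, N z`_c) ->
  (forall c y, OO N y -> \sum_h gsec grN h (z`_c * y) \in Aint) ->
  (\det (gmat gr b) ^+ 2)%:P * (\prod_h map_poly (gsec grN h) z) ^+ #|('ker p)%g|
    \is a polyOver Aint.
Proof.
move=> Ob Nz zA.
have -> : (\prod_h map_poly (gsec grN h) z) ^+ #|('ker p)%g| = \prod_g map_poly (gsec gr g) z.
  rewrite (partition_big p predT) //= -prodrXl; apply: eq_bigr => h _.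
  rewrite (eq_bigr (fun=> map_poly (gsec grN h) z)); last first.
    move=> g /eqP <-; apply/polyP => c; rewrite !coef_map_id0 ?rmorph0 // gsec_sub //.
  rewrite prodr_const; congr (_ ^+ _).
  have -> : ('ker p)%g = [set ((lt h)^-1 * g)%g | g in [pred g | p g == h]]%SET.
    apply/setP => c; apply/idP/imsetP => [|[g]]; rewrite !inE /=.
      move=> /eqP pc; exists (lt h * c)%g; last by rewrite mulKg.
      by rewrite inE morphM ?inE // pc mulg1 lift_ker.
    by move=> /eqP pg ->; rewrite morphM ?inE // morphV ?inE // lift_ker pg mulVg.
  by rewrite card_imset //; apply: mulgI.
pose V := gmat gr b.
pose D := diag_mx (\row_(i < #|G|) map_poly (gsec gr (enum_val (i : 'I_#|G|))) z).
have -> : \prod_g map_poly (gsec gr g) z = \det D.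
  rewrite det_diag (reindex_onto (fun i : 'I_#|G| => enum_val i) enum_rank) /=; last by move=> g _; rewrite enum_rankK.
  by apply: eq_big => [i|i _]; rewrite ?enum_valK ?eqxx // mxE.
have -> : (\det V ^+ 2)%:P * \det D = \det ((map_mx polyC V)^T *m D *m map_mx polyC V).
  by rewrite !det_mulmx det_tr !det_map_mx polyC_exp; ring.
have E i j : ((map_mx polyC V)^T *m D *m map_mx polyC V) i j =
    \poly_(c < size z) \sum_g gsec gr g (z`_c * (b i * b j)).
  rewrite mul_mx_diag !mxE.
  rewrite poly_def.
  under [RHS]eq_bigr do rewrite scaler_suml.
  rewrite exchange_big /=.
  rewrite [RHS](reindex_onto (fun i : 'I_#|G| => enum_val i) enum_rank) /=; last by move=> g _; rewrite enum_rankK.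
  apply: eq_big => [a|a _]; first by rewrite enum_valK eqxx.
  rewrite !mxE /map_poly poly_def mulr_sumr mulr_suml; apply: eq_bigr => c _.
  by rewrite !rmorphM /= -!mul_polyC !polyCM; ring.
rewrite /determinant; apply: rpred_sum => s _; apply: rpredM.
  by rewrite rpredX // rpredN rpred1.
apply: rpred_prod => i _; rewrite E; apply/polyOverP => c; rewrite coef_poly.
case: ifP => _; last exact: rpred0.
apply: codiff_trace => //; first exact: zA.
exact: (OOM nK).
Qed.

Lemma prod_mono (z : {poly algC}) (u : {poly algC}) :
  (\prod_h map_poly (gsec grN h) u) * (\prod_h map_poly (gsec grN h) z) =
  \prod_h map_poly (gsec grN h) (u * z).
Proof.
by rewrite -big_split /=; apply: eq_bigr => h _; rewrite rmorphM.
Qed.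

(** The discriminant ideal times its inverse is the unit ideal; the certificate is expanded so that
    the first factors are discriminants of tuples. *)
Lemma disc_one_sum : let J := discriminant k N in
  exists w : seq ({ffun 'I_#|H| -> algC} * algC),
  (forall q, q \in w -> (forall j, OO N (q.1 j)) /\ dual k J q.2) /\
  \sum_(q <- w) \det (gmat grN q.1) ^+ 2 * q.2 = 1.
Proof.
move=> J; have [fJ JO] := disc_frid nk nN grN.
pose P x := exists w : seq ({ffun 'I_#|H| -> algC} * algC),
  (forall q, q \in w -> (forall j, OO N (q.1 j)) /\ dual k J q.2) /\
  \sum_(q <- w) \det (gmat grN q.1) ^+ 2 * q.2 = x.
have P0 : P 0 by exists [::]; rewrite big_nil.
have PD x y : P x -> P y -> P (x + y).
  move=> [v [vP vE]] [w [wP wE]]; exists (v ++ w); rewrite big_cat /= vE wE; split=> // q.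
  by rewrite mem_cat => /orP[/vP|/wP].
have : span_mul J (dual k J) 1 by rewrite (frid_mul_dual nk) //; apply: (OO1 nk).
apply: (@span_mul_ind _ _ P) => // x y Jx Jy; move: x Jx.
rewrite /J /discriminant (basis_discriminantsE nk nN grN).
apply: (@span_mul_ind _ _ [set x | P (x * y)]) => [|x x' Px Px'|a _ Oa [b [Ob _ ->]]].
- by rewrite /= mul0r.
- by rewrite /= mulrDl; apply: PD.
exists [:: ([ffun j => b j], a * y)]; rewrite big_seq1 /=; split.
  move=> q; rewrite inE => /eqP -> /=; split=> [j|]; first by rewrite ffunE.
  have [Jk _ _ _] := frid_omod fJ.
  by have [_ _ _ h] := dual_omod nk Jk; apply: h.
have -> : ([ffun j => b j] : _ -> _) = b by apply/funext => j; rewrite ffunE.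
by rewrite mulrCA mulrA.
Qed.

(** [disc_poly] bounds [X] against the norm of [W], whose coefficients lie in the codifferent, and
    [disc_codiff] bounds [t] against the norm of [U], whose coefficients form an inverse system. In
    the product the norm of [U * W] can be peeled off. *)
Lemma disc_tower_dual b t : (forall j, OO K (b j)) ->
  ipow k (dual k (discriminant k N)) #|('ker p)%g| t -> \det (gmat gr b) ^+ 2 * t \in Aint.
Proof.
set l := #|_|; set J := discriminant k N; move=> Ob tl; set X := _ ^+ 2.
have [fJ JO] := disc_frid nk nN grN; have [kN _ _ _ _] := grN.
have [w [wP w1]] := disc_one_sum.
pose e (q : {ffun 'I_#|H| -> algC} * algC) := \det (gmat grN q.1) ^+ 2 * q.2.
have Oe q : q \in w -> OO k (e q).
  move=> /wP[Oq qJ]; split; last by apply: (proj2 qJ); apply: (disc_mem nk nN).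
  by apply: (nfM nk); [case: (OO_det2 nk nN grN Oq)|case: qJ].
have exz (q : {ffun 'I_#|H| -> algC} * algC) : exists z : 'I_#|H| -> algC, q \in w ->
   [/\ forall j, N (z j),
    forall g, \sum_j gsec grN g (q.1 j) * z j = if g == 1%g then e q else 0
  & forall j x, OO N x -> \sum_g gsec grN g (z j * x) \in Aint].
  have [qw|qw] := boolP (q \in w); last by exists (fun=> 0).
  have [Oq qJ] := wP q qw.
  by have [z zP] := codifferent nk nN grN Oq qJ; exists z.
have [Z ZP] := choice exz.
pose zs := [seq Z q j | q <- w, j <- enum 'I_#|H|].
have zsP z : z \in zs -> N z /\ forall y, OO N y -> \sum_h gsec grN h (z * y) \in Aint.
  by move=> /allpairsP[[q j] [/= qw _ ->]]; have [h1 _ h3] := ZP q qw; split=> // y; apply: h3.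
have zsN i : N zs`_i /\ forall y, OO N y -> \sum_h gsec grN h (zs`_i * y) \in Aint.
  have [ltiz|leiz] := ltnP i (size zs); first by apply: zsP; apply: mem_nth.
  rewrite nth_default //; split=> [|y _]; first exact: (nf0 nN).
  by rewrite big1 ?rpred0 // => h _; rewrite mul0r rmorph0.
have [u [Nu uz1 uzA]] : exists u : nat -> algC, [/\ forall i, N (u i),
    \sum_(i < size zs) zs`_i * u i = 1 & forall i j, zs`_i * u j \in Aint].
  apply: (content_inverse nN) => [x /zsP[]//|].
  apply: contraT => /hasPn z0; case/eqP: (oner_neq0 algC); rewrite -w1.
  rewrite big_seq big1 // => q qw; have [_ h _] := ZP q qw.
  have := h 1%g; rewrite eqxx -/(e q) => <-.
  rewrite big1 // => j _; have /z0 : Z q j \in zs by apply/allpairsP; exists (q, j); rewrite mem_enum.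
  by rewrite negbK => /eqP ->; rewrite mulr0.
(* [W] lists [zs] in reverse so that the middle coefficient of [U * W] is the sum of [u_i * zs_i],
   which is [1]. *)
pose U := \poly_(a < size zs) u a; pose W := \poly_(c < size zs) zs`_((size zs).-1 - c).
have size_gt0 : (0 < size zs)%N.
  by rewrite lt0n; apply/eqP => s0; move: uz1; rewrite s0 big_ord0 => /eqP; rewrite eq_sym oner_eq0.
have NU c : N U`_c by rewrite coef_poly; case: ifP => // _; apply: (nf0 nN).
have NW c : N W`_c /\ forall y, OO N y -> \sum_h gsec grN h (W`_c * y) \in Aint.
  rewrite coef_poly; case: ifP => // _; split=> [|y _]; first exact: (nf0 nN).
  by rewrite big1 ?rpred0 // => h _; rewrite mul0r rmorph0.
have UW1 : (U * W)`_((size zs).-1) = 1.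
  rewrite coefM prednK // -uz1; apply: eq_bigr => i _.
  rewrite !coef_poly ltn_ord mulrC; case: ifP => [_|]; last by have := ltn_ord i; lia.
  by rewrite subKn // -ltnS prednK.
pose FU := \prod_h map_poly (gsec grN h) U; pose FW := \prod_h map_poly (gsec grN h) W.
have XW : X%:P * FW ^+ l \is a polyOver Aint.
  by apply: disc_poly => // c; [case: (NW c)|case: (NW c)].
have tU q mm t' : q \in w -> ipow k (dual k J) mm t' ->
    (t' * e q ^+ (#|H| * mm))%:P * FU ^+ mm \is a polyOver Aint.
  move=> qw; have [Oq qJ] := wP q qw; have [zN zE zA] := ZP q qw.
  have base t0 : dual k J t0 -> (t0 * e q ^+ #|H|)%:P * FU \is a polyOver Aint.
    move=> t0J; apply: (disc_codiff nk nN Oq t0J zN zE) => //; first by case: (Oe q qw).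
    move=> c j; rewrite coef_poly; case: ifP => _; last by rewrite mul0r rpred0.
    have : Z q j \in zs by apply/allpairsP; exists (q, j); rewrite mem_enum.
    by move=> /(nthP 0)[i _ <-]; rewrite mulrC.
  elim: mm t' => [|mm IH] t'; first by move=> /= [_ tA]; rewrite muln0 !mulr1 polyOverC.
  apply: (@span_mul_ind _ _ [set t' | (t' * e q ^+ (#|H| * mm.+1))%:P * FU ^+ mm.+1 \is a polyOver Aint]).
  - by rewrite /= mul0r mul0r rpred0.
  - by move=> x y /= hx hy; rewrite mulrDl polyCD mulrDl rpredD.
  move=> x y /base hx /IH hy /=.
  have -> : (x * y * e q ^+ (#|H| * mm.+1))%:P * FU ^+ mm.+1 =
    ((x * e q ^+ #|H|)%:P * FU) * ((y * e q ^+ (#|H| * mm))%:P * FU ^+ mm).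
    by rewrite mulnS exprD !polyCM exprS; ring.
  exact: rpredM.
have Xe q : q \in w -> X * t * e q ^+ (#|H| * l) \in Aint.
  move=> qw; rewrite -polyOverC.
  have peel mm (f : {poly algC}) : f * (FU * FW) ^+ mm \is a polyOver Aint -> f \is a polyOver Aint.
    elim: mm f => [|mm IH] f; first by rewrite mulr1.
    rewrite exprS mulrA => /IH; rewrite /FU /FW prod_mono.
    by apply: (@Prague_peel _ _ _ (size zs).-1) => h; rewrite coef_map /= UW1 rmorph1.
  apply: (peel l).
  have -> : (X * t * e q ^+ (#|H| * l))%:P * (FU * FW) ^+ l =
    (X%:P * FW ^+ l) * ((t * e q ^+ (#|H| * l))%:P * FU ^+ l).
    by rewrite [(FU * FW) ^+ l]exprMn [FU ^+ l * _]mulrC -mulrA polyCM mulrACA.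
  by apply: rpredM => //; apply: tU.
(* The ideal of denominators of [X * t] contains powers of all [e q]. These sum to [1], so no prime
   can contain it. *)
pose I := [set a | a \in Aint /\ X * t * a \in Aint].
have iI : idealZ I.
  split=> [x []//||x y [xA hx] [yA hy]|a x aA [xA hx]].
  - by split; rewrite ?mulr0 rpred0.
  - by split; rewrite ?mulrDr rpredD.
  by split; [exact: rpredM|rewrite /= mulrCA; exact: rpredM].
have [[_]|I1] := pselect (I 1); first by rewrite mulr1.
have [P pP IP] := prime_exists iI I1; have [[PZ P0 PD PM] P1 _] := pP.
case: P1; rewrite -w1 big_seq; elim/big_ind: _ => // q qw.
have eA : e q \in Aint by case: (Oe q qw).
apply: (primeX pP eA (m := (#|H| * l)%N)); apply: IP; split; last exact: Xe.
exact: rpredX.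
Qed.

(* The local computation of a relative discriminant in a tower is made global
   by Dedekind's Prague theorem: [codifferent] gives polynomials whose norms
   stand for the inverse different of [N]. *)
Theorem disc_tower : discriminant k K `<=` ipow k (discriminant k N) #|('ker p)%g|.
Proof.
set J := discriminant k N.
have [fJ JO] := disc_frid nk nN grN.
have fJl l : frid k (ipow k J l) by apply: (frid_ipow _ nk).
move: (fJl #|('ker p)%g|) => [[lk l0 lD lM] _].
rewrite /discriminant (basis_discriminantsE nk nK gr).
apply: span_mul_ind => // a _ Oa [b [Ob _ ->]]; apply: lM => //.
have [kX _] := OO_det2 nk nK gr Ob.
apply: (frid_mem nk (fJl _)) => // t; rewrite (dual_ipow _ nk) // => tl.
exact: disc_tower_dual.
Qed.

End Tower.

(** * Tame ramification in the kernel *)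

Lemma geom0 (R : idomainType) (q : R) l : q != 1 -> q ^+ l = 1 -> \sum_(i < l) q ^+ i = 0.
Proof.
move=> q1 ql; apply/eqP; have /eqP := subrX1 q l.
by rewrite ql subrr eq_sym mulf_eq0 subr_eq0 (negbTE q1).
Qed.

Lemma fixes_inv k (s : algCaut) : fixes k s -> fixes k (algC_invaut s).
Proof. by move=> fs x kx /=; rewrite -{1}(fs x kx) algC_autK. Qed.

Lemma adjoin_sub (k : set algC) z : k `<=` adjoin k z.
Proof. by move=> x kx F [_ kF]; apply: kF; left. Qed.

Lemma adjoin_gen (k : set algC) z : adjoin k z z.
Proof. by move=> F [_ kF]; apply: kF; right. Qed.

Lemma fixes_adjoin (k : set algC) z (s : algCaut) : fixes k s -> s z = z -> fixes (adjoin k z) s.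
Proof.
move=> fs sz x h; apply: (h [set x | s x = x]); split; last by move=> y [ky|->]; [apply: fs|].
split; first by rewrite inE /= rmorph1.
  by move=> u v; rewrite !inE /= => hu hv; rewrite rmorphB hu hv.
by move=> u v; rewrite !inE /= => hu hv; rewrite fmorph_div /= hu hv.
Qed.

(** The [F]-embeddings of [E] with the identity marked. They give traces to [F] from cyclotomic
    extensions such as [K(zeta)] without setting up another Galois representation. *)
Definition emb_transversal (F E : set algC) r (t : 'I_r -> algCaut) (i0 : 'I_r) : Prop :=
  [/\ forall i, fixes F (t i),
      forall i j, (forall x, E x -> t i x = t j x) -> i = j,
      forall x, E x -> t i0 x = x
    & forall s, fixes F s -> exists2 pi : 'I_r -> 'I_r, injective pi &
        forall i x, E x -> s (t i x) = t (pi i) x].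

Lemma emb_transversal_exists n (F E : set algC) : number_field n E ->
  exists r (t : 'I_r -> algCaut) i0, emb_transversal F E t i0.
Proof.
move=> nE; have [th [e [Eth einj esurj]]] := number_field_emb nE.
pose Q (i : 'I_n) := `[< exists s, fixes F s /\ forall x, E x -> s x = e i x >].
pose r := #|[set i | Q i]%SET|.
have ev (j : 'I_r) : exists s, fixes F s /\ forall x, E x -> s x = e (enum_val j) x.
  by have := enum_valP j; rewrite inE => /asboolP.
have [t tP] := choice ev.
have tsurj s : fixes F s -> exists j, forall x, E x -> s x = t j x.
  move=> fs; have [i iE] := esurj s.
  have Qi : i \in [set i | Q i]%SET by rewrite inE; apply/asboolP; exists s.
  exists (enum_rank_in Qi i) => x Ex.
  by rewrite (proj2 (tP _)) // enum_rankK_in // iE.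
have tinj i j : (forall x, E x -> t i x = t j x) -> i = j.
  move=> h; apply/enum_val_inj/einj.
  by rewrite -(proj2 (tP i)) // -(proj2 (tP j)) // h.
have [i0 i0E] := tsurj idfun (fixes_id (k := F)).
exists r, t, i0; split=> //.
- by move=> i; case: (tP i).
- by move=> x Ex; rewrite -i0E.
move=> s fs; have ex i : exists j, forall x, E x -> s (t i x) = t j x.
  by apply: (tsurj (acomp s (t i))); apply: fixes_comp => //; case: (tP i).
have [pi piP] := choice ex; exists pi => // i j E1; apply: tinj => x Ex.
by apply: (fmorph_inj s); rewrite !piP // E1.
Qed.

Lemma emb_trace n F E r (t : 'I_r -> algCaut) i0 x : number_field n F ->
  emb_transversal F E t i0 -> E x -> F (\sum_i t i x).
Proof.
move=> nF [_ _ _ tP] Ex; apply: (number_field_fixed nF) => s fs.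
have [pi pinj piE] := tP s fs.
rewrite rmorph_sum [RHS](reindex_inj pinj) /=.
by apply: eq_bigr => i _; apply: piE.
Qed.

(** The sums attached to two systems multiply, so systems for two fields combine into one for their
    compositum. *)
Definition prod_system (v w : seq (algC * algC)) :=
  [seq (x.1 * y.1, x.2 * y.2) | x <- v, y <- w].

Lemma prod_systemE v w (s : algCaut) :
  \sum_(p <- prod_system v w) p.1 * s p.2 =
  (\sum_(p <- v) p.1 * s p.2) * (\sum_(p <- w) p.1 * s p.2).
Proof.
rewrite big_allpairs_dep /= mulr_suml; apply: eq_bigr => x _.
by rewrite mulr_sumr; apply: eq_bigr => y _; rewrite rmorphM /=; ring.
Qed.

Lemma prod_systemP v w : (forall p, p \in v -> p.1 \in Aint /\ p.2 \in Aint) ->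
  (forall p, p \in w -> p.1 \in Aint /\ p.2 \in Aint) ->
  forall p, p \in prod_system v w -> p.1 \in Aint /\ p.2 \in Aint.
Proof.
move=> vA wA _ /allpairsP[[x y] [/= /vA[x1 x2] /wA[y1 y2] ->]] /=.
by split; apply: rpredM.
Qed.

Section RootSystem.
Variables (l : nat) (zeta : algC).
Hypotheses (l_prime : prime l) (zP : l.-primitive_root zeta).

Let l_gt0 : (0 < l)%N. Proof. exact: prime_gt0. Qed.

Lemma root_zetaX (s : algCaut) : exists2 a, s zeta = zeta ^+ a & ~~ (l %| a)%N.
Proof.
have : (s zeta) ^+ l = 1 by rewrite -rmorphXn (prim_expr_order zP) rmorph1.
move=> /(prim_rootP zP)[a aE]; exists a => //; apply/negP.
rewrite (prim_order_dvd zP) -aE => /eqP /(canRL (algC_autK s)) z1.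
have {}z1 : zeta = 1 by rewrite z1 /= rmorph1.
by have := prim_order_dvd zP 1; rewrite expr1 z1 eqxx dvdn1 => /eqP l1; have := l_prime; rewrite l1.
Qed.

Lemma Aint_zeta : zeta \in Aint /\ zeta^-1 \in Aint.
Proof.
have z1 := prim_expr_order zP.
by split; apply: (@Aint_unity_root l) => //; apply/unity_rootP; rewrite ?exprVn z1 ?invr1.
Qed.

(** The analogous system for the cyclotomic field, exhibiting [l] through a geometric sum. *)
Definition zeta_system := [seq (zeta^-1 ^+ (b : 'I_l), zeta ^+ b) | b <- enum 'I_l].

Lemma zeta_systemE (s : algCaut) :
  \sum_(p <- zeta_system) p.1 * s p.2 = if s zeta == zeta then l%:R else 0.
Proof.
rewrite big_map big_enum /=.
have z0 : zeta != 0 by rewrite (prim_root_eq0 zP) -lt0n.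
transitivity (\sum_(b < l) (s zeta / zeta) ^+ b).
  by apply: eq_bigr => b _; rewrite rmorphXn exprMn mulrC.
case: eqP => [->|ne].
  by rewrite divff //; under eq_bigr do rewrite expr1n; rewrite sumr_const card_ord.
apply: geom0; first by apply/eqP => h; apply: ne; rewrite -[RHS]mul1r -h divfK.
by rewrite exprMn -rmorphXn exprVn (prim_expr_order zP) rmorph1 invr1 mulr1.
Qed.

Lemma zeta_systemP p : p \in zeta_system -> p.1 \in Aint /\ p.2 \in Aint.
Proof.
by move=> /mapP[b _ ->] /=; have [h1 h2] := Aint_zeta; split; apply: rpredX.
Qed.

End RootSystem.

(** A faithful character of the central kernel, recorded by exponents of [zeta]. The same exponents
    also number its powers, so they serve as row indices of the Fourier transform. *)
Definition central_chr (G H : finGroupType) (p : {morphism [set: G]%SET >-> H}) (l : nat)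
    (zeta : algC) (ex : G -> nat) : Prop :=
  [/\ ('ker p \subset 'Z([set: G]%SET))%g, #|('ker p)%g| = l, forall c, (ex c < l)%N,
     forall c d, c \in ('ker p)%g -> d \in ('ker p)%g ->
       zeta ^+ ex (c * d)%g = zeta ^+ ex c * zeta ^+ ex d
   & forall c, c \in ('ker p)%g -> zeta ^+ ex c = 1 -> c = 1%g].

Section CentralCharacter.
Variables (G H : finGroupType) (p : {morphism [set: G]%SET >-> H}) (l : nat) (zeta : algC) (ex : G -> nat).
Hypotheses (l_prime : prime l) (zP : l.-primitive_root zeta) (cc : central_chr p l zeta ex).

Local Notation lam c := (zeta ^+ ex c).
Local Notation A := ('ker p)%g.

Lemma in_kerE c : (c \in A) = (p c == 1%g).
Proof. by rewrite !inE. Qed.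

Lemma chrM c d : c \in A -> d \in A -> lam (c * d)%g = lam c * lam d.
Proof. by case: cc => _ _ _ h _; apply: h. Qed.

Lemma chr_cent c g : c \in A -> (c * g = g * c)%g.
Proof.
case: cc => /fintype.subsetP h _ _ _ _ /h /centerP[_ hc].
by apply: hc; rewrite inE.
Qed.

Lemma chr1 : lam 1%g = 1.
Proof.
have := chrM (group1 A) (group1 A); rewrite mulg1 -{1}[lam _]mulr1 => /mulfI -> //.
by rewrite expf_neq0 // (prim_root_eq0 zP) -lt0n prime_gt0.
Qed.

Lemma chr_inj c d : c \in A -> d \in A -> lam c = lam d -> c = d.
Proof.
move=> cA dA E; case: cc => _ _ _ _ inj; apply/eqP; rewrite eq_mulVg1; apply/eqP/inj.
  by rewrite groupM ?groupV.
by rewrite chrM ?groupV // -E -chrM ?groupV // mulVg chr1.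
Qed.

Lemma chrX c i : c \in A -> ~~ (l %| i)%N -> lam c ^+ i = 1 -> c = 1%g.
Proof.
move=> cA li; case: cc => _ _ _ _ inj; rewrite -exprM => /eqP.
rewrite -(prim_order_dvd zP) Euclid_dvdM // (negbTE li) orbF => h.
by apply: inj => //; apply/eqP; rewrite -(prim_order_dvd zP).
Qed.

Lemma chr_ord c : lam c ^+ l = 1.
Proof. by rewrite exprAC (prim_expr_order zP) expr1n. Qed.

Lemma chrV c : c \in A -> lam c^-1%g * lam c = 1.
Proof. by move=> cA; rewrite -chrM ?groupV // mulVg chr1. Qed.

Lemma chr_sum i : \sum_(c in A) lam c ^+ i = if (l %| i)%N then l%:R else 0.
Proof.
have [_ cA _ _ _] := cc.
case: ifP => [/dvdnP[q ->]|/negbT li].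
  under eq_bigr => c _ do rewrite mulnC exprM chr_ord expr1n.
  by rewrite sumr_const cA.
have [c cA1 c1] : exists2 c, c \in A & c != 1%g.
  have := prime_gt1 l_prime; rewrite -cA (cardD1 1%g) group1 ltnS => /card_gt0P[c].
  by rewrite !inE => /andP[c1 pc]; exists c => //; rewrite in_kerE.
apply/eqP; have : (lam c ^+ i - 1) * (\sum_(c in A) lam c ^+ i) == 0.
  rewrite mulrBl mul1r subr_eq0 mulr_sumr; apply/eqP.
  rewrite [RHS](reindex_inj (mulgI c)) /=; apply: eq_big => d; first by rewrite groupMl.
  by move=> dA; rewrite chrM // exprMn.
rewrite mulf_eq0 => /orP[|//]; rewrite subr_eq0 => /eqP /(chrX cA1 li) c1'.
by rewrite c1' eqxx in c1.
Qed.

End CentralCharacter.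

Section Gain.
Variables (m n n' : nat) (k K N : set algC) (G H : finGroupType) (phi : algCaut -> G).
Variable p : {morphism [set: G]%SET >-> H}.
Variables (l : nat) (zeta : algC) (ex : G -> nat).
Hypotheses (nk : number_field m k) (nK : number_field n K) (nN : number_field n' N).
Hypotheses (gr : galrep k K phi) (grN : galrep k N (p \o phi)).
Hypotheses (l_prime : prime l) (zP : l.-primitive_root zeta) (cc : central_chr p l zeta ex).

Local Notation lam c := (zeta ^+ ex c).
Local Notation A := ('ker p)%g.

Let kK : k `<=` K. Proof. by case: gr. Qed.
Let kN : k `<=` N. Proof. by case: grN. Qed.
Let phiM s t : fixes k s -> fixes k t -> phi (acomp s t) = (phi s * phi t)%g.
Proof. by case: gr => _ h _ _ _; apply: h. Qed.
Let phi1 s : fixes k s -> phi s = 1%g <-> fixes K s.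
Proof. by case: gr => _ _ _ h _; apply: h. Qed.
Let phiN s : fixes k s -> phi s \in A <-> fixes N s.
Proof.
case: grN => _ _ _ h _ fs; rewrite in_kerE; split=> [/eqP|/(iffRL (h s fs)) /= ->//].
exact: (iffLR (h s fs)).
Qed.
Let l_gt0 : (0 < l)%N. Proof. exact: prime_gt0. Qed.

(** Centrality of the extension enters here: conjugation over [k] does not change the kernel
    component. *)
Lemma phi_conj (t : algCaut) s : fixes k t -> fixes N s ->
  let r := acomp (algC_invaut t) (acomp s t) in fixes N r /\ phi r = phi s.
Proof.
move=> ft fs r; have fks := fixesW kN fs; have fi := fixes_inv ft.
have fr : fixes k r by do 2?apply: fixes_comp.
have E : phi r = phi s.
  have i1 : (phi (algC_invaut t) * phi t = 1)%g.
    rewrite -phiM //; apply/phi1; first exact: fixes_comp.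
    by move=> x _; rewrite acompE /= algC_autK.
  have sA : phi s \in A by apply/(phiN fks).
  rewrite phiM //; last exact: fixes_comp.
  by rewrite (phiM fks ft) (chr_cent cc _ sA) mulgA i1 mul1g.
by split=> //; apply/(phiN fr); rewrite E; apply/(phiN fks).
Qed.

(* Eigenvectors for opposite nontrivial characters of the kernel of [p]. *)
Definition eigenpair (x y : algC) : Prop :=
  [/\ x \in Aint, y \in Aint & exists2 e : nat, ~~ (l %| e)%N &
     forall s, fixes N s -> s zeta = zeta ->
       s x = lam (phi s) ^+ e * x /\ s y * lam (phi s) ^+ e = y].

(** If [t] raises [zeta] to the power [a], the eigencharacter is raised to the same power, and [a]
    is prime to [l]. *)
Lemma eigenpair_stable t x y : fixes k t -> eigenpair x y -> eigenpair (t x) (t y).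
Proof.
move=> ft [xA yA [e le eP]]; split; rewrite ?Aint_aut //.
have [a tz la] := root_zetaX l_prime zP t.
exists (a * e)%N; first by rewrite Euclid_dvdM // negb_or la.
move=> s fs sz; have [fr rE] := phi_conj ft fs.
set r := acomp _ _ in fr rE.
have rz : r zeta = zeta.
  by rewrite /r !acompE /= tz rmorphXn /= sz -tz algC_autK.
have st u : s (t u) = t (r u) by rewrite /r !acompE /= algC_invautK.
have [rx ry] := eP r fr rz; rewrite rE in rx ry.
have tl : t (lam (phi s) ^+ e) = lam (phi s) ^+ (a * e).
  rewrite !rmorphXn /= tz -!exprM; congr (_ ^+ _); ring.
split; first by rewrite st rx rmorphM /= tl.
by rewrite st -tl -rmorphM /= ry.
Qed.

Lemma eigenpair_fixed x y s : eigenpair x y -> fixes N s -> s zeta = zeta -> s (x * y) = x * y.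
Proof.
move=> [_ _ [e le eP]] fs sz; have [sx sy] := eP s fs sz.
by rewrite rmorphM /= sx -{2}sy; ring.
Qed.

(** Were [x * y] outside [P], the powers of [y] would be Kummer generators showing that [K] is
    unramified at [P]. Quantitatively, systems for [N], for the Kummer extension and for [zeta]
    combine into one for [K] exhibiting [T], and [P] contains no other factor of [T] than powers of
    [x * y]. *)
Lemma eigenpair_in_prime P s0 x y : primeZ P -> discriminant k K `<=` P ->
  discriminant k N s0%:R -> ~ P l%:R -> ~ P s0%:R -> eigenpair x y -> P (x * y).
Proof.
move=> pP dP dN Pl Ps exy; have [xA yA [e le eP]] := exy.
have [w [wP wE]] := disc_chr nk nN grN dN.
have [e' ne' nE] := number_field_adjoin nK zP; set E := adjoin K zeta in nE.
have [r [t [i0 tP]]] := emb_transversal_exists K nE.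
have [tK tinj ti0 tpi] := tP.
pose xs := [seq ((x * y) ^+ (l.-1 - (j : 'I_l)) * x ^+ j, y ^+ j) | j <- enum 'I_l].
pose v := prod_system w (prod_system xs (zeta_system l zeta)).
pose T := s0%:R * ((l%:R * (x * y) ^+ l.-1) * l%:R).
have sumxs s : fixes N s -> s zeta = zeta ->
    \sum_(q <- xs) q.1 * s q.2 = if phi s == 1%g then l%:R * (x * y) ^+ l.-1 else 0.
  move=> fs sz; have [sx sy] := eP s fs sz.
  rewrite big_map big_enum /=.
  have sA : phi s \in A by apply/phiN => //; apply: fixesW fs.
  have sy' : s y = lam (phi s)^-1%g ^+ e * y.
    by rewrite -{2}sy mulrCA -exprMn (chrV l_prime zP cc) // expr1n mulr1.
  set q := lam (phi s)^-1%g ^+ e in sy'.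
  transitivity ((\sum_(j < l) q ^+ j) * (x * y) ^+ l.-1).
    rewrite mulr_suml; apply: eq_bigr => j _; rewrite rmorphXn /= sy'.
    have jl : (j <= l.-1)%N by rewrite -ltnS prednK.
    rewrite -[in RHS](subnK jl) exprD !exprMn; ring.
  case: eqP => [s1|ns].
    rewrite /q s1 invg1 (chr1 l_prime zP cc) expr1n; congr (_ * _).
    by under eq_bigr do rewrite expr1n; rewrite sumr_const card_ord.
  have ql : q ^+ l = 1.
    by rewrite /q -!exprM [(e * l)%N]mulnC mulnCA exprM (prim_expr_order zP) expr1n.
  rewrite geom0 ?mul0r //; apply/eqP => /(chrX l_prime zP cc) h; apply: ns.
  by apply: invg_inj; rewrite invg1 h ?groupV.
have vE s : fixes k s -> \sum_(q <- v) q.1 * s q.2 =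
    if (phi s == 1%g) && (s zeta == zeta) then T else 0.
  move=> fs; rewrite !prod_systemE wE //= (zeta_systemE l_prime zP).
  have [p1|p1] := eqVneq (p (phi s)) 1%g; last first.
    by rewrite mul0r; case: eqP => //= s1; rewrite s1 morph1 eqxx in p1.
  have fN : fixes N s by apply/phiN => //; rewrite in_kerE p1.
  case: eqP => [sz|_]; last by rewrite andbF !mulr0.
  by rewrite sumxs // andbT; case: ifP => // _; rewrite mul0r mulr0.
have vA q : q \in v -> q.1 \in Aint /\ q.2 \in Aint.
  apply: prod_systemP => [q' q'w|]; first by have [? []] := wP q' q'w.
  apply: prod_systemP => [q' /mapP[j _ ->] /=|q']; last exact: zeta_systemP.
  by rewrite !(rpredM, rpredX).
have vE2 q : q \in v -> E q.2.
  move=> qv; apply: (number_field_fixed nE) => s fs.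
  have fsK : fixes K s by move=> u Ku; apply: fs; exact: adjoin_sub.
  have sz : s zeta = zeta by apply: fs; exact: adjoin_gen.
  have fk := fixesW kK fsK; have s1 : phi s = 1%g by apply/phi1.
  have fN : fixes N s by apply/phiN => //; rewrite s1 group1.
  have sy : s y = y.
    by have [_] := eP s fN sz; rewrite s1 (chr1 l_prime zP cc) expr1n mulr1.
  move: qv => /allpairsP[[a b] [/= aw /allpairsP[[c d] [/= cx dz ->]] ->]] /=.
  have [_ [Na _]] := wP a aw.
  move: cx dz => /mapP[j _ ->] /mapP[i _ ->] /=.
  by rewrite !rmorphM !rmorphXn /= sz sy fN.
(* The second components lie in [K(zeta)]; tracing them down to [K] keeps the sums, because the only
   embedding over [K] that fixes [zeta] is the identity. *)
pose v' := [seq (q.1, \sum_i t i q.2) | q <- v].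
have T0 : chr_system k K phi v' T.
  split=> [_ /mapP[q qv ->] /=|s fs].
    have [q1 q2] := vA q qv; split=> //; split; first exact: (emb_trace nK tP (vE2 q qv)).
    by apply: rpred_sum => i _; rewrite Aint_aut.
  rewrite big_map /=.
  transitivity (\sum_i (if (phi s == 1%g) && (acomp s (t i) zeta == zeta) then T else 0)).
    under eq_bigr do rewrite rmorph_sum mulr_sumr.
    rewrite exchange_big /=; apply: eq_bigr => i _.
    have fti := fixesW kK (tK i).
    have := vE (acomp s (t i)) (fixes_comp fs fti).
    rewrite phiM // (iffRL (phi1 fti) (tK i)) mulg1 => <-.
    exact: eq_bigr.
  case: eqP => [s1|_] /=; last by rewrite big1.
  have fsK : fixes K s by apply/phi1.
  have [pi pinj piE] := tpi s fsK.
  have [pi' piK pi'K] := injF_bij pinj.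
  rewrite (bigD1 (pi' i0)) //= big1 ?addr0 => [|i ii].
    by rewrite piE ?pi'K ?ti0 ?eqxx //; apply: adjoin_gen.
  case: eqP => // iz; case/eqP: ii; apply: pinj; rewrite pi'K; apply: tinj => u Eu.
  rewrite ti0 // -piE //; apply: (@fixes_adjoin K zeta (acomp s (t i)) _ iz u Eu).
  exact: fixes_comp.
have PT := chr_prime nk nK gr pP dP T0.
have [[_ _ _ _] _ PM] := pP.
have nA (a : nat) : a%:R \in Aint by apply: rpred_nat.
have xyA : x * y \in Aint by apply: rpredM.
have := PM _ _ (nA s0) (rpredM (rpredM (nA l) (rpredX l.-1 xyA)) (nA l)) PT; case=> //.
move=> /(PM _ _ (rpredM (nA l) (rpredX l.-1 xyA)) (nA l)); case=> //.
by move=> /(PM _ _ (nA l) (rpredX l.-1 xyA)); case=> // /(primeX pP xyA).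
Qed.

(** [x * y] lies in [N(zeta)], which is unramified over [k] up to [s0 * l]. The system for this
    extension writes the multiple of [x * y] through traces to [k], and these lie in [P] because
    every conjugate of the eigenpair is again one. *)
Lemma eigenpair_span P s0 x y : primeZ P -> discriminant k K `<=` P ->
  discriminant k N s0%:R -> ~ P l%:R -> ~ P s0%:R -> eigenpair x y ->
  span_mul ZZ (k `&` P) ((s0 * l)%:R * (x * y)).
Proof.
move=> pP dP dN Pl Ps exy; have [xA yA _] := exy.
have [w [wP wE]] := disc_chr nk nN grN dN.
have [e' ne' nE] := number_field_adjoin nN zP; set E := adjoin N zeta in nE.
have [r [t [i0 tP]]] := emb_transversal_exists k nE.
have [tK tinj ti0 tpi] := tP.
pose v := prod_system w (zeta_system l zeta).
have vA q : q \in v -> q.1 \in Aint /\ q.2 \in Aint.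
  by apply: prod_systemP => [q' q'w|]; [have [? []] := wP q' q'w|apply: zeta_systemP].
have Exy : E (x * y).
  apply: (number_field_fixed nE) => s fs; apply: eigenpair_fixed => //.
    by move=> u Nu; apply: fs; exact: adjoin_sub.
  by apply: fs; exact: adjoin_gen.
have Ev q : q \in v -> E q.2.
  move=> /allpairsP[[a b] [/= aw /mapP[j _ ->] ->]] /=; have [_ [Na _]] := wP a aw.
  apply: (nfM nE); first exact: adjoin_sub.
  by apply: (nfX nE); apply: adjoin_gen.
have -> : (s0 * l)%:R * (x * y) = \sum_(q <- v) q.1 * \sum_i t i (q.2 * (x * y)).
  transitivity (\sum_i (if (p (phi (t i)) == 1%g) && (t i zeta == zeta) then (s0 * l)%:R * t i (x * y) else 0)).
    rewrite (bigD1 i0) //= big1 ?addr0 => [|i ii].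
      have fN : fixes N (t i0) by move=> u Nu; apply: ti0; exact: adjoin_sub.
      rewrite ti0 //; last exact: adjoin_gen.
      by rewrite -in_kerE (iffRL (phiN (tK i0)) fN) eqxx ti0.
    case: ifP => // /andP[pi1 /eqP tz]; case/eqP: ii; apply: tinj => u Eu.
    rewrite [RHS]ti0 //; apply: (fixes_adjoin _ tz Eu).
    by apply/(phiN (tK i)); rewrite in_kerE.
  under [RHS]eq_bigr do rewrite mulr_sumr.
  rewrite exchange_big /=; apply: eq_bigr => i _.
  transitivity ((\sum_(q <- v) q.1 * t i q.2) * t i (x * y)); last first.
    by rewrite mulr_suml; apply: eq_bigr => q _; rewrite [in RHS]rmorphM /= mulrA.
  rewrite prod_systemE wE // (zeta_systemE l_prime zP) /=.
  by case: eqP => _ /=; case: eqP => _; rewrite ?natrM ?mulr0 ?mul0r.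
rewrite big_seq; apply: span_mul_sum => q qv; have [q1 q2] := vA q qv.
apply: mem_span_mul => //; split.
  by apply: (emb_trace nk tP); apply: (nfM nE) => //; apply: Ev.
have [[_ P0 PD PM] _ _] := pP.
elim/big_ind: _ => // i _; rewrite rmorphM /=; apply: PM; first by rewrite Aint_aut.
rewrite rmorphM /=; apply: (@eigenpair_in_prime P s0) => //.
by apply: eigenpair_stable.
Qed.


Local Notation lt h := (phi (gsec grN h)).
Local Notation cg g := ((lt (p g))^-1 * g)%g.
Local Notation sg := (gsec gr).

Lemma cg_ker g : cg g \in A.
Proof. by rewrite in_kerE morphM ?inE // morphV ?inE // lift_ker mulVg. Qed.

Lemma cg_lt h c : c \in A -> cg (lt h * c)%g = c.
Proof.
rewrite in_kerE => /eqP pc; have -> : p (lt h * c)%g = h by rewrite morphM ?inE // lift_ker pc mulg1.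
by rewrite mulKg.
Qed.

Lemma p_lt h c : c \in A -> p (lt h * c)%g = h.
Proof. by rewrite in_kerE => /eqP pc; rewrite morphM ?inE // lift_ker pc mulg1. Qed.

(** [Fp] and [Fm] are block Fourier transforms on the cosets of the kernel, for opposite characters.
    The row of [g] uses the power of the character given by the exponent of its kernel component. *)
Let Fp : 'M[algC]_#|G| := \matrix_(i, j)
  if p (enum_val i) == p (enum_val j) then lam (cg (enum_val j))^-1%g ^+ ex (cg (enum_val i)) else 0.
Let Fm : 'M[algC]_#|G| := \matrix_(i, j)
  if p (enum_val i) == p (enum_val j) then lam (cg (enum_val j)) ^+ ex (cg (enum_val i)) else 0.

Lemma sum_enum (F : G -> algC) : \sum_(i < #|G|) F (enum_val (i : 'I_#|G|)) = \sum_g F g.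
Proof.
rewrite [RHS](reindex_onto (fun i : 'I_#|G| => enum_val i) enum_rank) /=; last by move=> g _; rewrite enum_rankK.
by apply: eq_bigl => i; rewrite enum_valK eqxx.
Qed.

Lemma sum_coset (f : G -> G -> algC) g :
  \sum_g' (if p g == p g' then f (cg g') g' else 0) =
  \sum_(c in A) f c (lt (p g) * c)%g.
Proof.
rewrite (sum_fibers grN) (bigD1 (p g)) //= [X in _ + X]big1 ?addr0 => [|h hg].
  by apply: eq_bigr => c cA; rewrite cg_lt // p_lt // eqxx.
by rewrite big1 // => c cA; rewrite p_lt // eq_sym (negbTE hg).
Qed.

(** Orthogonality of characters; the transform is therefore invertible at primes not dividing
    [l]. *)
Lemma dft_det : \det Fp * \det Fm = l%:R ^+ #|G|.
Proof.
rewrite -[\det Fm]det_tr -det_mulmx -(det_scalar #|G| (l%:R : algC)); congr (\det _).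
apply/matrixP => i i'; rewrite !mxE.
pose g := enum_val i; pose g' := enum_val i'; set e := ex (cg g); set e' := ex (cg g').
transitivity (\sum_g1 (if p g == p g1 then
    (fun c x => if p g' == p x then lam c^-1%g ^+ e * lam c ^+ e' else 0) (cg g1) g1 else 0)).
  rewrite -sum_enum; apply: eq_bigr => j _; rewrite !mxE.
  by case: eqP => _; rewrite ?mul0r //; case: eqP => _; rewrite ?mulr0.
rewrite (sum_coset (fun c x => if p g' == p x then lam c^-1%g ^+ e * lam c ^+ e' else 0)).
have [pg|pg] := eqVneq (p g') (p g); last first.
  rewrite big1 => [|c cA]; last by rewrite p_lt // (negbTE pg).
  by have /negbTE -> : i != i' by apply: contra pg => /eqP ii; rewrite /g /g' ii.
have [el el'] : (e < l)%N /\ (e' < l)%N by case: cc => _ _ h _ _; split; apply: h.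
transitivity (\sum_(c in A) lam c ^+ (e' + (l - e))).
  apply: eq_bigr => c cA; rewrite p_lt // pg eqxx exprD mulrC; congr (_ * _).
  have lE : lam c ^+ l = lam c ^+ e * lam c ^+ (l - e) by rewrite -exprD subnKC // ltnW.
  rewrite -[LHS]mulr1 -(chr_ord ex zP c) lE mulrA -exprMn.
  by rewrite (chrV l_prime zP cc) // expr1n mul1r.
rewrite (chr_sum l_prime zP cc).
have -> : (l %| e' + (l - e))%N = (i == i').
  apply/idP/eqP => [h|ii]; last by rewrite /e /e' /g /g' ii subnKC ?dvdnn // ltnW.
  have ee : e = e'.
    have [q qE] := dvdnP h; have q1 : q = 1%N by nia.
    by rewrite q1 in qE; lia.
  apply: enum_val_inj; rewrite -/g -/g' -[g](mulKVg (lt (p g))) -[g'](mulKVg (lt (p g'))) pg.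
  congr (_ * _)%g; rewrite -{2}pg; apply: (chr_inj l_prime zP cc); try exact: cg_ker.
  by rewrite -/e -/e' ee.
by case: eqP; rewrite ?mulr1n ?mulr0n.
Qed.

Let X (b : 'I_#|G| -> algC) i j := \sum_(c in A) lam c^-1%g ^+ ex (cg (enum_val (i : 'I_#|G|))) *
  sg (lt (p (enum_val i)) * c)%g (b j).
Let Y (b : 'I_#|G| -> algC) i j := \sum_(c in A) lam c ^+ ex (cg (enum_val (i : 'I_#|G|))) *
  sg (lt (p (enum_val i)) * c)%g (b j).

Lemma dft_gmat b : Fp *m gmat gr b = \matrix_(i, j) X b i j /\ Fm *m gmat gr b = \matrix_(i, j) Y b i j.
Proof.
split; apply/matrixP => i j; rewrite !mxE /X /Y.
  rewrite -(sum_coset (fun c x => lam c^-1%g ^+ ex (cg (enum_val i)) * sg x (b j))) -sum_enum.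
  by apply: eq_bigr => j' _; rewrite !mxE; case: eqP => _; rewrite ?mul0r.
rewrite -(sum_coset (fun c x => lam c ^+ ex (cg (enum_val i)) * sg x (b j))) -sum_enum.
by apply: eq_bigr => j' _; rewrite !mxE; case: eqP => _; rewrite ?mul0r.
Qed.

Lemma XY_Aint b i j : (forall j, OO K (b j)) -> X b i j \in Aint /\ Y b i j \in Aint.
Proof.
move=> Ob; have [zA _] := Aint_zeta l_prime zP; split; apply: rpred_sum => c _;
by rewrite rpredM ?(rpredX, Aint_aut) //; case: (Ob j).
Qed.

(** An automorphism over [N(zeta)] shifts the summation over the kernel, so a transformed row is
    multiplied by a character value; [X] and [Y] receive inverse values. *)
Lemma XY_eigenpair b i j j' : (forall j, OO K (b j)) -> cg (enum_val i) != 1%g ->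
  eigenpair (X b i j) (Y b i j').
Proof.
move=> Ob ci; have [XA _] := XY_Aint i j Ob; have [_ YA] := XY_Aint i j' Ob.
have cA := cg_ker (enum_val i).
split=> //; exists (ex (cg (enum_val i))).
  apply: contra ci; rewrite (prim_order_dvd zP) => /eqP h.
  by apply/eqP; case: cc => _ _ _ _; apply.
move=> s fs sz; set e := ex (cg (enum_val i)); set h := p (enum_val i); set a := phi s.
have fk := fixesW kN fs; have aA : a \in A by apply/(phiN fk).
have sb c j0 : s (sg (lt h * c)%g (b j0)) = sg (lt h * (a * c))%g (b j0).
  have [Kb _] := Ob j0; rewrite (gsecE gr fk (gsec_stable gr _ Kb)) -gsecM //.
  by rewrite !mulgA (chr_cent cc _ aA).
have sl c : s (lam c) = lam c by rewrite rmorphXn /= sz.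
split.
  rewrite /X rmorph_sum mulr_sumr [RHS](reindex_inj (mulgI a)) /=.
  apply: eq_big => [c|c cA1]; first by rewrite groupMl.
  rewrite rmorphM /= rmorphXn /= sl sb -/h -/e mulrA -exprMn; congr (_ ^+ _ * _).
  by rewrite -(chrM cc) ?groupV ?groupM // invMg (chr_cent cc _ aA) mulgKV.
rewrite /Y rmorph_sum mulr_suml [RHS](reindex_inj (mulgI a)) /=.
apply: eq_big => [c|c cA1]; first by rewrite groupMl.
rewrite rmorphM /= rmorphXn /= sl sb -/h -/e mulrAC -exprMn; congr (_ ^+ _ * _).
by rewrite -(chrM cc) // (chr_cent cc _ aA).
Qed.

Lemma card_cg : #|[pred i : 'I_#|G| | cg (enum_val i) != 1%g]| = (#|H| * l.-1)%N.
Proof.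
apply/eqP; rewrite -(eqr_nat algC) -sumr_const natrM.
rewrite (big_mkcond (fun i : 'I_#|G| => i \in _)) /=.
rewrite (sum_enum (fun g => if cg g != 1%g then 1 else 0)) (sum_fibers grN).
transitivity (\sum_(h : H) l.-1%:R == #|H|%:R * l.-1%:R :> algC); last first.
  by rewrite sumr_const mulr_natl eqxx.
congr (_ == _); apply: eq_bigr => h _.
have [_ cA _ _ _] := cc.
have : \sum_(c in A) (1 : algC) = l%:R by rewrite sumr_const cA.
rewrite (bigD1 1%g) ?group1 //= -[in RHS](prednK l_gt0) -natr1 [RHS]addrC => /addrI <-.
rewrite (bigD1 1%g) ?group1 //= cg_lt ?group1 // eqxx add0r.
by apply: eq_bigr => c /andP[cA1 c1]; rewrite cg_lt // c1.
Qed.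

Lemma mul_span I c x : c \in Aint -> span_mul ZZ I x -> span_mul ZZ I (c * x).
Proof.
move=> cA; apply: (@span_mul_ind _ _ [set x | span_mul ZZ I (c * x)]) => /=.
- by rewrite mulr0; apply: span_mul0.
- by move=> u v hu hv; rewrite mulrDr; apply: span_mulD.
by move=> u v uA Iv; rewrite mulrA; apply: mem_span_mul => //=; apply: rpredM.
Qed.

Lemma span_prod (T : finType) (B : pred T) (z : T -> algC) c q :
  (forall i, z i \in Aint) -> (forall i, B i -> span_mul ZZ q (c * z i)) ->
  span_mul ZZ (ipow k q #|B|) (c ^+ #|B| * \prod_i z i).
Proof.
move=> zA zq.
rewrite (bigID B) /= mulrA [_ * \prod_(i | ~~ B i) _]mulrC; apply: mul_span.
  by apply: rpred_prod => i _.
rewrite -prodr_const -big_split /= -big_enum /= cardE.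
have : all B (enum B) by apply/allP => i; rewrite mem_enum.
elim: (enum B) => [_|i r IH /=/andP[Bi Br]].
  by rewrite big_nil -[1]mulr1; apply: mem_span_mul; [apply: rpred1|apply: (OO1 nk)].
rewrite big_cons; move: (IH Br); set y := \prod_(_ <- _) _ => hy.
apply: (@span_mul_ind _ _ [set x | span_mul ZZ (span_mul q (ipow k q (size r))) (x * y)] _ _ _ _ (zq i Bi)) => /=.
- by rewrite mul0r; apply: span_mul0.
- by move=> u v hu hv; rewrite mulrDl; apply: span_mulD.
move=> a u aA qu; rewrite -mulrA; apply: mul_span => //.
apply: (@span_mul_ind _ _ [set y | span_mul ZZ (span_mul q (ipow k q (size r))) (u * y)] _ _ _ _ hy) => /=.
- by rewrite mulr0; apply: span_mul0.
- by move=> v w hv hw; rewrite mulrDr; apply: span_mulD.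
move=> a' v a'A qv; rewrite mulrCA; apply: mem_span_mul => //; exact: mem_span_mul.
Qed.

(** Each term in the expansion of the two transformed determinants pairs an [X] and a [Y] from the
    same row. Every row with nontrivial character contributes one factor from the extension of
    [k :&: P], and [card_cg] counts these rows. *)
Lemma gain_span P s0 b : primeZ P -> discriminant k K `<=` P ->
  discriminant k N s0%:R -> ~ P l%:R -> ~ P s0%:R -> (forall j, OO K (b j)) ->
  span_mul ZZ (ipow k (k `&` P) (#|H| * l.-1))
    (((s0 * l) ^ (#|H| * l.-1) * l ^ #|G|)%:R * \det (gmat gr b) ^+ 2).
Proof.
move=> pP dP dN Pl Ps Ob; have [XE YE] := dft_gmat b.
have -> : ((s0 * l) ^ (#|H| * l.-1) * l ^ #|G|)%:R * \det (gmat gr b) ^+ 2 =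
   (s0 * l)%:R ^+ (#|H| * l.-1) * (\det (\matrix_(i, j) X b i j) * \det (\matrix_(i, j) Y b i j)).
  by rewrite -XE -YE !det_mulmx natrM !natrX -dft_det; ring.
rewrite -card_cg; set c := (s0 * l)%:R.
rewrite {1}/determinant mulr_suml mulr_sumr; apply: span_mul_sum => s _.
rewrite /determinant mulr_sumr mulr_sumr; apply: span_mul_sum => t _.
set S1 := (-1) ^+ s; set S2 := (-1) ^+ t.
rewrite (_ : c ^+ _ * _ = S1 * S2 * (c ^+ #|[pred i : 'I_#|G| | cg (enum_val i) != 1%g]| * \prod_i (X b i (s i) * Y b i (t i)))); last first.
  rewrite big_split /=; under eq_bigr do rewrite mxE.
  under [X in _ * (_ * (_ * X))]eq_bigr do rewrite mxE.
  ring.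
apply: mul_span; first by rewrite rpredM // rpredX // rpredN rpred1.
apply: span_prod => [i|i ci].
  by apply: rpredM; [case: (XY_Aint i (s i) Ob)|case: (XY_Aint i (t i) Ob)].
apply: eigenpair_span => //; exact: XY_eigenpair.
Qed.

Lemma primeZ_dvd P p0 a : primeZ P -> prime p0 -> P p0%:R -> P a%:R -> (p0 %| a)%N.
Proof.
move=> [[PZ P0 PD PM] P1 _] pp Pp Pa; apply/negPn/negP; rewrite -prime_coprime // => cop.
case: P1; have [[u v] /= uv] := coprimeP _ (prime_gt0 pp) cop.
have -> : 1 = u%:R * p0%:R + (- v%:R) * a%:R :> algC.
  have uv1 : (u * p0 = 1 + v * a)%N by lia.
  by rewrite -natrM uv1 natrD natrM; ring.
apply: PD; apply: PM => //; first exact: rpred_nat.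
by rewrite rpredN rpred_nat.
Qed.

(** The last hypothesis denies that the discriminant and [p0] are comaximal, so some prime contains
    both. The multiplier left by [gain_span] is prime to [p0] and is removed by a Bezout relation
    with [p0 ^ r], which also lies in the ideal power. *)
Theorem disc_gain p0 s0 : prime p0 -> discriminant k N s0%:R -> ~~ (p0 %| s0 * l)%N ->
  ~ (exists x y, [/\ discriminant k K x, OO k y & x + p0%:R * y = 1]) ->
  exists q, [/\ maxid k q, q p0%:R & discriminant k K `<=` ipow k q (#|H| * l.-1)].
Proof.
move=> pp dN ndiv n1; have [fK KO] := disc_frid nk nK gr.
have [Kk K0 KD KM] := frid_omod fK.
pose J := [set z | exists x y, [/\ discriminant k K x, OO k y & z = x + p0%:R * y]].
have Op := OO_nat nk p0.
have JO : J `<=` OO k.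
  by move=> _ [x [y [dx Oy ->]]]; apply: (OOD nk); [apply: KO|apply: (OOM nk)].
have oJ : omod k J.
  split=> [z /JO[]//||z z' [x [y [dx Oy ->]]] [x' [y' [dx' Oy' ->]]]|a z Oa [x [y [dx Oy ->]]]].
  - by exists 0, 0; split; [|apply: (OO0 nk)|rewrite mulr0 addr0].
  - exists (x + x'), (y + y'); split; [exact: KD|exact: (OOD nk)|ring].
  - exists (a * x), (a * y); split; [exact: KM|exact: (OOM nk)|ring].
have Jp : J p0%:R by exists 0, 1; split; [|apply: (OO1 nk)|rewrite mulr1 add0r].
have p00 : p0%:R != 0 :> algC by rewrite pnatr_eq0 -lt0n prime_gt0.
have fJ := omod_frid nk oJ JO Jp p00.
have J1 : ~ J 1 by move=> [x [y [dx Oy E]]]; apply: n1; exists x, y.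
have [q0 mq0 Jq0] := maxid_exists nk fJ JO J1.
have [[oq0 q0O] _ q01 _] := mq0.
have iZ : idealZ (span_mul ZZ q0) by apply: idealZ_span => x /q0O[].
have [P pP q0P] : exists2 P, primeZ P & span_mul ZZ q0 `<=` P.
  apply: prime_exists => // h; apply: q01.
  by apply: (frid_contract nk (maxid_frid nk mq0)) => //; apply: (nf1 nk).
have JP x : J x -> P x.
  by move=> /Jq0 qx; apply: q0P; rewrite -[x]mul1r; apply: mem_span_mul => //; apply: rpred1.
have Pp : P p0%:R by apply: JP.
have dP : discriminant k K `<=` P.
  by move=> x dx; apply: JP; exists x, 0; split; [|apply: (OO0 nk)|rewrite mulr0 addr0].
have Pl : ~ P l%:R.
  by move=> /(primeZ_dvd pP pp Pp) h; move: ndiv; rewrite dvdn_mull.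
have Ps : ~ P s0%:R.
  by move=> /(primeZ_dvd pP pp Pp) h; move: ndiv; rewrite dvdn_mulr.
have mq := prime_contract nk pP (prime_gt0 pp) Pp.
have qp : (k `&` P) p0%:R by split=> //; apply: (nf_nat nk).
exists (k `&` P); split=> //.
set r := (#|H| * l.-1)%N.
have fq := frid_ipow r nk (maxid_frid nk mq); have [qk q0' qD qM] := frid_omod fq.
rewrite {1}/discriminant (basis_discriminantsE nk nK gr).
apply: span_mul_ind => // a _ Oa [b [Ob _ ->]]; apply: (qM) => //.
set d := _ ^+ 2; have Od : OO k d := OO_det2 nk nK gr Ob; have [kd _] := Od.
pose c := ((s0 * l) ^ r * l ^ #|G|)%N.
have qc : ipow k (k `&` P) r (c%:R * d).
  apply: (frid_contract nk fq); first by apply: (nfM nk) => //; apply: (nf_nat nk).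
  exact: (gain_span pP dP dN Pl Ps Ob).
have qpr : ipow k (k `&` P) r (p0%:R ^+ r).
  elim: (r) => [|r' IH]; first by rewrite expr0; apply: (OO1 nk).
  by rewrite exprS; apply: mem_span_mul.
have cop : coprime (p0 ^ r) c.
  rewrite coprimeXl // prime_coprime // /c Euclid_dvdM //.
  apply/negP => /orP[]; rewrite Euclid_dvdX // => /andP[h _]; first by rewrite h in ndiv.
  by rewrite dvdn_mull in ndiv.
have [|[u v] /= uv] := coprimeP _ _ cop; first by rewrite expn_gt0 prime_gt0.
have uv1 : (u * p0 ^ r = 1 + v * c)%N by lia.
have -> : d = (u%:R * d) * p0%:R ^+ r + (- v%:R) * (c%:R * d).
  rewrite -natrX; transitivity (((u * p0 ^ r)%:R - (v * c)%:R) * d); last by rewrite !natrM; ring.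
  by rewrite uv1 natrD; ring.
apply: qD; apply: (qM) => //; first by apply: (OOM nk) => //; apply: (OO_nat nk).
by apply: (OON nk); apply: (OO_nat nk).
Qed.

End Gain.

Section DiscIndex.
Variables (m n n' : nat) (k K N : set algC) (G H : finGroupType) (phi : algCaut -> G).
Variable p : {morphism [set: G]%SET >-> H}.
Variables (l : nat) (zeta : algC) (ex : G -> nat).
Hypotheses (nk : number_field m k) (nK : number_field n K) (nN : number_field n' N).
Hypotheses (gr : galrep k K phi) (grN : galrep k N (p \o phi)).
Hypotheses (l_prime : prime l) (zP : l.-primitive_root zeta) (cc : central_chr p l zeta ex).

Lemma coprime_comax I J a b : omod k I -> omod k J -> I a%:R -> J b%:R ->
  (0 < a)%N -> coprime a b -> comax I J.
Proof.
move=> [_ _ _ IM] [_ _ _ JM] Ia Jb a0 cop; have [[u v] /= uv] := coprimeP _ a0 cop.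
exists (u%:R * a%:R), (- v%:R * b%:R); split.
- by apply: IM => //; apply: (OO_nat nk).
- by apply: JM => //; apply: (OON nk); apply: (OO_nat nk).
have uv1 : (u * a = 1 + v * b)%N by lia.
by rewrite -natrM uv1 natrD natrM; ring.
Qed.

Lemma comax_eq I J : omod k J -> comax I J -> I = J -> J 1.
Proof. by move=> [_ _ JD _] [x [y [Ix Jy <-]]] IJ; apply: JD => //; rewrite -IJ. Qed.

(** The tower contribution and the prime powers for the various [q] are pairwise comaximal, so the
    discriminant lies in their product, whose index is multiplicative. *)
Lemma disc_index_gain DK DN ps : idx (OO k) (discriminant k K) DK ->
  idx (OO k) (discriminant k N) DN -> uniq ps ->
  (forall q, q \in ps -> [/\ prime q, ~~ (q %| DN * l)%N &
     ~ (exists x y, [/\ discriminant k K x, OO k y & x + q%:R * y = 1])]) ->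
  (DN ^ l * (\prod_(q <- ps) q) ^ (#|H| * l.-1) <= DK)%N.
Proof.
move=> iK iN ups psP; set r := (#|H| * l.-1)%N.
have r0 : (0 < r)%N by rewrite muln_gt0 -subn1 subn_gt0 prime_gt1 // -cardsT cardG_gt0.
have [fN NO] := disc_frid nk nN grN; have [fK KO] := disc_frid nk nK gr.
have oO := omod_OO nk.
have DN0 : (0 < DN)%N := idx_gt0 oO iN.
have NDN : discriminant k N DN%:R.
  have := idx_mem nk oO (frid_omod fN) NO iN (OO1 nk).
  by rewrite mulr1.
have exq q : exists Q, q \in ps -> [/\ maxid k Q, Q q%:R & discriminant k K `<=` ipow k Q r].
  have [qps|] := boolP (q \in ps); last by exists set0.
  have [qp qd q1] := psP q qps.
  by have [Q QP] := disc_gain nk nK nN gr grN l_prime zP cc qp NDN qd q1; exists Q.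
have [Q QP] := choice exq.
pose X0 := ipow k (discriminant k N) l; pose F q := ipow k (Q q) r.
have FO q : q \in ps -> frid k (F q) /\ F q `<=` OO k.
  move=> /QP[mq _ _]; split; first exact: (frid_ipow _ nk (maxid_frid nk mq)).
  by apply: (ipow_subOO nk); case: mq => [[]].
have F1 q : q \in ps -> ~ F q 1.
  move=> /QP[mq _ _]; rewrite /F -(prednK r0) /= => F1; have [[oq qO] _ q1 _] := mq.
  apply: q1; apply: (span_subr oq _ F1); apply: (ipow_subOO nk qO).
have X0P : frid k X0 /\ X0 `<=` OO k.
  by split; [exact: (frid_ipow _ nk)|exact: (ipow_subOO nk)].
have X0F q : q \in ps -> comax X0 (F q).
  move=> qps; have [mq qq _] := QP q qps; have [pq qd _] := psP q qps.
  have [[oq qO] _ _ _] := mq.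
  apply: (comax_ipow nk) => //; first exact: frid_omod (FO q qps).1.
    exact: (FO q qps).2.
  apply: comax_sym; apply: (comax_ipow nk) => //; first exact: frid_omod.
  apply: (coprime_comax oq (frid_omod fN) qq NDN (prime_gt0 pq)).
  by rewrite prime_coprime //; apply: contra qd => /dvdn_mulr ->.
have FF q q' : q \in ps -> q' \in ps -> q != q' -> comax (F q) (F q').
  move=> qps q'ps qq'; have [mq qq _] := QP q qps; have [pq _ _] := psP q qps.
  have [mq' qq1 _] := QP q' q'ps; have [pq' _ _] := psP q' q'ps.
  have [[oq qO] _ _ _] := mq; have [[oq' qO'] _ _ _] := mq'.
  apply: (comax_ipow nk) => //; first exact: frid_omod (FO q' q'ps).1.
    exact: (FO q' q'ps).2.
  apply: comax_sym; apply: (comax_ipow nk) => //.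
  apply: (coprime_comax oq' oq qq1 qq (prime_gt0 pq')).
  by rewrite prime_coprime // dvdn_prime2 // eq_sym.
have sub : discriminant k K `<=` iprod k (X0 :: [seq F q | q <- ps]).
  apply: (iprod_comax nk (frid_omod fK) KO).
  - rewrite /= map_inj_in_uniq ?ups ?andbT.
      apply/mapP => -[q qps E]; apply: (F1 q qps).
      exact: (comax_eq (frid_omod (FO q qps).1) (X0F q qps) E).
    move=> q q' qps q'ps E; apply/eqP; apply: contraT => qq'.
    by case: (F1 q' q'ps); apply: (comax_eq (frid_omod (FO q' q'ps).1) (FF q q' qps q'ps qq') E).
  - move=> P; rewrite inE => /predU1P[->|/mapP[q qps ->]].
      have [_ cA _ _ _] := cc; case: X0P => h1 h2; split=> //.
      by rewrite /X0 -cA; apply: (disc_tower nk nK nN gr grN).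
    by have [h1 h2] := FO q qps; split=> //; have [] := QP q qps.
  move=> P P'; rewrite !inE => /predU1P[->|/mapP[q qps ->]] /predU1P[->|/mapP[q' q'ps ->]] // ne.
  - exact: X0F.
  - by apply/comax_sym/X0F.
  by apply: FF => //; apply/eqP => E; apply: ne; rewrite E.
have [M [iM Mge fM MO]] : exists M, [/\ idx (OO k) (iprod k [seq F q | q <- ps]) M,
    ((\prod_(q <- ps) q) ^ r <= M)%N, frid k (iprod k [seq F q | q <- ps])
    & iprod k [seq F q | q <- ps] `<=` OO k].
  have : {subset ps <= ps} by [].
  elim: {1 3 4 5 6}ps => [_|q s IH sub1].
    rewrite /= big_nil exp1n; exists 1%N; split=> //; [exact: (idx_refl oO)|exact: (frid_OO nk)].
  have qps : q \in ps by apply: sub1; rewrite mem_head.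
  have [M [iM Mge fM MO]] := IH (fun x xs => sub1 x (mem_behead (s := q :: s) xs)).
  have [mq qq _] := QP q qps; have [pq _ _] := psP q qps; have [[oq qO] _ _ _] := mq.
  have fq := maxid_frid nk mq.
  have [Nq iNq] := idx_frid nk fq qO (A := OO k) (fun x h => h).
  have qNq := maxid_idx_ge nk mq pq qq iNq.
  have [fF OF] := FO q qps.
  exists (Nq ^ r * M)%N; split.
  - by apply: (idx_mulOO nk) => //; apply: (idx_ipow nk).
  - by rewrite big_cons expnMn leq_mul // leq_exp2r.
  - exact: (frid_mul nk).
  exact: (span_subOO nk).
have iX0 := idx_ipow nk l fN NO iN.
have [fX OX] := X0P.
have iZ := idx_mulOO nk fX fM OX MO iX0 iM.
have fZ := frid_mul nk fX fM.
have [M' M'le iM'] := idx_super nk (frid_omod fK) (frid_omod fZ) sub iK.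
apply: leq_trans M'le; rewrite (idx_unique nk (frid_omod fZ) iM' iZ).
by rewrite leq_mul2l Mge orbT.
Qed.

End DiscIndex.

(** * Fields with the same quotient *)

Section Fibre.
Variables (m n1 : nat) (k : set algC) (G H : finGroupType).
Variable p : {morphism [set: G]%SET >-> H}.
Variables (l : nat) (zeta : algC) (ex : G -> nat).
Hypotheses (nk : number_field m k) (nk1 : number_field n1 (adjoin k zeta)).
Hypotheses (l_prime : prime l) (zP : l.-primitive_root zeta) (cc : central_chr p l zeta ex).

Local Notation lam c := (zeta ^+ ex c).
Local Notation A := ('ker p)%g.
Local Notation k1 := (adjoin k zeta).

Lemma fixes_k1 s : fixes k1 s <-> fixes k s /\ s zeta = zeta.
Proof.
split=> [fs|[fs sz]]; last exact: fixes_adjoin.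
split; last by apply: fs; apply: adjoin_gen.
by move=> x kx; apply: fs; apply: adjoin_sub.
Qed.

Section Pair.
Variables (n n0 : nat) (K K0 : set algC) (phi phi0 : algCaut -> G).
Hypotheses (nK : number_field n K) (nK0 : number_field n0 K0).
Hypotheses (gr : galrep k K phi) (gr0 : galrep k K0 phi0).
Hypothesis (phiE : forall s, fixes k s -> p (phi s) = p (phi0 s)).

Let chi (d : G * G) := (d.1 * d.2^-1)%g.

Let chiA s : fixes k s -> chi (phi s, phi0 s) \in A.
Proof. by move=> fs; rewrite in_kerE -[chi _]/(phi s * (phi0 s)^-1)%g morphM ?inE // morphV ?inE // phiE // mulgV. Qed.

Let phiM s t : fixes k s -> fixes k t -> phi (acomp s t) = (phi s * phi t)%g.
Proof. by case: gr => _ h _ _ _; apply: h. Qed.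
Let phi0M s t : fixes k s -> fixes k t -> phi0 (acomp s t) = (phi0 s * phi0 t)%g.
Proof. by case: gr0 => _ h _ _ _; apply: h. Qed.

Let chiM s t : fixes k s -> fixes k t ->
  chi (phi (acomp s t), phi0 (acomp s t)) = (chi (phi s, phi0 s) * chi (phi t, phi0 t))%g.
Proof.
move=> fs ft; rewrite /chi /= phiM // phi0M // invMg.
have := chiA ft; rewrite /chi /= => cA.
by rewrite -!mulgA; congr (_ * _)%g; rewrite mulgA (chr_cent cc _ cA).
Qed.

(** The image of the automorphisms over [k(zeta)] in [G * G]; it plays the Galois group of the
    compositum of [K], [K0] and [k(zeta)], which is never constructed. *)
Let Delta : {set G * G} := [set d | `[< exists s, fixes k1 s /\ (phi s, phi0 s) = d >]]%SET.

Let rep_exists d : exists s, d \in Delta -> fixes k1 s /\ (phi s, phi0 s) = d.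
Proof.
have [|h] := boolP (d \in Delta); last by exists idfun.
by rewrite inE => /asboolP[s sP]; exists s.
Qed.
Let rep := projT1 (choice rep_exists).
Let repP d : d \in Delta -> fixes k1 (rep d) /\ (phi (rep d), phi0 (rep d)) = d.
Proof. by rewrite /rep; case: choice => f /= h; apply: h. Qed.

Let Delta_mem s : fixes k1 s -> (phi s, phi0 s) \in Delta.
Proof. by move=> fs; rewrite inE; apply/asboolP; exists s. Qed.

(** Replaces membership in the compositum: automorphisms over [k(zeta)] act on [x] through
    [Delta]. *)
Let adm (x : algC) := forall s t, fixes k1 s -> fixes k1 t -> phi s = phi t -> phi0 s = phi0 t -> s x = t x.

Let act s (d : G * G) : G * G := (phi s * d.1, phi0 s * d.2)%g.

Let act_inj s : injective (act s).
Proof. by move=> [a b] [c d] [/mulgI -> /mulgI ->]. Qed.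

Let act_rep s d : fixes k1 s -> d \in Delta -> act s d = (phi (acomp s (rep d)), phi0 (acomp s (rep d))).
Proof.
move=> fs dD; have [fr rE] := repP dD.
have [fks _] := iffLR (fixes_k1 s) fs; have [fkr _] := iffLR (fixes_k1 _) fr.
by rewrite phiM // phi0M // /act -{1 2}rE.
Qed.

Let act_Delta s d : fixes k1 s -> (act s d \in Delta) = (d \in Delta).
Proof.
move=> fs; have h d' s' : fixes k1 s' -> d' \in Delta -> act s' d' \in Delta.
  move=> fs' dD; have [fr rE] := repP dD; rewrite act_rep //.
  by apply: Delta_mem; apply: fixes_comp.
apply/idP/idP => dD; last exact: h.
have fi := fixes_inv fs; have := h _ _ fi dD.
suff -> : act (algC_invaut s) (act s d) = d by [].
have [fks _] := iffLR (fixes_k1 s) fs; have [fki _] := iffLR (fixes_k1 _) fi.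
have e1 : (phi (algC_invaut s) * phi s = 1)%g.
  rewrite -phiM //; case: gr => _ _ _ h1 _; apply/h1; first exact: fixes_comp.
  by move=> x _; rewrite acompE /= algC_autK.
have e2 : (phi0 (algC_invaut s) * phi0 s = 1)%g.
  rewrite -phi0M //; case: gr0 => _ _ _ h1 _; apply/h1; first exact: fixes_comp.
  by move=> x _; rewrite acompE /= algC_autK.
by case: d {dD} => a b; rewrite /act /= !mulgA e1 e2 !mul1g.
Qed.

Let sum_act s (F : G * G -> algC) : fixes k1 s ->
  \sum_(d in Delta) F d = \sum_(d in Delta) F (act s d).
Proof.
move=> fs; rewrite (reindex_inj (@act_inj s)) /=; apply: eq_bigl => d; exact: act_Delta.
Qed.

Let adm_act s d x : fixes k1 s -> d \in Delta -> adm x -> s (rep d x) = rep (act s d) x.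
Proof.
move=> fs dD ax; have [fr rE] := repP dD.
have aD : act s d \in Delta by rewrite act_Delta.
have [fr' rE'] := repP aD; have [e1 e2] := etrans rE' (act_rep fs dD).
by rewrite -acompE; apply: ax => //; apply: fixes_comp.
Qed.

Let chi_act s d : fixes k1 s -> d \in Delta -> chi (act s d) = (chi (phi s, phi0 s) * chi d)%g.
Proof.
move=> fs dD; have [fr rE] := repP dD; rewrite act_rep // -{3}rE.
have [fks _] := iffLR (fixes_k1 s) fs; have [fkr _] := iffLR (fixes_k1 _) fr.
exact: chiM.
Qed.

Let chiD d : d \in Delta -> chi d \in A.
Proof.
move=> dD; have [fr <-] := repP dD; apply: chiA; exact: (iffLR (fixes_k1 _) fr).1.
Qed.

(** The Lagrange resolvent of [x] for the character [lam \o chi]. *)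
Let twist x := \sum_(d in Delta) lam (chi d)^-1%g * rep d x.

Let twistE x s : adm x -> fixes k1 s -> s (twist x) = lam (chi (phi s, phi0 s)) * twist x.
Proof.
move=> ax fs; have [_ sz] := iffLR (fixes_k1 s) fs.
have sA := chiA (iffLR (fixes_k1 s) fs).1.
rewrite /twist [in RHS](sum_act _ fs) rmorph_sum mulr_sumr; apply: eq_bigr => d dD.
rewrite rmorphM rmorphXn /= sz adm_act // chi_act // mulrA; congr (_ * _).
have dA := chiD dD; rewrite -(chrM cc sA); last by rewrite groupV groupM.
by rewrite (invMg (chi (phi s, phi0 s))) (chr_cent cc _ sA) mulgKV.
Qed.

Let trace x := \sum_(d in Delta) rep d x.

Let traceE x : adm x -> k1 (trace x).
Proof.
move=> ax; apply: (number_field_fixed nk1) => s fs.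
rewrite /trace [RHS](sum_act _ fs) rmorph_sum; apply: eq_bigr => d dD.
exact: adm_act.
Qed.

Let one_Delta : (1, 1)%g \in Delta.
Proof.
rewrite inE; apply/asboolP; exists idfun; split; first by [].
by case: gr => _ _ _ h _; case: gr0 => _ _ _ h0 _; congr (_, _); [apply/h|apply/h0].
Qed.

Let K_fix s t x : fixes k s -> fixes k t -> phi s = phi t -> K x -> s x = t x.
Proof. by move=> fs ft E Kx; apply: (gal_agree gr) E _ Kx. Qed.
Let K0_fix s t x : fixes k s -> fixes k t -> phi0 s = phi0 t -> K0 x -> s x = t x.
Proof. by move=> fs ft E Kx; apply: (gal_agree gr0) E _ Kx. Qed.

(* Hilbert 90 for the cocycle [lam \o chi], with integrality controlled by
   Noether's different. *)
Lemma kummer_generator s s0 S M : discriminant k K s%:R -> discriminant k K0 s0%:R ->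
  (0 < s)%N -> (0 < s0)%N -> (0 < S)%N -> (s * s0 %| S ^ M)%N ->
  exists delta, [/\ delta != 0, selmer k1 l S (delta ^+ l) &
    forall s, fixes k1 s -> s delta = lam (phi s * (phi0 s)^-1)%g * delta].
Proof.
move=> dK dK0 s_gt0 s0_gt0 S_gt0 sS.
have [w [wP wE]] := disc_chr nk nK gr dK; have [w0 [w0P w0E]] := disc_chr nk nK0 gr0 dK0.
pose v := prod_system w w0.
have vA q : q \in v -> q.1 \in Aint /\ q.2 \in Aint.
  apply: prod_systemP => q' q'w; first by have [? []] := wP q' q'w.
  by have [? []] := w0P q' q'w.
have vadm q : q \in v -> adm q.2.
  move=> /allpairsP[[a b] [/= aw bw ->]] s1 t1 fs ft E E0 /=.
  have [_ [Ka _]] := wP a aw; have [_ [Kb _]] := w0P b bw.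
  have [fks _] := iffLR (fixes_k1 _) fs; have [fkt _] := iffLR (fixes_k1 _) ft.
  by rewrite !rmorphM /=; congr (_ * _); [apply: K_fix|apply: K0_fix].
have vE d : d \in Delta -> \sum_(q <- v) q.1 * rep d q.2 = if d == (1, 1)%g then (s * s0)%:R else 0.
  move=> dD; have [fr rE] := repP dD; have [fk _] := iffLR (fixes_k1 _) fr.
  rewrite prod_systemE wE // w0E // -[in RHS]rE -pair_eqE /= /pair_eq /=.
  by case: eqP => _; case: eqP => _; rewrite ?natrM ?mul0r ?mulr0.
have ss0 : (s * s0)%:R != 0 :> algC by rewrite pnatr_eq0 -lt0n muln_gt0 s_gt0.
have sumD (f : G * G -> algC) : \sum_(d in Delta) (if d == (1, 1)%g then f d else 0) = f (1, 1)%g.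
  rewrite (bigD1 (1, 1)%g) //= eqxx big1 ?addr0 // => d /andP[_ /negbTE ->] //.
have lam1 : lam (1 : G)%g = 1 := chr1 l_prime zP cc.
have tw : \sum_(q <- v) q.1 * twist q.2 = (s * s0)%:R.
  transitivity (\sum_(d in Delta) if d == (1, 1)%g then lam (chi d)^-1%g * (s * s0)%:R else 0).
    under eq_bigr do rewrite mulr_sumr.
    rewrite exchange_big /=; apply: eq_bigr => d dD.
    transitivity (lam (chi d)^-1%g * \sum_(q <- v) q.1 * rep d q.2).
      by rewrite mulr_sumr; apply: eq_bigr => q _; ring.
    by rewrite vE //; case: ifP => // _; rewrite mulr0.
  by rewrite sumD /chi /= !invg1 mulg1 invg1 lam1 mul1r.
have [q0 q0v q0n] : exists2 q, q \in v & twist q.2 != 0.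
  have : has (fun q => twist q.2 != 0) v; last by move=> /hasP.
  apply: contraT => /hasPn h; case/eqP: ss0; rewrite -tw big_seq big1 // => q qv.
  by have := h q qv; rewrite negbK => /eqP ->; rewrite mulr0.
set delta := twist q0.2 in q0n.
have dE s1 : fixes k1 s1 -> s1 delta = lam (phi s1 * (phi0 s1)^-1)%g * delta.
  by move=> fs; apply: twistE => //; apply: vadm.
exists delta; split=> //.
have lA c : lam c \in Aint by rewrite rpredX //; case: (Aint_zeta l_prime zP).
(* These traces generate an ideal [I] of [k(zeta)]. Extended to all algebraic integers, it lies
   inside the multiples of [delta] and contains [s * s0 * delta], so [delta ^+ l] generates the
   [l]-th power of [I] up to divisors of powers of [S]. *)
pose gen := [seq trace (delta * q.2) | q <- v].
have dadm q : q \in v -> adm (delta * q.2).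
  move=> qv s1 t1 fs ft E E0; rewrite !rmorphM /= !dE // E E0; congr (_ * _).
  exact: vadm.
have genk x : x \in gen -> k1 x.
  by move=> /mapP[q qv ->]; apply: traceE; apply: dadm.
have geni x : x \in gen -> exists2 y, y \in Aint & x = delta * y.
  move=> /mapP[q qv ->]; exists (\sum_(d in Delta) lam (chi d) * rep d q.2).
    by apply: rpred_sum => d _; rewrite rpredM // Aint_aut; case: (vA q qv).
  rewrite /trace mulr_sumr; apply: eq_bigr => d dD; have [fr rE] := repP dD.
  have cE : chi d = (phi (rep d) * (phi0 (rep d))^-1)%g by rewrite -{1}rE.
  by rewrite rmorphM /= dE // cE; ring.
have gsum : \sum_(q <- v) q.1 * trace (delta * q.2) = (s * s0)%:R * delta.
  transitivity (\sum_(d in Delta) if d == (1, 1)%g then rep d delta * (s * s0)%:R else 0).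
    under eq_bigr do rewrite mulr_sumr.
    rewrite exchange_big /=; apply: eq_bigr => d dD.
    transitivity (rep d delta * \sum_(q <- v) q.1 * rep d q.2).
      by rewrite mulr_sumr; apply: eq_bigr => q _; rewrite rmorphM /=; ring.
    by rewrite vE //; case: ifP => // _; rewrite mulr0.
  rewrite sumD mulrC; have [fr [r1 r2]] := repP one_Delta.
  by rewrite dE // r1 r2 invg1 mulg1 lam1 mul1r.
have gnz : has (fun x => x != 0) gen.
  apply: contraT => /hasPn h; case/eqP: ss0; apply: (mulIf q0n); rewrite mul0r -gsum.
  rewrite big_seq big1 // => q qv; have : trace (delta * q.2) \in gen by apply/mapP; exists q.
  by move=> /h; rewrite negbK => /eqP ->; rewrite mulr0.
pose I := span_mul (OO k1) [set` gen].
have fI : frid k1 I := frid_gen nk1 genk gnz.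
have oI := frid_omod fI.
have kd : k1 (delta ^+ l).
  apply: (number_field_fixed nk1) => s1 fs.
  by rewrite rmorphXn /= dE // exprMn (chr_ord _ zP) mul1r.
have Idelta r x : ipow k1 I r x -> exists2 y, y \in Aint & x = delta ^+ r * y.
  elim: r x => [|r IH] x; first by move=> [_ xA]; exists x; rewrite // mul1r.
  apply: (@span_mul_ind _ _ [set x | exists2 y, y \in Aint & x = delta ^+ r.+1 * y]) => /=.
  - by exists 0; rewrite ?rpred0 ?mulr0.
  - by move=> a b [a' aA ->] [b' bA ->]; exists (a' + b'); rewrite ?rpredD ?mulrDr.
  move=> a b Ia /IH[b' bA ->].
  have [a' aA ->] : exists2 y, y \in Aint & a = delta * y.
    move: a Ia; apply: (@span_mul_ind _ _ [set a | exists2 y, y \in Aint & a = delta * y]) => /=.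
    - by exists 0; rewrite ?rpred0 ?mulr0.
    - by move=> a c [a' aA ->] [c' cA ->]; exists (a' + c'); rewrite ?rpredD ?mulrDr.
    move=> a c [_ aA] /geni[y yA ->]; exists (a * y); first exact: rpredM.
    by ring.
  by exists (a' * b'); rewrite ?rpredM // exprS; ring.
split=> //; first by rewrite expf_neq0.
exists I; split=> //.
  move=> x Ix; have [y yA xE] := Idelta l x Ix; exists y => //; split=> //.
  have [Ik _ _ _] := omod_ipow l nk1 (let: And4 h _ _ _ := oI in h).
  have -> : y = x / delta ^+ l by rewrite xE mulrAC divff ?mul1r // expf_neq0.
  by apply: (nfM nk1); [apply: Ik|apply: (nfV nk1)].
have sd : span_mul ZZ I ((s * s0)%:R * delta).
  rewrite -gsum big_seq; apply: span_mul_sum => q qv; apply: mem_span_mul.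
    by case: (vA q qv).
  rewrite -[trace _]mul1r; apply: mem_span_mul; first exact: (OO1 nk1).
  by apply/mapP; exists q.
have sdl : span_mul ZZ (ipow k1 I l) (((s * s0)%:R * delta) ^+ l).
  have := span_prod nk1 (B := (predT : pred 'I_l)) (z := fun=> 1) (c := (s * s0)%:R * delta) (q := I).
  have -> : #|(predT : pred 'I_l)| = l by rewrite -[RHS]card_ord.
  rewrite big1 // !mulr1; apply=> [_|_ _]; [exact: rpred1|exact: sd].
have kss (a : nat) : k1 a%:R := nf_nat nk1 a.
have fIl := frid_ipow l nk1 fI; have [_ _ _ Il] := frid_omod fIl.
exists (l * M)%N.
have [q qE] := dvdnP sS.
have -> : S%:R ^+ (l * M) * delta ^+ l = q%:R ^+ l * ((s * s0)%:R * delta) ^+ l.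
  by rewrite -exprMn mulrA -natrM -qE natrX exprMn -exprM mulnC.
apply: Il; first by apply: (OOX nk1); apply: (OO_nat nk1).
apply: (frid_contract nk1 fIl) => //.
by rewrite exprMn; apply: (nfM nk1) => //; apply: (nfX nk1).
Qed.

End Pair.

Lemma galrep_field_eq n n' K K' (phi phi' : algCaut -> G) :
  number_field n K -> number_field n' K' -> galrep k K phi -> galrep k K' phi' ->
  (forall s, fixes k s -> phi s = phi' s) -> K = K'.
Proof.
have sub n2 n3 L L' psi psi' : number_field n2 L -> number_field n3 L' ->
  galrep k L psi -> galrep k L' psi' -> (forall s, fixes k s -> psi s = psi' s) -> L `<=` L'.
  move=> nL nL' gL gL' E x Lx; apply: (number_field_fixed nL') => s fs.
  have [kL' _ _ h' _] := gL'; have [_ _ _ h _] := gL.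
  have fk := fixesW kL' fs.
  by apply: (iffLR (h s fk)) => //; rewrite E //; apply/h'.
move=> nK nK' gK gK' E; apply/seteqP; split.
  exact: (sub _ n n' K K' phi phi').
by apply: (sub _ n' n K' K phi' phi) => // s fs; rewrite E.
Qed.

(* [s ^ (l - 1)] fixes [zeta], and the difference of the two maps takes values
   in a group of order [l]. *)
Lemma galrep_agree K K' (phi phi' : algCaut -> G) : galrep k K phi -> galrep k K' phi' ->
  (forall s, fixes k s -> p (phi s) = p (phi' s)) ->
  (forall s, fixes k1 s -> phi s = phi' s) -> forall s, fixes k s -> phi s = phi' s.
Proof.
move=> gr gr' pE E s fs.
pose it j : algCaut := iter j (acomp s) idfun.
have itf j : fixes k (it j) by elim: j => [|j IH] //=; apply: fixes_comp.
have itE L psi : galrep k L psi -> forall j, psi (it j) = (psi s ^+ j)%g.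
  move=> [_ pM _ p1 _]; elim=> [|j IH]; first by rewrite expg0; apply/p1.
  by rewrite /= pM // IH expgS.
have [a sz la] := root_zetaX l_prime zP s.
have itz j : it j zeta = zeta ^+ (a ^ j).
  elim: j => [|j IH]; first by rewrite expn0 expr1.
  by rewrite /= IH rmorphXn /= sz -exprM expnS.
have fl : fixes k1 (it l.-1).
  apply/fixes_k1; split=> //; apply: (fmorph_inj s).
  have -> : s (it l.-1 zeta) = it l zeta by rewrite -{2}(prednK (prime_gt0 l_prime)).
  rewrite itz sz; apply/eqP; rewrite (eq_prim_root_expr zP).
  by apply/eqP; apply: fermat_little.
have := E _ fl; rewrite !(itE _ _ _ gr) !(itE _ _ _ gr') => El.
pose c := ((phi' s)^-1 * phi s)%g.
have cA : c \in A by rewrite in_kerE morphM ?inE // morphV ?inE // pE // mulVg.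
have phiE : phi s = (phi' s * c)%g by rewrite mulKVg.
have c1 : (c ^+ l.-1 = 1)%g.
  move: El; rewrite phiE expgMn; last by rewrite /commute (chr_cent cc _ cA).
  by rewrite -{2}[(phi' s ^+ l.-1)%g]mulg1 => /mulgI.
have cl : (c ^+ l = 1)%g by have [_ <- _ _ _] := cc; apply: expg_cardG.
have : c = 1%g by move: cl; rewrite -{1}(prednK (prime_gt0 l_prime)) expgS c1 mulg1.
by move=> c1'; rewrite phiE c1' mulg1.
Qed.

Definition fibre (psi : algCaut -> H) (S : nat) (K : set algC) : Prop :=
  exists n (phi : algCaut -> G) s M,
    [/\ number_field n K, galrep k K phi, forall t, fixes k t -> p (phi t) = psi t,
        discriminant k K s%:R & (0 < s)%N /\ (s %| S ^ M)%N].

(** All fields are compared with the first one. If two of the classes [delta ^+ l] agree modulo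
    [l]-th powers, the corresponding maps to [G] agree over [k(zeta)], hence over [k], and the
    fields coincide. *)
Lemma fibre_bound (Q : finGroupType) :
  (forall (S : nat) (gs : seq algC), (0 < S)%N -> uniq gs ->
    (forall g, g \in gs -> selmer k1 l S g) ->
    (forall g g' a, g \in gs -> g' \in gs -> k1 a -> g = g' * a ^+ l -> g = g') ->
    (size gs <= l ^ (n1 * size (primes S)) * (#|Q| * l ^ n1.+1))%N) ->
  forall psi S Ks, (0 < S)%N -> uniq Ks -> (forall K, K \in Ks -> fibre psi S K) ->
  (size Ks <= l ^ (n1 * size (primes S)) * (#|Q| * l ^ n1.+1))%N.
Proof.
move=> bound psi S [//|K0 Ks] S_gt0 uKs KsP; set Ks' := K0 :: Ks.
have [n0 [phi0 [s0 [M0 [nK0 gr0 pE0 dK0 [s00 sS0]]]]]] := KsP K0 (mem_head _ _).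
pose good K (phi : algCaut -> G) delta := [/\ exists n, number_field n K, galrep k K phi,
  forall t, fixes k t -> p (phi t) = psi t, delta != 0 &
  selmer k1 l S (delta ^+ l) /\
  forall s, fixes k1 s -> s delta = lam (phi s * (phi0 s)^-1)%g * delta].
have ex1 K : exists pd : (algCaut -> G) * algC, K \in Ks' -> good K pd.1 pd.2.
  have [KKs|] := boolP (K \in Ks'); last by exists ((fun=> 1%g), 0).
  have [n [phi [s [M [nK gr pE dK [s_gt0 sS]]]]]] := KsP K KKs.
  have sSS : (s * s0 %| S ^ (M + M0))%N by rewrite expnD dvdn_mul.
  have pEE t : fixes k t -> p (phi t) = p (phi0 t) by move=> ft; rewrite pE // pE0.
  have [delta [d0 sel dE]] := kummer_generator nK nK0 gr gr0 pEE dK dK0 s_gt0 s00 S_gt0 sSS.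
  by exists (phi, delta); split=> //; exists n.
have [pd pdP] := choice ex1.
have key K K' a : K \in Ks' -> K' \in Ks' -> k1 a ->
    (pd K).2 ^+ l = (pd K').2 ^+ l * a ^+ l -> K = K'.
  move=> KKs K'Ks ka E; have [[n nK] gr pE d0 [_ dE]] := pdP K KKs.
  have [[n' nK'] gr' pE' d0' [_ dE']] := pdP K' K'Ks.
  apply: (galrep_field_eq nK nK' gr gr'); apply: (galrep_agree gr gr') => s fs.
    by rewrite pE // pE'.
  have [fk sz] := iffLR (fixes_k1 s) fs.
  have a0 : (pd K').2 * a != 0.
    have : (pd K').2 ^+ l * a ^+ l != 0 by rewrite -E expf_neq0.
    by rewrite -exprMn; apply: contraNneq => ->; rewrite expr0n; case: (l) l_prime.
  have : ((pd K).2 / ((pd K').2 * a)) ^+ l = 1.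
    by rewrite expr_div_n exprMn -E divff // expf_neq0.
  move=> /(prim_rootP zP)[i /(canRL (divfK a0)) dKE].
  have : lam ((pd K).1 s * (phi0 s)^-1)%g * (pd K).2 = lam ((pd K').1 s * (phi0 s)^-1)%g * (pd K).2.
    rewrite -dE // {1}dKE !rmorphM rmorphXn /= sz dE' // (fs a) // dKE; ring.
  move=> /(mulIf d0) /(chr_inj l_prime zP cc) h.
  apply: (mulIg (phi0 s)^-1)%g; apply: h.
    by rewrite in_kerE morphM ?inE // morphV ?inE // pE // pE0 // mulgV.
  by rewrite in_kerE morphM ?inE // morphV ?inE // pE' // pE0 // mulgV.
rewrite -(size_map (fun K => (pd K).2 ^+ l) Ks').
apply: bound => //.
- rewrite map_inj_in_uniq // => K K' KKs K'Ks E.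
  by apply: (key K K' 1) => //; [apply: (nf1 nk1)|rewrite expr1n mulr1].
- by move=> _ /mapP[K KKs ->]; have [_ _ _ _ []] := pdP K KKs.
move=> _ _ a /mapP[K KKs ->] /mapP[K' K'Ks ->] ka E.
by rewrite (key K K' a).
Qed.

End Fibre.

(** * Counting *)

(** An infinite set contains lists longer than [B], so a bound on all lists also proves
    finiteness. *)
Lemma counting_le (R : realType) (T : choiceType) (X : set T) (B : R) :
  (forall s : seq T, uniq s -> (forall x, x \in s -> X x) -> (size s)%:R <= B) ->
  (counting X <= B%:E)%E.
Proof.
move=> h; rewrite /counting; case: asboolP => [fX|iX].
  rewrite lee_fin; apply: h => [|x]; first exact: finmap.fset_uniq.
  by move=> xs; rewrite -[X]fset_setK.
have [s sX] := infinite_set_fset (Num.truncn B).+1 iX.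
have := h _ (finmap.fset_uniq s) (fun x xs => sX x xs) => hB hs.
have : (Num.truncn B).+1%:R <= B by apply: le_trans hB; rewrite ler_nat.
by rewrite leNgt truncnS_gt.
Qed.

Lemma counting_ge (R : realType) (T : choiceType) (X : set T) (s : seq T) :
  uniq s -> (forall x, x \in s -> X x) -> ((size s)%:R%:E <= counting (R := R) X)%E.
Proof.
move=> us sX; rewrite /counting; case: asboolP => [fX|_]; last by rewrite leey.
rewrite lee_fin ler_nat; apply: uniq_leq_size => // x /sX Xx.
by rewrite in_fset_set // inE.
Qed.

Lemma ideal_normE (R : realType) n k I N : number_field n k -> omod k I ->
  idx (OO k) I N -> ideal_norm R k I = (N%:R)%:E.
Proof.
move=> nk oI [s [us sO sinj sall] <-].
have [Ik I0 ID IM] := oI.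
pose f (x : algC) : set algC := [set x + y | y in I].
have fE x y : f x = f y <-> I (x - y).
  split=> [E|Ixy].
    have : f x x by exists 0; rewrite // addr0.
    by rewrite E => -[z Iz <-]; rewrite addrC addKr.
  apply/seteqP; split=> _ [z Iz <-].
    by exists (x - y + z); [apply: ID|ring].
  exists (z - (x - y)); last by ring.
  exact: (omodB nk oI).
have ufs : uniq [seq f x | x <- s].
  by rewrite map_inj_in_uniq // => x y xs ys /fE; apply: sinj.
have E : [set f x | x in OO k] = [set` [seq f x | x <- s]].
  apply/seteqP; split=> [_ [x Ox <-]|c /= /mapP[x xs ->]].
    have [y ys Ixy] := sall x Ox; apply/mapP; exists y => //; exact/fE.
  by exists x => //; apply: sO.
rewrite /ideal_norm -/f E; apply/eqP; rewrite eq_le; apply/andP; split.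
  apply: counting_le => s' us' s's; rewrite ler_nat -(size_map f s).
  by apply: uniq_leq_size => // x /s's.
by rewrite -(size_map f s); apply: counting_ge.
Qed.

Lemma bigmin_le (T : eqType) (r : seq T) (P : pred T) (F : T -> nat) n j :
  j \in r -> P j -> (\big[minn/n]_(i <- r | P i) F i <= F j)%N.
Proof.
move=> jr Pj; elim: r jr => // i r IH; rewrite inE big_cons => /predU1P[<-|/IH h].
  by rewrite Pj geq_minl.
by case: ifP => // _; apply: leq_trans h; apply: geq_minr.
Qed.

(** * The invariant [a] of the regular representation *)

Section Regular.
Variables (R : realType) (G : finGroupType).

Lemma regular_porbit (g x : G) : porbit (actperm 'R g) x = lcoset <[g]>%g x.
Proof.
have actX i : (actperm 'R g ^+ i)%g = actperm 'R (g ^+ i)%g.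
  by rewrite morphX ?inE.
rewrite lcosetE; apply/setP => y; apply/porbitP/lcosetP => [[i ->]|[_ /cycleP[i ->] ->]].
  by exists (g ^+ i)%g; rewrite ?mem_cycle // actX actpermE.
by exists i; rewrite actX actpermE.
Qed.

(** The orbits of [g] are the left cosets of the cyclic group it generates. *)
Lemma regular_ind (g : G) : (perm_ind (actperm 'R g) * #[g]%g = #|G| * #[g]%g.-1)%N.
Proof.
rewrite /perm_ind; have -> : #|porbits (actperm 'R g)| = #|[set: G]%SET : <[g]>|%g.
  rewrite -card_lcosets; congr #|pred_of_set _|; apply/setP => X.
  by apply/imsetP/imsetP => -[x _ ->]; exists x; rewrite ?inE ?regular_porbit.
have := Lagrange (finset.subsetT <[g]>%G); rewrite cardsT => E.
rewrite mulnBl; have -> : (#|[set: G]%SET : <[g]>|%g * #[g]%g = #|G|)%N by rewrite mulnC.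
by rewrite -[in RHS]subn1 mulnBr muln1.
Qed.

Lemma regular_a_ge (l : nat) (g : G) : (1 < l)%N -> #[g]%g = l -> 
  ((#|G| * l.-1) %/ l)%:R^-1 <= regular_a R G.
Proof.
move=> l1 ol; set h := (_ %/ l)%N.
have l0 : (0 < l)%N by apply: ltnW.
have lG : (l %| #|G|)%N by rewrite -cardsT -ol order_dvdG ?inE.
pose s := actperm 'R g.
have sh : perm_ind s = h.
  rewrite /h; apply/eqP; rewrite eqn_div //; last by rewrite dvdn_mulr.
  by rewrite -{1 2}ol regular_ind.
have sA : s \in (actperm 'R @* [set: G]%SET)%g by rewrite mem_morphim ?inE.
have s1 : s != 1%g.
  apply/eqP => /(congr1 (fun t : {perm G} => t 1%g)); rewrite actpermE perm1 /= mul1g => g1.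
  by move: ol; rewrite g1 order1 => E; rewrite -E in l1.
rewrite /regular_a /perm_a ifF; last first.
  by apply/negP => /eqP E; move: sA s1; rewrite E inE => ->.
set mn := \big[minn/_]_(_ in _) _.
have mnle : (mn <= h)%N.
  rewrite -sh; apply: bigmin_le; rewrite ?mem_index_enum // 2!inE s1; exact: sA.
have mn0 : (0 < mn)%N.
  rewrite /mn; elim/big_ind: _ => [|a b a0 b0|t].
  - by rewrite -cardsT cardG_gt0.
  - by rewrite leq_min a0.
  rewrite 2!inE => /andP[t1 /morphimP[g' _ _ tE]].
  have g'1 : g' != 1%g by apply: contra t1 => /eqP g'1; rewrite tE g'1 morph1.
  have := regular_ind g'; rewrite -tE; case: (perm_ind t) => // /esym/eqP.
  rewrite mul0n muln_eq0 -cardsT -[_ == 0%N]negbK -lt0n cardG_gt0 /=.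
  by rewrite -subn1 subn_eq0 leqNgt order_gt1 g'1.
by rewrite lef_pV2 ?posrE ?ltr0n ?ler_nat // (leq_trans mn0).
Qed.

(** Every nontrivial element has order at least [l], because its order has a prime factor dividing
    the group order; the index grows with the order. *)
Lemma regular_a_le (l : nat) : (1 < l)%N ->
  (forall p, prime p -> (p < l)%N -> ~~ (p %| #|G|)%N) ->
  regular_a R G <= l%:R * (#|G| * l.-1)%:R^-1.
Proof.
move=> l1 Gp; have l0 : (0 < l)%N by apply: ltnW.
have G0 : (0 < #|G|)%N by rewrite -cardsT cardG_gt0.
have lp : (0 < l.-1)%N by rewrite -subn1 subn_gt0.
rewrite /regular_a /perm_a; case: ifP => [_|_]; first by rewrite mulr_ge0.
set mn := \big[minn/_]_(_ in _) _.
have h : (#|G| * l.-1 <= l * mn)%N.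
  rewrite /mn; elim/big_ind: _ => [|a b ha hb|t].
  - by rewrite mulnC leq_mul2r leq_pred orbT.
  - by rewrite minnMr leq_min ha.
  rewrite 2!inE => /andP[t1 /morphimP[g' _ _ tE]].
  have g'1 : (1 < #[g']%g)%N.
    by rewrite order_gt1; apply: contra t1 => /eqP g'1; rewrite tE g'1 morph1.
  have lo : (l <= #[g']%g)%N.
    rewrite leqNgt; apply/negP => ol.
    have := Gp _ (pdiv_prime g'1) (leq_ltn_trans (pdiv_leq (ltnW g'1)) ol).
    by rewrite (dvdn_trans (pdiv_dvd _)) // -cardsT order_dvdG ?inE.
  rewrite -(leq_pmul2r (ltnW g'1)) -!mulnA [(perm_ind t * _)%N](_ : _ = #|G| * #[g']%g.-1)%N; last by rewrite tE regular_ind.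
  rewrite [X in (_ <= X)%N]mulnCA leq_mul2l; apply/orP; right.
  by rewrite -!subn1 mulnBl mulnBr mul1n muln1 leq_sub2l.
have mn0 : (0 < mn)%N.
  by have : (0 < l * mn)%N by [apply: leq_trans h; rewrite muln_gt0 G0]; rewrite muln_gt0 => /andP[].
rewrite ler_pdivlMr ?ltr0n ?muln_gt0 ?G0 // mulrC ler_pdivrMr ?ltr0n //.
by rewrite -natrM ler_nat.
Qed.

End Regular.

Lemma central_chr_exists (G H : finGroupType) (l : nat) (zeta : algC) :
  prime l -> l.-primitive_root zeta -> central_extension 'Z_l G H ->
  exists (p : {morphism [set: G]%SET >-> H}) (ex : G -> nat),
    central_chr p l zeta ex /\ (p @* [set: G]%SET = [set: H]%SET)%g.
Proof.
move=> l_prime zP [i [p [iinj iker psurj icent]]].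
have lE : (Zp_trunc l).+2 = l := Zp_cast (prime_gt1 l_prime).
pose ex (g : G) : nat := if g \in ('ker p)%g then nat_of_ord (invm iinj g : 'I_(Zp_trunc l).+2) else 0%N.
have inA c : c \in ('ker p)%g -> exists2 x : 'Z_l, c = i x & ex c = x.
  move=> cA; have := cA; rewrite -iker => /morphimP[x _ _ cE]; exists x => //.
  by rewrite /ex cA cE invmE ?inE.
have iA x : i x \in ('ker p)%g by rewrite -iker mem_morphim ?inE.
exists p, ex; split=> //; split.
- by rewrite -iker.
- by rewrite -iker card_injm // cardsT card_ord lE.
- move=> c; rewrite /ex; case: ifP => _; last exact: prime_gt0.
  by rewrite -[X in (_ < X)%N]lE ltn_ord.
- move=> c d cA dA; have [x cE exc] := inA c cA; have [y dE exd] := inA d dA.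
  have cdA : (c * d)%g \in ('ker p)%g by rewrite groupM.
  have [z zE exz] := inA _ cdA.
  have {}zE : z = (x * y)%g.
    by apply: (injmP iinj); rewrite ?inE // -zE cE dE morphM ?inE.
  rewrite exz exc exd zE -exprD /= -[RHS](prim_expr_mod zP); congr (_ ^+ _).
  by congr (_ %% _)%N; exact: lE.
move=> c cA; have [x cE exc] := inA c cA; rewrite exc => /eqP.
rewrite -(prim_order_dvd zP) => h; have x0 : (x : nat) = 0%N.
  have xl : (x < l)%N by rewrite -[X in (_ < X)%N]lE ltn_ord.
  by apply/eqP; apply: contraT; rewrite -lt0n => x0; have := dvdn_leq x0 h; rewrite leqNgt xl.
have x1 : x = 1%g by apply: ord_inj.
by rewrite cE x1; exact: morph1.
Qed.

Lemma dvdn_primes_exp s T : (0 < s)%N ->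
  (forall q, prime q -> (q %| s)%N -> (q %| T)%N) -> (s %| T ^ s)%N.
Proof.
elim/ltn_ind: s => s IH s0 h; have [s1|s1] := leqP s 1.
  by have -> : s = 1%N by [apply/eqP; rewrite eqn_leq s1]; rewrite dvd1n.
have qp := pdiv_prime s1; set q := pdiv s in qp; have [t tE] := dvdnP (pdiv_dvd s).
rewrite -/q in tE; have t0 : (0 < t)%N by move: s0; rewrite tE muln_gt0 => /andP[].
have ts : (t < s)%N by rewrite tE -{1}[t]muln1 ltn_pmul2l // prime_gt1.
have tT : (t %| T ^ t)%N.
  by apply: IH => // r rp rt; apply: h => //; rewrite tE dvdn_mulr.
have qT : (q %| T)%N by apply: h => //; apply: pdiv_dvd.
apply: (@dvdn_trans (T ^ t.+1)); last exact: dvdn_exp2l.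
by rewrite tE expnSr dvdn_mul.
Qed.

Lemma prod_primes_dvd (ps : seq nat) S : uniq ps ->
  (forall q, q \in ps -> prime q /\ (q %| S)%N) -> (\prod_(q <- ps) q %| S)%N.
Proof.
elim: ps => [|q ps IH]; first by rewrite big_nil dvd1n.
move=> /= /andP[qps ups] h; have [qp qS] := h q (mem_head _ _).
rewrite big_cons Gauss_dvd ?qS; first by apply: IH => // r rps; apply: h; rewrite inE rps orbT.
have : forall r, r \in ps -> prime r by move=> r rps; case: (h r); rewrite // inE rps orbT.
elim: ps qps {IH ups h} => [|r ps IH]; first by rewrite big_nil coprimen1.
rewrite inE negb_or big_cons => /andP[qr qps] h; rewrite coprimeMr IH //; last first.
  by move=> t tps; apply: h; rewrite inE tps orbT.
by rewrite andbT prime_coprime // dvdn_prime2 //; apply: h; apply: mem_head.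
Qed.

Section Counting.
Variables (m n1 : nat) (k : set algC) (G H : finGroupType).
Variable p : {morphism [set: G]%SET >-> H}.
Variables (l : nat) (zeta : algC) (ex : G -> nat).
Hypotheses (nk : number_field m k) (nk1 : number_field n1 (adjoin k zeta)).
Hypotheses (l_prime : prime l) (zP : l.-primitive_root zeta) (cc : central_chr p l zeta ex).
Hypothesis psurj : (p @* [set: G]%SET = [set: H]%SET)%g.

(** [s] is the least positive integer in the discriminant and [r] the product of its primes not
    dividing [DN * l]. *)
Lemma extension_data K DK : galois_extension k K G -> idx (OO k) (discriminant k K) DK ->
  exists (phi : algCaut -> G) N DN s r,
  [/\ (exists n, number_field n K) /\ (exists n, number_field n N),
      galrep k K phi, galrep k N (p \o phi), galois_extension k N H &
  [/\ idx (OO k) (discriminant k N) DN, discriminant k K s%:R,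
      (0 < s)%N /\ (s %| (l * DN * r) ^ s)%N, (0 < DN)%N /\ (0 < r)%N
    & (DN ^ l * r ^ (#|H| * l.-1) <= DK)%N]].
Proof.
move=> gK iK; have [phi [N [gr gN grN [[n nK] [n' nN]]]]] := galois_extension_quotient gK psurj.
have [fK KO] := disc_frid nk nK gr; have [fN NO] := disc_frid nk nN grN.
have [DN iN] := idx_frid nk fN NO (A := OO k) (fun x h => h).
have DN0 := idx_gt0 (omod_OO nk) iN.
have exs : exists s, (0 < s)%N && `[< discriminant k K s%:R >].
  by have [s s0 ds] := frid_nat nk fK KO; exists s; rewrite s0; apply/asboolP.
case: (ex_minnP exs) => s /andP[s0 /asboolP ds] smin.
have [Kk K0 KD KM] := frid_omod fK.
pose ps := [seq q <- primes s | ~~ (q %| DN * l)%N].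
have psP q : q \in ps -> [/\ prime q, ~~ (q %| DN * l)%N & (q %| s)%N].
  by rewrite mem_filter mem_primes => /and4P[-> -> _ ->].
pose r := (\prod_(q <- ps) q)%N.
have r0 : (0 < r)%N.
  by rewrite /r big_seq prodn_cond_gt0 // => q /psP[qp _ _]; apply: prime_gt0.
exists phi, N, DN, s, r; split=> //; first by split; [exists n|exists n'].
split=> //.
  split=> //; apply: dvdn_primes_exp => // q qp qs.
  have [h|h] := boolP (q %| DN * l)%N; first by rewrite dvdn_mulr // mulnC.
  have qps : q \in ps by rewrite mem_filter h mem_primes qp s0.
  by rewrite dvdn_mull // /r (big_rem q) //= dvdn_mulr.
apply: (disc_index_gain nk nK nN gr grN l_prime zP cc iK iN).
  by rewrite filter_uniq // primes_uniq.
move=> q /psP[qp qd qs]; split=> // -[x [y [dx Oy E]]].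
(* If [q] were comaximal with the discriminant, then [s / q] would already lie in it, against the
   minimality of [s]. *)
have [s' sE] := dvdnP qs.
have s'0 : (0 < s')%N by move: s0; rewrite sE muln_gt0 => /andP[].
have : (s <= s')%N.
  apply: smin; rewrite s'0; apply/asboolP.
  have -> : s'%:R = s'%:R * x + y * s%:R.
    transitivity (s'%:R * (x + q%:R * y)); first by rewrite E mulr1.
    by rewrite sE natrM; ring.
  by apply: KD; apply: KM => //; apply: (OO_nat nk).
by rewrite sE -{2}[s']muln1 leq_pmul2l // leqNgt prime_gt1.
Qed.

(** Fields are sorted by [N], by [r] and by a map from [H] to [H]. Fields with the same data form a
    fibre for one [S]. *)
Lemma count_extensions (Q : finGroupType) X W Ks :
  (forall (S : nat) (gs : seq algC), (0 < S)%N -> uniq gs ->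
    (forall g, g \in gs -> selmer (adjoin k zeta) l S g) ->
    (forall g g' a, g \in gs -> g' \in gs -> adjoin k zeta a -> g = g' * a ^+ l -> g = g') ->
    (size gs <= l ^ (n1 * size (primes S)) * (#|Q| * l ^ n1.+1))%N) ->
  (forall S, (0 < S <= l * X)%N -> (l ^ (n1 * size (primes S)) <= W)%N) -> uniq Ks ->
  (forall K, K \in Ks -> galois_extension k K G /\
    exists2 DK, (DK <= X)%N & idx (OO k) (discriminant k K) DK) ->
  exists P : seq (set algC * nat), [/\ uniq P,
    forall q, q \in P -> [/\ galois_extension k q.1 H, (0 < q.2)%N &
      exists2 DN, (DN ^ l * q.2 ^ (#|H| * l.-1) <= X)%N & 
        omod k (discriminant k q.1) /\ idx (OO k) (discriminant k q.1) DN]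
  & (size Ks <= size P * (#|{ffun H -> H}| * (W * (#|Q| * l ^ n1.+1))))%N].
Proof.
move=> bound WP uKs KsP.
have r0 : (0 < #|H| * l.-1)%N by rewrite muln_gt0 -subn1 subn_gt0 prime_gt1 // -cardsT cardG_gt0.
pose good K (d : (algCaut -> G) * set algC * (nat * nat * nat)) :=
  let: (phi, N, (DN, s, r)) := d in
  [/\ (exists n, number_field n K) /\ (exists n, number_field n N),
      galrep k K phi, galrep k N (p \o phi), galois_extension k N H &
  [/\ idx (OO k) (discriminant k N) DN, discriminant k K s%:R,
      (0 < s)%N /\ (s %| (l * DN * r) ^ s)%N, (0 < DN)%N /\ (0 < r)%N
    & (DN ^ l * r ^ (#|H| * l.-1) <= X)%N]].
have exd K : exists d, K \in Ks -> good K d.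
  have [KKs|] := boolP (K \in Ks); last by exists ((fun=> 1%g), set0, (0%N, 0%N, 0%N)).
  have [gK [DK DKX iK]] := KsP K KKs.
  have [phi [N [DN [s [r [h1 h2 h3 h4 [h5 h6 h7 h8 h9]]]]]]] := extension_data gK iK.
  exists (phi, N, (DN, s, r)) => _; split=> //; split=> //.
  exact: leq_trans DKX.
have [d dP] := choice exd.
(* A reference identification of the Galois group of [N] with [H] is fixed; the one induced by [K]
   differs from it by a map [f K] of [H], which accounts for the factor [#|{ffun H -> H}|]. *)
have exr (N : set algC) : exists psi : algCaut -> H, (exists psi' : algCaut -> H, galrep k N psi') -> galrep k N psi.
  by have [[psi h]|h] := pselect (exists psi' : algCaut -> H, galrep k N psi'); [exists psi|exists (fun=> 1%g) => /h].
have [psi0 psi0P] := choice exr.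
have exf K : exists f : {ffun H -> H}, K \in Ks ->
    forall t, fixes k t -> p ((d K).1.1 t) = f (psi0 (d K).1.2 t).
  have [KKs|] := boolP (K \in Ks); last by exists [ffun h => h].
  have := dP K KKs; case: (d K) => [[phi N] [[DN s] r]] [_ gK gN _ _] /=.
  have g0 : galrep k N (psi0 N) by apply: psi0P; exists (p \o phi).
  exists [ffun h => p (phi (gsec g0 h))] => _ t ft; rewrite ffunE.
  apply: (gal_agreeP gN ft (gsec_fix g0 _)) => x Nx.
  exact: gsecE.
have [f fP] := choice exf.
pose P := undup [seq ((d K).1.2, (d K).2.2) | K <- Ks].
exists P; split; first exact: undup_uniq.
  move=> q; rewrite mem_undup => /mapP[K KKs ->] /=.
  have := dP K KKs; case: (d K) => [[phi N] [[DN s] r]] [[_ [n nN]] gK gN geN [iN _ _ [DN0 rp] DX]] /=.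
  split=> //; exists DN => //; split=> //; exact: frid_omod (disc_frid nk nN gN).1.
pose key K : set algC * nat * {ffun H -> H} := (((d K).1.2, (d K).2.2), f K).
pose ks := [seq (a, b) | a <- P, b <- enum {ffun H -> H}].
have -> : (size P * (#|{ffun H -> H}| * (W * (#|Q| * l ^ n1.+1))) =
   size ks * (W * (#|Q| * l ^ n1.+1)))%N.
  by rewrite size_allpairs -cardE mulnA.
apply: (size_fibers (key := key)) => [K KKs|c _].
  apply/allpairsP; exists (((d K).1.2, (d K).2.2), f K); split=> //; last by rewrite mem_enum.
  by rewrite mem_undup; apply/mapP; exists K.
have uL := filter_uniq (fun K => key K == c) uKs.
set L := [seq K <- Ks | _] in uL *.
have LP K : K \in L -> K \in Ks /\ key K = c by rewrite mem_filter => /andP[/eqP].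
have [[K1 K1L]|L0] := pselect (exists K1 : set algC, K1 \in L); last first.
  have -> : L = [::] by case E : L => [//|K1 L']; case: L0; exists K1; rewrite E mem_head.
  by [].
have [K1Ks K1c] := LP K1 K1L.
have := dP K1 K1Ks; case E1 : (d K1) => [[phi1 N1] [[DN1 s1] r1]] /= [[_ [n' nN1]] _ gN1 _ [iN1 _ _ [DN0 rp] DX]].
pose S := (l * DN1 * r1)%N.
have S0 : (0 < S)%N by rewrite !muln_gt0 prime_gt0 // DN0.
have SX : (S <= l * X)%N.
  rewrite /S -mulnA leq_mul2l; apply/orP; right; apply: leq_trans DX.
  by apply: leq_mul; rewrite -{1}[X in (X <= _)%N]expn1 leq_pexp2l // prime_gt0.
apply: leq_trans (leq_mul (WP S _) (leqnn _)); last by rewrite S0.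
apply: (fibre_bound nk nk1 l_prime zP cc bound (psi := fun t => f K1 (psi0 N1 t))) => // K KL.
have [KKs Kc] := LP K KL.
have := dP K KKs; have := fP K KKs; have : key K = key K1 by rewrite Kc K1c.
rewrite /key E1; case E : (d K) => [[phi N] [[DN s] r]] /= [NE rE fE] pE.
move=> [[[n nK] _] gK gN _ [iN ds [s0 sS] _ _]]; subst N1 r1.
have DNE : DN = DN1.
  exact: (idx_unique nk (frid_omod (disc_frid nk nN1 gN1).1) iN iN1).
subst DN1; exists n, phi, s, s; split=> // t ft.
by rewrite -fE pE.
Qed.

End Counting.

(** * Real estimates *)

Section RealBounds.
Variable R : realType.

Lemma ler_powRl (a b r : R) : 0 <= r -> 0 <= a -> a <= b -> a `^ r <= b `^ r.
Proof.
move=> r0 a0 ab; apply: ge0_ler_powR => //; rewrite nnegrE //; exact: le_trans ab.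
Qed.

(** Primes [q >= P0] satisfy [b <= q ^ eta] and pay for themselves; fewer than [P0] smaller ones
    exist, so [C = b ^ P0] covers them. *)
Lemma omega_bound (b : nat) (eta : R) : (0 < b)%N -> 0 < eta ->
  exists2 C : R, 0 < C & forall S, (0 < S)%N -> (b ^ size (primes S))%:R <= C * S%:R `^ eta.
Proof.
move=> b0 e0; set P0 := (Num.truncn (b%:R `^ eta^-1 : R)).+1.
have big p : (P0 <= p)%N -> b%:R <= p%:R `^ eta :> R.
  move=> Pp; have -> : b%:R = (b%:R `^ eta^-1) `^ eta :> R.
    by rewrite -powRrM mulVf ?gt_eqF // powRr1.
  apply: ler_powRl; rewrite ?powR_ge0 //; first exact: ltW.
  apply: le_trans (_ : P0%:R <= _); last by rewrite ler_nat.
  by apply: ltW; apply: truncnS_gt.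
exists (b ^ P0)%:R; first by rewrite ltr0n expn_gt0 b0.
move=> S S0; pose ps1 := [seq q <- primes S | (q < P0)%N]; pose ps2 := [seq q <- primes S | ~~ (q < P0)%N].
have -> : size (primes S) = (size ps1 + size ps2)%N.
  by rewrite !size_filter; have := count_predC (fun q => (q < P0)%N) (primes S).
rewrite expnD natrM; apply: ler_pM; rewrite ?ler0n //.
  rewrite ler_nat leq_pexp2l // -[X in (_ <= X)%N](size_iota 0).
  apply: uniq_leq_size => [|q]; first by rewrite filter_uniq // primes_uniq.
  by rewrite mem_filter mem_iota => /andP[].
have ps2P q : q \in ps2 -> prime q /\ (q %| S)%N.
  by rewrite mem_filter mem_primes => /and4P[_ -> _ ->].
have u2 : uniq ps2 by rewrite filter_uniq // primes_uniq.
apply: le_trans (_ : (\prod_(q <- ps2) q)%:R `^ eta <= _); last first.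
  apply: ler_powRl; rewrite ?ler0n ?ler_nat; first exact: ltW.
    by [].
  exact: dvdn_leq (prod_primes_dvd u2 ps2P).
have : all (fun q => (P0 <= q)%N) ps2.
  by apply/allP => q; rewrite mem_filter -leqNgt => /andP[].
elim: ps2 {ps2P u2} => [|q s IH] /=; first by rewrite big_nil powR1.
move=> /andP[Pq Ps]; rewrite big_cons expnS !natrM powRM ?ler0n //.
by apply: ler_pM; rewrite ?ler0n ?big ?IH.
Qed.

Lemma harmonic_ln (n : nat) : (0 < n)%N -> \sum_(r < n) (r.+1%:R)^-1 <= 1 + ln n%:R :> R.
Proof.
case: n => // n _; elim: n => [|n IH]; first by rewrite big_ord1 invr1 ln1 addr0.
rewrite big_ord_recr /=; apply: le_trans (lerD IH (lexx _)) _.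
have h : ln (1 + - n.+2%:R^-1) <= - n.+2%:R^-1 :> R.
  by apply: le_ln1Dx; rewrite ltrN2 invf_lt1 ?ltr0n // ltr1n.
have E : 1 + - n.+2%:R^-1 = n.+1%:R / n.+2%:R :> R.
  have n2 : n.+2%:R != 0 :> R by rewrite pnatr_eq0.
  by apply: (mulIf n2); rewrite mulrDl mul1r mulNr mulVf // divfK // -[n.+2%:R]natr1 addrK.
rewrite E lnM ?posrE ?invr_gt0 ?ltr0n // lnV ?posrE ?ltr0n // in h.
by move: h; rewrite -addrA lerD2l lerBlDl lerBrDr.
Qed.

Lemma ln_le_powR (x eta : R) : 1 <= x -> 0 < eta -> 1 + ln x <= (1 + eta^-1) * x `^ eta.
Proof.
move=> x1 e0; have x0 : 0 < x by apply: lt_le_trans x1.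
have h1 : 1 <= x `^ eta.
  by rewrite -(powRr0 x); apply: ler_powR => //; apply: ltW.
have h2 : ln x <= eta^-1 * x `^ eta.
  rewrite ler_pdivlMl // -ln_powR; apply/ltW/ln_sublinear; exact: powR_gt0.
by rewrite mulrDl mul1r lerD.
Qed.

(** With [z = x / r ^ r0 >= 1], the exponent [b / l] may be raised to [a], and [r ^ (r0 * a)] is at
    least [r]. The factor [1 / r] is what makes the sum over [r] harmonic. *)
Lemma height_bound (x b a : R) (r l r0 : nat) : (0 < r)%N -> (0 < l)%N -> (0 < r0)%N ->
  (r ^ r0)%:R <= x -> b <= l%:R * a -> r0%:R^-1 <= a ->
  ((x / (r ^ r0)%:R) `^ l%:R^-1) `^ b <= x `^ a / r%:R.
Proof.
move=> r_gt0 l_gt0 r0_gt0 rx ba ra.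
have rr : 0 < (r ^ r0)%:R :> R by rewrite ltr0n expn_gt0 r_gt0.
set z := x / _; have z1 : 1 <= z by rewrite ler_pdivlMr // mul1r.
rewrite -powRrM; apply: le_trans (_ : z `^ a <= _).
  by apply: ler_powR => //; rewrite ler_pdivrMl ?ltr0n.
rewrite ler_pdivlMr ?ltr0n //.
have -> : x = z * (r ^ r0)%:R by rewrite divfK // gt_eqF.
rewrite powRM ?(le_trans ler01 z1) ?ler0n //; apply: ler_wpM2l; first exact: powR_ge0.
have -> : r%:R = (r ^ r0)%:R `^ r0%:R^-1 :> R.
  by rewrite natrX -powR_mulrn ?ler0n // -powRrM mulfV ?powRr1 ?ler0n // pnatr_eq0 -lt0n.
by apply: ler_powR => //; rewrite ler1n expn_gt0 r_gt0.
Qed.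

(** For fixed [r] the fields [N] have discriminant norm at most the [l]-th root of [X / r ^ r0], so
    the hypothesis for [H] applies at that height. *)
Lemma pairs_bound m k (H : finGroupType) (C b a : R) (l r0 X : nat) (P : seq (set algC * nat)) :
  number_field m k -> 0 <= C -> (0 < l)%N -> (0 < r0)%N ->
  (forall y : R, 0 < y -> (Zcount k H y <= (C * y `^ b)%:E)%E) ->
  b <= l%:R * a -> r0%:R^-1 <= a -> uniq P ->
  (forall q, q \in P -> [/\ galois_extension k q.1 H, (0 < q.2)%N &
      exists2 DN, (DN ^ l * q.2 ^ r0 <= X)%N &
        omod k (discriminant k q.1) /\ idx (OO k) (discriminant k q.1) DN]) ->
  (size P)%:R <= C * X%:R `^ a * \sum_(r < X) (r.+1%:R)^-1.
Proof.
move=> nk C0 l_gt0 r0_gt0 HB ba ra uP PP.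
have PX q : q \in P -> (0 < q.2)%N /\ (q.2 ^ r0 <= X)%N.
  move=> /PP[_ q0 [DN DNX [_ iN]]]; split=> //; apply: leq_trans DNX.
  by apply: leq_pmull; rewrite expn_gt0 (idx_gt0 (omod_OO nk) iN).
have -> : size P = (\sum_(r < X) count (fun q => q.2 == r.+1) P)%N.
  have sum1 : (\sum_(q <- P) \sum_(r < X) (q.2 == r.+1 :> nat) = size P)%N.
    rewrite -sum1_size big_seq [RHS]big_seq; apply: eq_bigr => q qP.
    have [q0 qX] := PX q qP.
    have qX' : (q.2.-1 < X)%N.
      by rewrite prednK //; apply: leq_trans qX; rewrite -{1}[q.2]expn1 leq_pexp2l.
    rewrite (bigD1 (Ordinal qX')) //= prednK // eqxx big1 ?addn0 // => r rq.
    apply/eqP; rewrite eqb0; apply: contra rq => /eqP E.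
    by apply/eqP/val_inj; rewrite /= E.
  rewrite -{1}sum1 exchange_big /=; apply: eq_bigr => r _.
  by rewrite -sum1_count [RHS]big_mkcond /=; apply: eq_bigr => q _; case: eqP.
rewrite natr_sum mulr_sumr; apply: ler_sum => r _.
pose L := [seq q.1 | q <- P & q.2 == r.+1].
have -> : count (fun q => q.2 == r.+1) P = size L by rewrite size_map size_filter.
have [[q0 q0P]|L0] := pselect (exists q, q \in P /\ q.2 = r.+1); last first.
  have -> : L = [::].
    rewrite /L; case E : [seq q <- P | _] => [//|q s]; case: L0; exists q.
    have : q \in [seq q <- P | q.2 == r.+1] by rewrite E mem_head.
    by rewrite mem_filter => /andP[/eqP -> ->].
  by rewrite mulr_ge0 // mulr_ge0 // powR_ge0.
have [q0P' q0r] := q0P; have [_ rX] := PX q0 q0P'; rewrite q0r in rX.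
have uL : uniq L.
  rewrite map_inj_in_uniq ?filter_uniq // => -[N1 r1] [N2 r2].
  by rewrite !mem_filter /= => /andP[/eqP -> _] /andP[/eqP -> _] ->.
have rr : 0 < (r.+1 ^ r0)%:R :> R by rewrite ltr0n expn_gt0.
pose y : R := (X%:R / (r.+1 ^ r0)%:R) `^ l%:R^-1.
have z0 : 0 < X%:R / (r.+1 ^ r0)%:R :> R.
  by rewrite divr_gt0 // ltr0n; apply: leq_trans rX; rewrite expn_gt0.
have y0 : 0 < y by apply: powR_gt0.
have Ly : ((size L)%:R%:E <= Zcount k H y)%E.
  apply: counting_ge => // N /mapP[q]; rewrite mem_filter => /andP[/eqP qr qP] ->.
  have [gN _ [DN DNX [oN iN]]] := PP q qP; split=> //.
  rewrite (ideal_normE R nk oN iN) lee_fin /y.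
  have -> : DN%:R = (DN ^ l)%:R `^ l%:R^-1 :> R.
    by rewrite natrX -powR_mulrn ?ler0n // -powRrM mulfV ?powRr1 ?ler0n // pnatr_eq0 -lt0n.
  apply: ler_powRl; rewrite ?ler0n ?invr_ge0 ?ler0n //.
  by rewrite ler_pdivlMr // -natrM ler_nat -qr.
have := le_trans Ly (HB y y0); rewrite lee_fin => /le_trans; apply.
rewrite -mulrA; apply: ler_wpM2l => //; apply: height_bound => //.
by rewrite ler_nat.
Qed.

End RealBounds.

Theorem theorem5p1 (R : realType) (G H : finGroupType) (l m : nat)
  (zeta : algC) (c : set algC -> R)
  (l_prime : prime l)
  (H_primes : forall p, prime p -> (p < l)%N -> ~~ (p %| #|H|)%N)
  (G_ext : central_extension 'Z_l G H)
  (m_gt0 : (1 <= m)%N)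
  (zeta_prim : l.-primitive_root zeta)
  (c_gt0 : forall k, number_field m k -> 0 < c k)
  (H_bound : forall delta : R, 0 < delta -> exists C : R,
     forall k, number_field m k -> forall x : R, 0 < x ->
     (Zcount k H x <= (C * c k * x `^ (regular_a R H + delta))%:E)%E) :
  forall epsilon : R, 0 < epsilon -> exists C : R,
    forall k, number_field m k -> forall x : R, 0 < x ->
    (Zcount k G x <= (C * c k)%:E * card_class_group_ell R l (adjoin k zeta)
                * (x `^ (regular_a R G + epsilon))%:E)%E.
Proof.
move=> epsilon e0.
have [p [ex [cc psurj]]] := central_chr_exists l_prime zeta_prim G_ext.
have l_gt1 := prime_gt1 l_prime; have l_gt0 := prime_gt0 l_prime.
have H0 : (0 < #|H|)%N by rewrite -cardsT cardG_gt0.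
set r0 := (#|H| * l.-1)%N.
have r0_gt0 : (0 < r0)%N by rewrite muln_gt0 H0 -subn1 subn_gt0.
have [_ cardA _ _ _] := cc.
have cardG : #|G| = (#|H| * l)%N.
  have := Lagrange (finset.subsetT ('ker p)%G); rewrite cardsT => <-.
  rewrite cardA mulnC -cardsT -psurj; congr (_ * _)%N.
  have := card_morphim p [set: G]%SET; rewrite finset.setTI => ->.
  by rewrite -divgS ?finset.subsetT.
have aG : r0%:R^-1 <= regular_a R G.
  have [c0 c0A c01] : exists2 c0, c0 \in ('ker p)%g & c0 != 1%g.
    have := l_gt1; rewrite -cardA (cardD1 1%g) group1 ltnS => /card_gt0P[c0].
    by rewrite !inE => /andP[c01 pc]; exists c0 => //; rewrite in_kerE.
  have ordc : #[c0]%g = l.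
    have : (#[c0]%g %| l)%N by rewrite -cardA order_dvdG.
    by move=> /(prime_nt_dvdP l_prime) -> //; rewrite order_eq1.
  have := regular_a_ge R l_gt1 ordc; rewrite cardG.
  by rewrite -mulnA mulnCA mulKn.
have aH : regular_a R H <= l%:R * r0%:R^-1 by apply: regular_a_le.
pose eta := epsilon / 3%:R; have eta0 : 0 < eta by rewrite divr_gt0.
have [CH HB] := H_bound eta eta0.
(* Each prime number dividing [S] costs a factor [l ^ n1] in the Selmer bound, and [n1 <= m * l]. *)
have b0 : (0 < l ^ (m * l))%N by rewrite expn_gt0 l_gt0.
have [Cw Cw0 omega] := omega_bound b0 eta0.
set ff := #|{ffun H -> H}|.
(* The factors come from the hypothesis for [H] (with an absolute value, as its constant carries no
   sign condition), the harmonic sum, the identifications of quotients, the primes dividing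
   [S <= l * X], and the units. *)
pose C := `|CH| * (1 + eta^-1) * (ff%:R * (Cw * l%:R `^ eta * (l ^ (m * l).+1)%:R)).
have C0 : 0 <= C.
  by rewrite !mulr_ge0 ?ler0n ?powR_ge0 ?addr_ge0 ?invr_ge0 // ltW.
exists C => k nk x x0; have ck := ltW (c_gt0 k nk).
have [n1 n1l nk1] := number_field_adjoin nk zeta_prim.
have [Q [Qq bound]] := selmer_bound nk1 l_prime.
have QS : ((#|Q|%:R)%:E <= card_class_group_ell R l (adjoin k zeta))%E.
  by apply: ereal_sup_ubound; exists Q.
suff key : (Zcount k G x <= (C * c k * #|Q|%:R * x `^ (regular_a R G + epsilon))%:E)%E.
  apply: le_trans key _; rewrite !EFinM; apply: lee_wpmul2r.
    by rewrite lee_fin powR_ge0.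
  by rewrite -EFinM; apply: lee_wpmul2l => //; rewrite lee_fin mulr_ge0.
have DKP K : galois_extension k K G -> (ideal_norm R k (discriminant k K) <= x%:E)%E ->
    exists DK, [/\ idx (OO k) (discriminant k K) DK, (0 < DK)%N & DK%:R <= x].
  move=> gK Kx; have [phi [N [gr _ _ [[n nK] _]]]] := galois_extension_quotient gK psurj.
  have [fK KO] := disc_frid nk nK gr.
  have [DK iK] := idx_frid nk fK KO (A := OO k) (fun x h => h).
  exists DK; split=> //; first exact: idx_gt0 (omod_OO nk) iK.
  by move: Kx; rewrite (ideal_normE R nk (frid_omod fK) iK) lee_fin.
apply: counting_le => -[|K1 s'] us sP.
  by rewrite mulr_ge0 ?powR_ge0 // mulr_ge0 ?ler0n // mulr_ge0.
set s := K1 :: s' in us sP *.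
(* The norm of the discriminant of a counted field is a positive integer; an empty list was settled
   before. *)
have x1 : 1 <= x.
  have [gK1 K1x] := sP K1 (mem_head _ _).
  have [DK [_ D0 Dx]] := DKP K1 gK1 K1x.
  by apply: le_trans Dx; rewrite ler1n.
set X := Num.truncn x.
have xge0 := ltW x0.
have X0 : (0 < X)%N by rewrite truncn_ge_nat.
have Xx : X%:R <= x by rewrite truncn_le.
pose W := Num.truncn (Cw * (l * X)%:R `^ eta).
have W0 : 0 <= Cw * (l * X)%:R `^ eta by rewrite mulr_ge0 ?powR_ge0 // ltW.
have WP S : (0 < S <= l * X)%N -> (l ^ (n1 * size (primes S)) <= W)%N.
  move=> /andP[S0 SX]; rewrite truncn_ge_nat //.
  apply: le_trans (_ : ((l ^ (m * l)) ^ size (primes S))%:R <= _).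
    by rewrite ler_nat -expnM leq_pexp2l // leq_mul2r n1l orbT.
  apply: le_trans (omega S S0) _; apply: ler_wpM2l; first exact: ltW.
  by apply: ler_powRl; rewrite ?ler0n ?ler_nat // ltW.
have sP' K : K \in s -> galois_extension k K G /\
    exists2 DK, (DK <= X)%N & idx (OO k) (discriminant k K) DK.
  move=> /sP[gK Kx]; split=> //; have [DK [iK _ Dx]] := DKP K gK Kx.
  by exists DK => //; rewrite truncn_ge_nat.
have [P [uP PP sizeP]] := count_extensions nk nk1 l_prime zeta_prim cc psurj bound WP us sP'.
have CHk : 0 <= `|CH| * c k by rewrite mulr_ge0.
have HB' y : 0 < y -> (Zcount k H y <= (`|CH| * c k * y `^ (regular_a R H + eta))%:E)%E.
  move=> y0; apply: le_trans (HB k nk y y0) _; rewrite lee_fin.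
  by apply: ler_wpM2r; rewrite ?powR_ge0 //; apply: ler_wpM2r => //; apply: ler_norm.
(* The sum over [r] is run with the exponent [1 / r0 + eta]; the comparison of [1 / r0] with
   [regular_a R G] is made only at the end. *)
have ba : regular_a R H + eta <= l%:R * (r0%:R^-1 + eta).
  rewrite mulrDr lerD // -{1}[eta]mul1r ler_wpM2r //; first exact: ltW.
  by rewrite ler1n.
have ra : r0%:R^-1 <= r0%:R^-1 + eta by rewrite lerDl ltW.
have PB := pairs_bound nk CHk l_gt0 r0_gt0 HB' ba ra uP PP.
have PB' : (size P)%:R <= `|CH| * c k * X%:R `^ (r0%:R^-1 + eta) * ((1 + eta^-1) * X%:R `^ eta).
  apply: le_trans PB _; apply: ler_wpM2l; first by rewrite mulr_ge0 ?powR_ge0.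
  apply: le_trans (harmonic_ln R X0) _; apply: ln_le_powR => //.
  by rewrite ler1n.
have WB : W%:R <= Cw * (l%:R `^ eta * X%:R `^ eta).
  by rewrite -powRM ?ler0n // -natrM truncn_le.
apply: le_trans (_ : (size P * (ff * (W * (#|Q| * l ^ (m * l).+1))))%:R <= _).
  rewrite ler_nat; apply: leq_trans sizeP _.
  by rewrite !leq_mul2l leq_pexp2l ?orbT.
have XX : X%:R `^ (r0%:R^-1 + eta) * X%:R `^ eta * X%:R `^ eta <= x `^ (regular_a R G + epsilon).
  have Xn : X%:R != 0 :> R by rewrite pnatr_eq0 -lt0n.
  rewrite -!powRD ?Xn ?implybT //.
  have -> : r0%:R^-1 + eta + eta + eta = r0%:R^-1 + epsilon by rewrite -!addrA; congr (_ + _); rewrite /eta; field.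
  have ae : 0 <= r0%:R^-1 + epsilon by rewrite addr_ge0 ?invr_ge0 ?ler0n // ltW.
  apply: le_trans (ler_powRl ae (ler0n _ _) Xx) _.
  by apply: ler_powR => //; rewrite lerD2r.
rewrite !natrM.
apply: le_trans (_ : `|CH| * c k * X%:R `^ (r0%:R^-1 + eta) * ((1 + eta^-1) * X%:R `^ eta) *
   (ff%:R * (Cw * (l%:R `^ eta * X%:R `^ eta) * (#|Q|%:R * (l ^ (m * l).+1)%:R))) <= _).
  apply: ler_pM => //.
  by apply: ler_wpM2l; rewrite ?ler0n //; apply: ler_wpM2r; rewrite ?mulr_ge0 ?ler0n.
have -> : `|CH| * c k * X%:R `^ (r0%:R^-1 + eta) * ((1 + eta^-1) * X%:R `^ eta) *
   (ff%:R * (Cw * (l%:R `^ eta * X%:R `^ eta) * (#|Q|%:R * (l ^ (m * l).+1)%:R))) =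
  C * c k * #|Q|%:R * (X%:R `^ (r0%:R^-1 + eta) * X%:R `^ eta * X%:R `^ eta).
  rewrite /C; ring.
by apply: ler_wpM2l => //; rewrite mulr_ge0 ?ler0n // mulr_ge0.
Qed.
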